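(* Let $\mathbb K$ be a field, let $f:\mathbb N^k\to\mathbb N^\ell$ be a surjective monoid homomorphism, and let $\Gamma$ be a row-finite $\ell$-graph with no sources and finitely many vertices which is strongly aperiodic. Put $A=\mathrm{KP}_{\mathbb K}(f^*\Gamma)$, $H=\ker\bar f$, $C=\mathbb K[H]$. Let $T\in\mathrm{MT}(\Gamma)$, choose $w_T\in T$ and an aperiodic path $x_T\in w_T\Gamma_T^\infty$ such that $v\Gamma_Tw_T\neq\varnothing$ for every $v\in T$, and let $\mathfrak m\in\mathrm{MaxSpec}\,C$ with $\kappa(\mathfrak m)=C/\mathfrak m$. Then $$M(T,\mathfrak m):=\mathrm{Ind}_{\widetilde{x_T}}\bigl(\kappa(\mathfrak m)\bigr)$$ is a simple $A$-module and $$\mathrm{Ann}_A\,M(T,\mathfrak m)=P_{T,\mathfrak m},\qquad\text{where } P_{T,\mathfrak m}=I_{H_T}+A\,\iota(\mathfrak m).$$ Consequently, every ideal in the family $\{P_{T,\mathfrak m}:T\in\mathrm{MT}(\Gamma),\ \mathfrak m\in\mathrm{MaxSpec}\,C\}$ is realised as the annihilator of such an isotropy-induced module; if $\mathbb K$ is uncountable and algebraically closed, this accounts for every primitive ideal of $A$.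
   Context: $\mathbb N$ contains $0$. A $k$-graph is a countable small category $\Lambda$ with a functor $d:\Lambda\to\mathbb N^k$ satisfying the factorisation property: if $d(\lambda)=m+n$ there are unique composable $\mu,\nu$ with $\lambda=\mu\nu$, $d(\mu)=m$, $d(\nu)=n$. Objects are identified with $\Lambda^0=d^{-1}(0)$ (vertices); $r,s$ are range and source, and $\mu\nu$ is defined when $s(\mu)=r(\nu)$. Put $v\Lambda^n=\{\lambda: d(\lambda)=n,\ r(\lambda)=v\}$ and $v\Lambda w=\{\lambda:r(\lambda)=v,\ s(\lambda)=w\}$. $\Lambda$ is row-finite if every $v\Lambda^n$ is finite, and has no sources if every $v\Lambda^n$ is nonempty. For a commutative unital ring $R$ and a row-finite $k$-graph $\Lambda$ with no sources, $\mathrm{KP}_R(\Lambda)$ is the universal $R$-algebra generated by $\{p_v:v\in\Lambda^0\}\cup\{s_\lambda,s_{\lambda^*}:\lambda\in\Lambda\setminus\Lambda^0\}$, with $s_v=s_{v^*}=p_v$, subject to: (KP1) the $p_v$ are mutually orthogonal idempotents; (KP2) $s_\lambda s_\mu=s_{\lambda\mu}$ and $s_{\mu^*}s_{\lambda^*}=s_{(\lambda\mu)^*}$ whenever $\lambda\mu$ is defined, and $p_{r(\lambda)}s_\lambda=s_\lambda=s_\lambda p_{s(\lambda)}$, $p_{s(\lambda)}s_{\lambda^*}=s_{\lambda^*}=s_{\lambda^*}p_{r(\lambda)}$; (KP3) if $d(\lambda)=d(\mu)$ then $s_{\lambda^*}s_\mu=\delta_{\lambda,\mu}p_{s(\lambda)}$;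 (KP4) $p_v=\sum_{\lambda\in v\Lambda^n}s_\lambda s_{\lambda^*}$ for $v\in\Lambda^0$, $0\ne n\in\mathbb N^k$. It is unital, with $1=\sum_v p_v$, when $\Lambda^0$ is finite. Infinite paths of a $k$-graph $\Lambda$: $\Lambda^\infty$ is the set of degree-preserving functors $x:\{(p,q):p\le q\in\mathbb N^k\}\to\Lambda$ (with $d(x(p,q))=q-p$); $x(n)=x(n,n)$, $v\Lambda^\infty=\{x:x(0)=v\}$, $(\sigma^mx)(p,q)=x(p+m,q+m)$. A path $x$ is aperiodic if $\sigma^mx=\sigma^nx$ implies $m=n$. The graph $\Lambda$ is aperiodic if every $v\Lambda^\infty$ contains an aperiodic path. A set $L\subseteq\Gamma^0$ is hereditary if $v\in L$, $v\Gamma w\ne\varnothing$ imply $w\in L$; it is saturated if $v\in L$ whenever $s(v\Gamma^n)\subseteq L$ for some $0\ne n\in\mathbb N^\ell$. For saturated hereditary $L$, $\Gamma\setminus L=\{\lambda\in\Gamma:s(\lambda)\notin L\}$, an $\ell$-graph with vertex set $\Gamma^0\setminus L$. $\Gamma$ is strongly aperiodic if $\Gamma\setminus L$ is aperiodic for every proper saturated hereditary $L\subsetneq\Gamma^0$. A maximal tail is a nonempty $T\subseteq\Gamma^0$ with: (MT1) $w\in T$, $v\Gamma w\ne\varnothing$ imply $v\in T$; (MT2) for $v\in T$, $n\in\mathbb N^\ell$ there is $\lambda\in v\Gamma^n$ with $s(\lambda)\in T$; (MT3) for $v,w\in T$ there is $z\in T$ with $v\Gamma z\ne\varnothing$ and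 $w\Gamma z\ne\varnothing$. $\mathrm{MT}(\Gamma)$ is the set of maximal tails. $H_T=\Gamma^0\setminus T$ (saturated hereditary), $\Gamma_T=\Gamma\setminus H_T$, and $I_{H_T}$ is the two-sided ideal of $A$ generated by $\{p_v:v\in H_T\}$. Pullback: $f^*\Gamma=\{(\lambda,n)\in\Gamma\times\mathbb N^k:d(\lambda)=f(n)\}$, a $k$-graph with degree $d(\lambda,n)=n$ and product $(\lambda,n)(\mu,m)=(\lambda\mu,n+m)$; vertices $(v,0)$ are identified with $v\in\Gamma^0$. $\bar f:\mathbb Z^k\to\mathbb Z^\ell$ is the group completion of $f$. $\mathbb K[H]$ is the group algebra with basis $u_h$ ($h\in H$), $u_hu_g=u_{h+g}$. For $h\in H$ write $h=h_+-h_-$ (coordinatewise positive and negative parts) and put $U_h=\sum_{v\in\Gamma^0}\sum_{\lambda\in v\Gamma^{f(h_+)}}s_{(\lambda,h_+)}s_{(\lambda,h_-)^*}\in A$. The map $\iota:\mathbb K[H]\to A$, $u_h\mapsto U_h$, is an injective unital homomorphism with central image. Each $x\in\Gamma^\infty$ has the lift $\widetilde x\in(f^*\Gamma)^\infty$, $\widetilde x(p,q)=(x(f(p),f(q)),q-p)$. Induction: for a row-finite $k$-graph $\Lambda$ with no sources, $\mathcal G_\Lambda=\{(x,p-q,y):x,y\in\Lambda^\infty,\ \sigma^px=\sigma^qy\}$ is the infinite-path groupoid, with range $x$, source $y$, product $(x,a,y)(y,b,z)=(x,a+b,z)$. For a unit $x$, $(\mathcal G_\Lambda)_x$ is the isotropy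 group at $x$ and $L_x=s^{-1}(x)$. $\mathrm{KP}_{\mathbb K}(\Lambda)$ is identified with the Steinberg algebra of $\mathcal G_\Lambda$ by sending $s_\lambda s_{\mu^*}$ (with $s(\lambda)=s(\mu)$) to the indicator function of the bisection $Z(\lambda,\mu)=\{(\lambda z,d(\lambda)-d(\mu),\mu z):z\in s(\lambda)\Lambda^\infty\}$. It acts on the left of $\mathbb KL_x$ (the space with basis $L_x$): the indicator of a compact open bisection $D$ sends $\gamma\in L_x$ to $\beta\gamma$ if there is a (unique) $\beta\in D$ with $s(\beta)=r(\gamma)$, and to $0$ otherwise; $(\mathcal G_\Lambda)_x$ acts on the right by multiplication. For a left $\mathbb K(\mathcal G_\Lambda)_x$-module $V$, $\mathrm{Ind}_x(V)=\mathbb KL_x\otimes_{\mathbb K(\mathcal G_\Lambda)_x}V$. When $x\in\Gamma^\infty$ is aperiodic, the isotropy group of $\mathcal G_{f^*\Gamma}$ at $\widetilde x$ is $\{(\widetilde x,h,\widetilde x):h\in H\}\cong H$, and $\kappa(\mathfrak m)=C/\mathfrak m$ is a module over its group algebra via this identification with $C=\mathbb K[H]$. A primitive ideal is the annihilator of a simple left module. *)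

(* Defs.v *)
From HB Require Import structures.
From mathcomp Require Import all_boot all_order all_algebra.
From mathcomp Require Import boolp classical_sets functions cardinality fsbigop.
From mathcomp Require Import freeg.
From mathcomp Require Import zify.

Set Implicit Arguments.
Unset Strict Implicit.
Unset Printing Implicit Defensive.

Import Order.TTheory GRing.Theory Num.Theory.

Local Open Scope classical_set_scope.
Local Open Scope ring_scope.
Local Open Scope quotient_scope.

Notation nvec k := {ffun 'I_k -> nat}.
Notation zvec k := {ffun 'I_k -> int}.

Definition nle k (m n : nvec k) : bool := [forall i, m i <= n i]%N.

Definition nsub k (n m : nvec k) : nvec k := [ffun i => (n i - m i)%N].

Definition n2z k (m : nvec k) : zvec k := [ffun i => (m i)%:Z].

Definition zpos k (h : zvec k) : nvec k := [ffun i => `|Num.max (h i) 0|%N].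
Definition zneg k (h : zvec k) : nvec k := [ffun i => `|Num.max (- h i) 0|%N].

Section NVec.
Variable k : nat.
Implicit Types (m n p q : nvec k) (h : zvec k).

Lemma naddE m n i : (m + n) i = (m i + n i)%N.
Proof. by rewrite ffunE. Qed.

Lemma nleP m n : reflect (forall i, (m i <= n i)%N) (nle m n).
Proof. exact: forallP. Qed.

Lemma nle_refl m : nle m m.
Proof. by apply/nleP. Qed.

Lemma nle_addr m n : nle m (m + n).
Proof. by apply/nleP => i; rewrite ffunE leq_addr. Qed.

Lemma nle_addl m n : nle m (n + m).
Proof. by rewrite addrC nle_addr. Qed.

Lemma nle0 m : nle 0 m.
Proof. by apply/nleP => i; rewrite ffunE. Qed.

Lemma nle_trans n m p : nle m n -> nle n p -> nle m p.
Proof. by move=> /nleP h1 /nleP h2; apply/nleP => i; apply: leq_trans (h2 i). Qed.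

Lemma nle_add2r p m n : nle m n -> nle (m + p) (n + p).
Proof. by move=> /nleP h; apply/nleP => i; rewrite !ffunE leq_add2r. Qed.

Lemma nsubK m n : nle m n -> nsub n m + m = n.
Proof. by move=> /nleP h; apply/ffunP => i; rewrite !ffunE [LHS]subnK. Qed.

Lemma nsubKC m n : nle m n -> m + nsub n m = n.
Proof. by move=> h; rewrite addrC nsubK. Qed.

Lemma naddIr p m n : m + p = n + p -> m = n.
Proof.
by move=> /ffunP e; apply/ffunP => i; have := e i; rewrite !ffunE => /addIn.
Qed.

Lemma naddIl p m n : p + m = p + n -> m = n.
Proof. by rewrite ![p + _]addrC => /naddIr. Qed.

Lemma n2z0 : n2z 0 = 0 :> zvec k.
Proof. by apply/ffunP => i; rewrite !ffunE. Qed.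

Lemma n2zD m n : n2z (m + n) = n2z m + n2z n.
Proof. by apply/ffunP => i; rewrite !ffunE; exact: PoszD. Qed.

Lemma n2z_inj : injective (@n2z k).
Proof. by move=> m n /ffunP e; apply/ffunP => i; have := e i; rewrite !ffunE => -[]. Qed.

Lemma zpos_negB h : n2z (zpos h) - n2z (zneg h) = h.
Proof.
apply/ffunP => i; rewrite !ffunE.
case: (lerP 0 (h i)) => hi.
  by rewrite (max_idPr _) ?oppr_le0 // subr0 gez0_abs.
by rewrite (max_idPl _) ?oppr_ge0 1?ltW // sub0r gez0_abs ?opprK ?oppr_ge0 ?ltW.
Qed.

Lemma n2z_eqB (p q p' q' : nvec k) :
  n2z p - n2z q = n2z p' - n2z q' <-> p + q' = p' + q.
Proof.
split=> /ffunP e; apply/ffunP => i; have := e i; rewrite !(naddE, ffunE); lia.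
Qed.

End NVec.

Section Fbar.
Variables (k l : nat) (f : {additive nvec k -> nvec l}).

(** The group completion: every element of Z^k is a difference h_+ - h_-;
    [fbarB] shows that any presentation as a difference may be used. *)
Definition fbar (h : zvec k) : zvec l := n2z (f (zpos h)) - n2z (f (zneg h)).

Lemma fbarB (p q : nvec k) : fbar (n2z p - n2z q) = n2z (f p) - n2z (f q).
Proof.
apply/n2z_eqB; rewrite -!raddfD; congr (f _).
by apply/n2z_eqB; rewrite zpos_negB.
Qed.

Fact fbar_is_additive : zmod_morphism fbar.
Proof.
move=> g h; have -> : g - h = n2z (zpos g + zneg h) - n2z (zneg g + zpos h).
  rewrite -{1}[g]zpos_negB -{1}[h]zpos_negB !n2zD.
  by rewrite opprB addrACA -opprD.
rewrite fbarB !raddfD /= !n2zD /fbar.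
by rewrite opprK [- n2z _ + _]addrC addrACA -opprD.
Qed.

HB.instance Definition _ := GRing.isZmodMorphism.Build _ _ fbar fbar_is_additive.

Lemma f_mono (p q : nvec k) : nle p q -> nle (f p) (f q).
Proof. by move=> h; rewrite -(nsubKC h) raddfD nle_addr. Qed.

Lemma f_nsub (p q : nvec k) : nle p q -> f (nsub q p) = nsub (f q) (f p).
Proof.
move=> h; apply: (@naddIr _ (f p)).
by rewrite [RHS]nsubK ?f_mono // -(raddfD f) nsubK.
Qed.

End Fbar.

(** The objects form a separate type [V]; [idv] identifies them with the paths
    of degree 0 (see [deg0_idv]).  [comp] is a total function, whose value is
    only meaningful on composable pairs. *)
Record kgraph (k : nat) (V : countType) := KGraph {
  arr : countType;
  deg : arr -> nvec k;
  rng : arr -> V;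
  src : arr -> V;
  idv : V -> arr;
  comp : arr -> arr -> arr;
  rng_idv : forall v, rng (idv v) = v;
  src_idv : forall v, src (idv v) = v;
  rng_comp : forall a b, src a = rng b -> rng (comp a b) = rng a;
  src_comp : forall a b, src a = rng b -> src (comp a b) = src b;
  comp1p : forall a, comp (idv (rng a)) a = a;
  compp1 : forall a, comp a (idv (src a)) = a;
  compA : forall a b c, src a = rng b -> src b = rng c ->
    comp a (comp b c) = comp (comp a b) c;
  deg_idv : forall v, deg (idv v) = 0;
  deg_comp : forall a b, src a = rng b -> deg (comp a b) = deg a + deg b;
  factorisation : forall a m n, deg a = m + n ->
    exists! bc : arr * arr,
      [/\ src bc.1 = rng bc.2, comp bc.1 bc.2 = a, deg bc.1 = m & deg bc.2 = n]
}.

Arguments deg {k V _}.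
Arguments rng {k V _}.
Arguments src {k V _}.
Arguments idv {k V _}.
Arguments comp {k V _}.

Section KGraphTheory.
Variables (k : nat) (V : countType) (L : kgraph k V).
Implicit Types (a b c : arr L) (v w : V) (m n : nvec k).

(** [paths_from v n] is v\Lambda^n, and [conn v w] says that v\Lambda w is nonempty. *)
Definition paths_from v n : set (arr L) := [set a | rng a = v /\ deg a = n].
Definition conn v w : Prop := exists a : arr L, rng a = v /\ src a = w.

Definition row_finite : Prop := forall v n, finite_set (paths_from v n).
Definition no_sources : Prop := forall v n, paths_from v n !=set0.

Lemma fact_uniq a b a' b' : src a = rng b -> src a' = rng b' ->
  comp a b = comp a' b' -> deg a = deg a' -> a = a' /\ b = b'.
Proof.
move=> sab sab' e da.
have := factorisation (deg_comp sab) => -[[x y] [_ u]].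
have db : deg b' = deg b.
  by have := congr1 (@deg _ _ L) e; rewrite !deg_comp // da => /naddIl.
have e1 : (x, y) = (a, b) by apply: u.
have e2 : (x, y) = (a', b') by apply: u => /=; split.
by move: e2; rewrite e1 => -[].
Qed.

Lemma deg0_idv a : deg a = 0 -> a = idv (rng a).
Proof.
move=> da.
have [] := @fact_uniq a (idv (src a)) (idv (rng a)) a.
- by rewrite rng_idv.
- by rewrite src_idv.
- by rewrite compp1 comp1p.
- by rewrite deg_idv.
by [].
Qed.

Fact fact_exists a m : exists bc : arr L * arr L, nle m (deg a) ->
  [/\ src bc.1 = rng bc.2, comp bc.1 bc.2 = a & deg bc.1 = m].
Proof.
have [h|/negP h] := boolP (nle m (deg a)); last by exists (a, a).
have [bc [[s1 c1 d1 d2] _]] := factorisation (esym (nsubKC h)).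
by exists bc.
Qed.

(** The two factors of [a = head a m * tail a m], where [deg (head a m) = m]. *)
Definition head a m := (projT1 (cid (fact_exists a m))).1.
Definition tail a m := (projT1 (cid (fact_exists a m))).2.

Lemma headtailP a m : nle m (deg a) ->
  [/\ src (head a m) = rng (tail a m), comp (head a m) (tail a m) = a &
      deg (head a m) = m].
Proof. by rewrite /head /tail; case: cid. Qed.

Lemma headtailE a b : src a = rng b ->
  head (comp a b) (deg a) = a /\ tail (comp a b) (deg a) = b.
Proof.
move=> sab.
have [|s1 c1 d1] := @headtailP (comp a b) (deg a); first by rewrite deg_comp ?nle_addr.
by have [] := fact_uniq s1 sab c1 d1.
Qed.

(** [seg a p q] is the segment a(p, q) for p <= q <= deg a. *)
Definition seg a p q := tail (head a q) p.

Lemma segE a b c p q : src a = rng b -> src b = rng c ->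
  deg a = p -> deg a + deg b = q -> seg (comp (comp a b) c) p q = b.
Proof.
move=> sab sbc <- <-; rewrite /seg.
have sabc : src (comp a b) = rng c by rewrite src_comp.
have [] := headtailE sabc; rewrite deg_comp // => -> _.
by have [_ ->] := headtailE sab.
Qed.

Lemma seg_dec a p q : nle p q -> nle q (deg a) -> exists b c d,
  [/\ src b = rng c, src c = rng d, a = comp (comp b c) d, deg b = p & deg b + deg c = q].
Proof.
move=> pq qa; have [s1 c1 d1] := headtailP qa.
have pq' : nle p (deg (head a q)) by rewrite d1.
have [s2 c2 d2] := headtailP pq'.
exists (head (head a q) p), (tail (head a q) p), (tail a q).
split=> //; rewrite ?c2 ?c1 //.
  by rewrite -s1 -[in RHS]c2 src_comp.
by rewrite -deg_comp // c2.
Qed.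

Lemma seg_comp a b p q : nle p q -> nle q (deg a) -> src a = rng b ->
  seg (comp a b) p q = seg a p q.
Proof.
move=> pq qa sab; have [x [y [z [sxy syz ea dx dy]]]] := seg_dec pq qa.
have sz : src z = rng b by rewrite -sab ea src_comp // src_comp.
have sxyz : src (comp x y) = rng z by rewrite src_comp.
rewrite ea [RHS]segE // -compA // segE //.
by rewrite rng_comp.
Qed.

End KGraphTheory.

Arguments paths_from {k V} L v n.
Arguments conn {k V} L v w.
Arguments row_finite {k V} L.
Arguments no_sources {k V} L.

Section Paths.
Variables (k : nat) (V : countType) (L : kgraph k V).

(** Degree-preserving functors from the poset category of pairs p <= q. *)
Record inf_path := InfPath {
  pobj : nvec k -> V;
  parr : forall p q : nvec k, nle p q -> arr L;
  rng_parr : forall p q (h : nle p q), rng (parr h) = pobj p;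
  src_parr : forall p q (h : nle p q), src (parr h) = pobj q;
  parr_id : forall p (h : nle p p), parr h = idv (pobj p);
  parr_comp : forall p q r (h1 : nle p q) (h2 : nle q r) (h3 : nle p r),
    parr h3 = comp (parr h1) (parr h2);
  deg_parr : forall p q (h : nle p q), deg (parr h) = nsub q p
}.

HB.instance Definition _ := gen_eqMixin inf_path.
HB.instance Definition _ := gen_choiceMixin inf_path.

Lemma inf_pathP (x y : inf_path) :
  (forall p q (h : nle p q), parr x h = parr y h) -> x = y.
Proof.
case: x y => [o1 a1 r1 s1 i1 c1 d1] [o2 a2 r2 s2 i2 c2 d2] /= e.
have ea : a1 = a2.
  by apply: functional_extensionality_dep => p; apply: functional_extensionality_dep => q;
     apply: functional_extensionality_dep => h; exact: e.
have eo : o1 = o2.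
  by apply/funext => p; rewrite -(r1 _ _ (nle_refl p)) e r2.
subst a2 o2; by f_equal; exact: Prop_irrelevance.
Qed.

Lemma parr_irr (x : inf_path) p q p' q' (h : nle p q) (h' : nle p' q') :
  p = p' -> q = q' -> parr x h = parr x h'.
Proof. by move=> e1 e2; subst p' q'; rewrite (bool_irrelevance h h'). Qed.

Section Shift.
Variables (m : nvec k) (x : inf_path).

Definition shift_obj (p : nvec k) := pobj x (p + m).
Definition shift_arr p q (h : nle p q) := parr x (nle_add2r m h).

Fact shift_rng p q (h : nle p q) : rng (shift_arr h) = shift_obj p.
Proof. exact: rng_parr. Qed.
Fact shift_src p q (h : nle p q) : src (shift_arr h) = shift_obj q.
Proof. exact: src_parr. Qed.
Fact shift_id p (h : nle p p) : shift_arr h = idv (shift_obj p).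
Proof. exact: parr_id. Qed.
Fact shift_comp p q r (h1 : nle p q) (h2 : nle q r) (h3 : nle p r) :
  shift_arr h3 = comp (shift_arr h1) (shift_arr h2).
Proof. exact: parr_comp. Qed.
Fact shift_deg p q (h : nle p q) : deg (shift_arr h) = nsub q p.
Proof.
by rewrite deg_parr; apply/ffunP => i; rewrite !ffunE [LHS]subnDr.
Qed.

(** \sigma^m x *)
Definition shift : inf_path :=
  InfPath shift_rng shift_src shift_id shift_comp shift_deg.

End Shift.

Definition aperiodic_path (x : inf_path) : Prop :=
  forall m n : nvec k, shift m x = shift n x -> m = n.

Definition aperiodic : Prop :=
  forall v : V, exists x : inf_path, pobj x 0 = v /\ aperiodic_path x.

Lemma shift0 x : shift 0 x = x.
Proof. by apply: inf_pathP => p q h; rewrite /= /shift_arr /=; apply: parr_irr; rewrite addr0. Qed.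

Lemma shiftD m n x : shift m (shift n x) = shift (m + n) x.
Proof. by apply: inf_pathP => p q h; rewrite /= /shift_arr /=; apply: parr_irr; rewrite addrA. Qed.

(** [is_cat a z y] says that y is the infinite path a z. *)
Definition is_cat (a : arr L) (z y : inf_path) : Prop :=
  parr y (nle0 (deg a)) = a /\ shift (deg a) y = z.

Lemma is_cat_src a z y : is_cat a z y -> src a = pobj z 0.
Proof. by case=> <- <-; rewrite src_parr /= /shift_obj add0r deg_parr;
  congr pobj; apply/ffunP => i; rewrite !ffunE subn0. Qed.

Lemma is_cat_rng a z y : is_cat a z y -> pobj y 0 = rng a.
Proof. by case=> <- _; rewrite rng_parr. Qed.

Lemma deg_parr0 (x : inf_path) n : deg (parr x (nle0 n)) = n.
Proof. by rewrite deg_parr; apply/ffunP => i; rewrite !ffunE subn0. Qed.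

Lemma parr_seg (x : inf_path) p q n (h : nle p q) : nle q n ->
  parr x h = seg (parr x (nle0 n)) p q.
Proof.
move=> qn.
rewrite (parr_comp x (nle0 q) qn (nle0 n)) (parr_comp x (nle0 p) h (nle0 q)).
by rewrite segE ?rng_parr ?src_parr ?deg_parr0 // deg_parr nsubKC.
Qed.

Section Cat.
Variables (a : arr L) (z : inf_path).
Hypothesis saz : src a = pobj z 0.

Let W n := comp a (parr z (nle0 n)).

Let sW n : src a = rng (parr z (nle0 n)). Proof. by rewrite rng_parr. Qed.

Let nW n : nle n (deg (W n)).
Proof.
by rewrite /W deg_comp // deg_parr0 nle_addl.
Qed.

Let Wseg p q n : nle p q -> nle q n -> seg (W n) p q = seg (W q) p q.
Proof.
move=> pq qn; rewrite /W (parr_comp z (nle0 q) qn (nle0 n)) compA //; last first.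
  by rewrite src_parr rng_parr.
by rewrite seg_comp ?src_comp ?src_parr ?rng_parr //; exact: nW.
Qed.

Let obj (p : nvec k) := rng (seg (W p) p p).
Let arw (p q : nvec k) (h : nle p q) := seg (W q) p q.

Let dec p q (h : nle p q) : exists b c d,
  [/\ src b = rng c, src c = rng d, W q = comp (comp b c) d, deg b = p & deg b + deg c = q].
Proof. by apply: seg_dec => //; exact: nW. Qed.

Fact cat_rng p q (h : nle p q) : rng (arw h) = obj p.
Proof.
rewrite /obj -(@Wseg p p q (nle_refl p) h) /arw.
have [b [c [d [s1 s2 -> d1 d2]]]] := dec h.
rewrite segE // -compA // -[comp c d]comp1p rng_comp // compA ?src_idv ?rng_idv ?rng_comp //.
by rewrite segE ?rng_comp ?src_idv ?rng_idv // deg_idv addr0.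
Qed.

Fact cat_src p q (h : nle p q) : src (arw h) = obj q.
Proof.
rewrite /obj /arw; have [b [c [d [s1 s2 -> d1 d2]]]] := dec h.
rewrite segE // -[comp b c]compp1 segE ?rng_idv ?src_idv ?src_comp ?deg_comp //.
by rewrite deg_idv addr0.
Qed.

Fact cat_id p (h : nle p p) : arw h = idv (obj p).
Proof.
rewrite -(cat_rng h); apply: deg0_idv.
rewrite /arw; have [b [c [d [s1 s2 -> d1 d2]]]] := dec h.
by rewrite segE //; apply: (@naddIl _ p); rewrite addr0 -[in LHS]d1.
Qed.

Fact cat_comp p q r (h1 : nle p q) (h2 : nle q r) (h3 : nle p r) :
  arw h3 = comp (arw h1) (arw h2).
Proof.
rewrite /arw -(Wseg h1 h2).
have [b [c [d [s1 s2 -> d1 d2]]]] := dec h2.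
have pb : nle p (deg b) by rewrite d1.
have [s3 e3 d3] := headtailP pb; set b1 := head b p in s3 e3 d3 *.
set b2 := tail b p in s3 e3 d3 *.
have s4 : src b2 = rng c by rewrite -s1 -e3 src_comp.
rewrite [seg _ q r]segE // -e3.
have -> : comp (comp (comp b1 b2) c) d = comp (comp b1 (comp b2 c)) d by rewrite (compA s3 s4).
have -> : seg (comp (comp b1 (comp b2 c)) d) p r = comp b2 c.
  by apply: segE; rewrite ?rng_comp ?src_comp // deg_comp // addrA -(deg_comp s3) e3.
congr comp; apply/esym.
rewrite -(compA (b := comp b2 c)) ?rng_comp ?src_comp // -(compA (a := b2)) // compA ?rng_comp //.
by apply: segE; rewrite ?rng_comp // -(deg_comp s3) e3.
Qed.

Fact cat_deg p q (h : nle p q) : deg (arw h) = nsub q p.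
Proof.
rewrite /arw; have [b [c [d [s1 s2 -> d1 d2]]]] := dec h.
rewrite segE //; apply: (@naddIl _ p).
by rewrite nsubKC // -[in LHS]d1.
Qed.

Definition cat_path : inf_path := InfPath cat_rng cat_src cat_id cat_comp cat_deg.

Lemma cat_pathP : is_cat a z cat_path.
Proof.
split=> /=.
  rewrite /arw /W -[a in comp a]comp1p segE ?src_idv ?rng_parr ?deg_idv //.
  by rewrite add0r.
apply: inf_pathP => p q h /=; rewrite /shift_arr /= /arw.
rewrite /W (parr_comp z (nle0 q) (nle_addr q (deg a)) (nle0 _)).
rewrite (parr_comp z (nle0 p) h (nle0 q)).
rewrite !compA ?rng_parr ?src_parr ?rng_comp ?src_comp ?rng_parr ?src_parr //.
rewrite segE ?rng_comp ?src_comp ?rng_parr ?src_parr // deg_comp ?rng_parr // deg_parr0.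
  exact: addrC.
by rewrite deg_parr -addrA nsubKC // addrC.
Qed.

End Cat.

Lemma is_cat_inj a z y y' : is_cat a z y -> is_cat a z y' -> y = y'.
Proof.
have key u p q (h : nle p q) : is_cat a z u ->
  parr u h = seg (comp a (parr z (nle0 q))) p q.
  move=> [e1 e2]; rewrite (@parr_seg u p q (q + deg a) h (nle_addr _ _)).
  suff -> : parr u (nle0 (q + deg a)) = comp a (parr z (nle0 q)) by [].
  rewrite (parr_comp u (nle0 (deg a)) (nle_addl _ _) (nle0 _)) e1 -e2.
  by rewrite /= /shift_arr; congr (comp _ _); apply: parr_irr; rewrite ?add0r.
by move=> h h'; apply: inf_pathP => p q pq; rewrite (key y) // (key y').
Qed.

Lemma is_cat_idv v z y : pobj z 0 = v -> is_cat (idv v) z y <-> y = z.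
Proof.
move=> zv; split=> [[_]|->]; first by rewrite deg_idv shift0.
split; last by rewrite deg_idv shift0.
have -> : parr z (nle0 (deg (idv v : arr L))) = parr z (nle_refl 0) by apply: parr_irr; rewrite ?deg_idv.
by rewrite parr_id zv.
Qed.

Lemma is_cat_comp a b z y w : is_cat b z y -> is_cat a y w -> src a = rng b ->
  is_cat (comp a b) z w.
Proof.
move=> [e1 e2] [e3 e4] sab; split; last by rewrite -e2 -e4 shiftD deg_comp // addrC.
have h : nle (deg a) (deg (comp a b)) by rewrite deg_comp // nle_addr.
rewrite (parr_comp w (nle0 (deg a)) h) e3; congr comp.
rewrite -[RHS]e1 -e4 /= /shift_arr; apply: parr_irr; rewrite ?add0r //.
by rewrite deg_comp // addrC.
Qed.

Lemma is_cat_head m (y : inf_path) : is_cat (parr y (nle0 m)) (shift m y) y.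
Proof.
by split; rewrite ?deg_parr0 //; apply: parr_irr; rewrite ?deg_parr0.
Qed.

End Paths.

Arguments aperiodic {k V} L.
Arguments pobj {k V L}.
Arguments parr {k V L} i {p q}.
Arguments shift {k V L}.

Section Tails.
Variables (l : nat) (V : finType) (G : kgraph l V).
Implicit Types (X T : {set V}).

Definition hereditary X : Prop :=
  forall v w, v \in X -> conn G v w -> w \in X.

Definition saturated X : Prop :=
  forall v n, n != 0 -> (forall a, paths_from G v n a -> src a \in X) -> v \in X.

(** The last three clauses are (MT1), (MT2) and (MT3). *)
Definition maximal_tail T : Prop :=
  [/\ T != finset.set0,
      forall v w, w \in T -> conn G v w -> v \in T,
      forall v n, v \in T -> exists a, paths_from G v n a /\ src a \in T &
      forall v w, v \in T -> w \in T -> exists z, [/\ z \in T, conn G v z & conn G w z]].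

Lemma maximal_tail_hereditary T : maximal_tail T -> hereditary (~: T)%SET.
Proof.
case=> _ mt1 _ _ v w; rewrite !inE => vT vw.
by apply: contra vT => wT; exact: mt1 wT vw.
Qed.

(** The graph \Gamma \ X.  For composable a, b the composite has the source of
    b; on the other pairs the value of the total function is irrelevant. *)
Section Complement.
Variables (X : {set V}) (hX : hereditary X).

Let sV := {v : V | v \notin X}.
Let sA := {a : arr G | src a \notin X}.

Fact compl_rngP (a : sA) : rng (val a) \notin X.
Proof.
apply: contra (valP a) => /hX; apply.
by exists (val a).
Qed.

Fact compl_idP (v : sV) : src (idv (val v) : arr G) \notin X.
Proof. by rewrite src_idv; exact: (valP v). Qed.

Let deg' (a : sA) := deg (val a).
Let rng' (a : sA) : sV := Sub (rng (val a)) (compl_rngP a).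
Let src' (a : sA) : sV := Sub (src (val a)) (valP a).
Let idv' (v : sV) : sA := Sub (idv (val v)) (compl_idP v).
Let comp' (a b : sA) : sA := insubd a (comp (val a) (val b)).

Let sr (a b : sA) : src' a = rng' b -> src (val a) = rng (val b).
Proof. by move/(congr1 val); rewrite !SubK. Qed.

Let val_comp (a b : sA) : src' a = rng' b -> val (comp' a b) = comp (val a) (val b).
Proof. by move/sr => h; rewrite insubdK // unfold_in src_comp //; exact: (valP b). Qed.

Fact compl_rng_idv v : rng' (idv' v) = v.
Proof. by apply: val_inj; rewrite /= rng_idv. Qed.
Fact compl_src_idv v : src' (idv' v) = v.
Proof. by apply: val_inj; rewrite /= src_idv. Qed.
Fact compl_rng_comp a b : src' a = rng' b -> rng' (comp' a b) = rng' a.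
Proof. by move=> h; apply: val_inj; rewrite !SubK val_comp // rng_comp //; exact: sr. Qed.
Fact compl_src_comp a b : src' a = rng' b -> src' (comp' a b) = src' b.
Proof. by move=> h; apply: val_inj; rewrite !SubK val_comp // src_comp //; exact: sr. Qed.
Fact compl_comp1p a : comp' (idv' (rng' a)) a = a.
Proof. by apply: val_inj; rewrite val_comp ?compl_src_idv // !SubK comp1p. Qed.
Fact compl_compp1 a : comp' a (idv' (src' a)) = a.
Proof. by apply: val_inj; rewrite val_comp ?compl_rng_idv // !SubK compp1. Qed.
Fact compl_compA a b c : src' a = rng' b -> src' b = rng' c ->
  comp' a (comp' b c) = comp' (comp' a b) c.
Proof.
move=> h1 h2; apply: val_inj.
rewrite !val_comp ?compl_rng_comp ?compl_src_comp //.
by rewrite compA //; exact: sr.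
Qed.
Fact compl_deg_idv v : deg' (idv' v) = 0.
Proof. by rewrite /deg' SubK deg_idv. Qed.
Fact compl_deg_comp a b : src' a = rng' b -> deg' (comp' a b) = deg' a + deg' b.
Proof. by move=> h; rewrite /deg' val_comp // deg_comp //; exact: sr. Qed.
Fact compl_factorisation a m n : deg' a = m + n ->
  exists! bc : sA * sA,
    [/\ src' bc.1 = rng' bc.2, comp' bc.1 bc.2 = a, deg' bc.1 = m & deg' bc.2 = n].
Proof.
move=> /factorisation[[b c] [[/= s1 c1 d1 d2] u]].
have cX : src c \notin X by have : src (sval a) \notin X := valP a; rewrite -c1 src_comp.
have bX : src b \notin X by rewrite s1; exact: (compl_rngP (Sub c cX)).
have s1' : src' (Sub b bX) = rng' (Sub c cX) by apply: val_inj.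
exists (Sub b bX, Sub c cX); split=> /=.
  by split; rewrite /deg' ?SubK //; apply: val_inj; rewrite val_comp.
move=> [b' c'] [/= s2 c2 e1 e2].
have [eb ec] : b = val b' /\ c = val c'.
  have : (b, c) = (val b', val c'); last by case.
  by apply: u; split=> //=; [exact: sr|rewrite -val_comp // c2].
by congr pair; apply: val_inj; rewrite SubK.
Qed.

Definition compl_graph : kgraph l {v : V | v \notin X} :=
  KGraph compl_rng_idv compl_src_idv compl_rng_comp compl_src_comp
    compl_comp1p compl_compp1 compl_compA compl_deg_idv compl_deg_comp
    compl_factorisation.

Section Inclusion.
Variable x : inf_path compl_graph.

Let obj p := val (pobj x p).
Let arw (p q : nvec l) (h : nle p q) : arr G := val (parr x h : sA).

Fact incl_rng p q (h : nle p q) : rng (arw h) = obj p.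
Proof. by rewrite /obj -(rng_parr x h). Qed.
Fact incl_src p q (h : nle p q) : src (arw h) = obj q.
Proof. by rewrite /obj -(src_parr x h). Qed.
Fact incl_id p (h : nle p p) : arw h = idv (obj p).
Proof. by rewrite /arw parr_id. Qed.
Fact incl_comp p q r (h1 : nle p q) (h2 : nle q r) (h3 : nle p r) :
  arw h3 = comp (arw h1) (arw h2).
Proof.
rewrite /arw (parr_comp x h1 h2 h3) [LHS]val_comp //.
exact: (etrans (src_parr x h1) (esym (rng_parr x h2))).
Qed.
Fact incl_deg p q (h : nle p q) : deg (arw h) = nsub q p.
Proof. exact: (deg_parr x h). Qed.

Definition path_incl : inf_path G :=
  InfPath incl_rng incl_src incl_id incl_comp incl_deg.

End Inclusion.

Lemma path_incl_inj : injective path_incl.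
Proof.
move=> x y e; apply: inf_pathP => p q h; apply: val_inj.
by have := congr1 (fun u => parr u h) e.
Qed.

Lemma path_incl_aperiodic x : aperiodic_path x -> aperiodic_path (path_incl x).
Proof.
move=> hx m n e; apply: hx; apply: path_incl_inj.
have key p : path_incl (shift p x) = shift p (path_incl x) by exact: inf_pathP.
by rewrite !key.
Qed.

End Complement.

Definition strongly_aperiodic : Prop :=
  forall (X : {set V}) (hX : hereditary X), saturated X -> X != [set: V]%SET ->
    aperiodic (compl_graph hX).

(** \Gamma_T = \Gamma \ H_T with H_T the complement of T *)
Definition tail_graph T (hT : maximal_tail T) :=
  compl_graph (maximal_tail_hereditary hT).

End Tails.

Section Pullback.
Variables (k l : nat) (f : {additive nvec k -> nvec l}).
Variables (V : countType) (G : kgraph l V).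

Definition pb_arr := {a : arr G * nvec k | deg a.1 == f a.2}.
HB.instance Definition _ := Countable.on pb_arr.

Fact pb_idP v : deg (idv v : arr G, 0 : nvec k).1 == f (idv v : arr G, 0 : nvec k).2.
Proof. by rewrite /= deg_idv raddf0. Qed.

Let deg' (a : pb_arr) := (val a).2.
Let rng' (a : pb_arr) := rng (val a).1.
Let src' (a : pb_arr) := src (val a).1.
Let idv' v : pb_arr := Sub (idv v, 0) (pb_idP v).
Let comp' (a b : pb_arr) : pb_arr :=
  insubd a (comp (val a).1 (val b).1, (val a).2 + (val b).2).

Let val_comp (a b : pb_arr) : src' a = rng' b ->
  val (comp' a b) = (comp (val a).1 (val b).1, (val a).2 + (val b).2).
Proof.
move=> h; rewrite insubdK // unfold_in /= deg_comp // raddfD.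
by rewrite (eqP (valP a)) (eqP (valP b)).
Qed.

Fact pb_rng_idv v : rng' (idv' v) = v. Proof. exact: rng_idv. Qed.
Fact pb_src_idv v : src' (idv' v) = v. Proof. exact: src_idv. Qed.
Fact pb_rng_comp a b : src' a = rng' b -> rng' (comp' a b) = rng' a.
Proof. by move=> h; rewrite /rng' val_comp // rng_comp. Qed.
Fact pb_src_comp a b : src' a = rng' b -> src' (comp' a b) = src' b.
Proof. by move=> h; rewrite /src' val_comp // src_comp. Qed.
Fact pb_comp1p a : comp' (idv' (rng' a)) a = a.
Proof.
apply: val_inj; rewrite val_comp ?pb_src_idv // SubK /= comp1p add0r.
exact/esym/surjective_pairing.
Qed.
Fact pb_compp1 a : comp' a (idv' (src' a)) = a.
Proof.
apply: val_inj; rewrite val_comp ?pb_rng_idv // SubK /= compp1 addr0.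
exact/esym/surjective_pairing.
Qed.
Fact pb_compA a b c : src' a = rng' b -> src' b = rng' c ->
  comp' a (comp' b c) = comp' (comp' a b) c.
Proof.
move=> h1 h2; apply: val_inj.
by rewrite !val_comp ?pb_rng_comp ?pb_src_comp //= compA // addrA.
Qed.
Fact pb_deg_idv v : deg' (idv' v) = 0. Proof. by []. Qed.
Fact pb_deg_comp a b : src' a = rng' b -> deg' (comp' a b) = deg' a + deg' b.
Proof. by move=> h; rewrite /deg' val_comp. Qed.
Fact pb_factorisation a m n : deg' a = m + n ->
  exists! bc : pb_arr * pb_arr,
    [/\ src' bc.1 = rng' bc.2, comp' bc.1 bc.2 = a, deg' bc.1 = m & deg' bc.2 = n].
Proof.
move=> da; have : deg (val a).1 = f m + f n.
  by rewrite (eqP (valP a)) -raddfD; congr (f _).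
move=> /factorisation[[b c] [[/= s1 c1 d1 d2] u]].
have hb : deg (b, m).1 == f (b, m).2 by apply/eqP.
have hc : deg (c, n).1 == f (c, n).2 by apply/eqP.
exists (Sub (b, m) hb, Sub (c, n) hc); split=> /=.
  split=> //; apply: val_inj; rewrite val_comp //= c1 -da /deg'.
  exact/esym/surjective_pairing.
move=> [b' c'] [/= s2 c2 e1 e2].
have : (b, c) = ((val b').1, (val c').1).
  apply: u => /=; split=> //; first by rewrite -c2 val_comp.
    by rewrite (eqP (valP b')) -e1.
  by rewrite (eqP (valP c')) -e2.
case=> eb ec; congr pair; apply: val_inj; rewrite SubK.
  by rewrite eb -e1 -surjective_pairing.
by rewrite ec -e2 -surjective_pairing.
Qed.

(** f^*\Gamma; its vertices (v, 0) are identified with the vertices v of \Gamma. *)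
Definition pullback : kgraph k V :=
  KGraph pb_rng_idv pb_src_idv pb_rng_comp pb_src_comp pb_comp1p pb_compp1
    pb_compA pb_deg_idv pb_deg_comp pb_factorisation.

Section Lift.
Variable x : inf_path G.

Fact lift_arrP p q (h : nle p q) :
  deg (parr x (f_mono f h), nsub q p).1 == f (parr x (f_mono f h), nsub q p).2.
Proof. by rewrite /= deg_parr f_nsub. Qed.

Let obj p := pobj x (f p).
Let arw (p q : nvec k) (h : nle p q) : arr pullback :=
  (Sub (parr x (f_mono f h), nsub q p) (lift_arrP h) : pb_arr).

Fact lift_rng p q (h : nle p q) : rng (arw h) = obj p.
Proof. exact: rng_parr. Qed.
Fact lift_src p q (h : nle p q) : src (arw h) = obj q.
Proof. exact: src_parr. Qed.
Fact lift_id p (h : nle p p) : arw h = idv (obj p).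
Proof.
apply: val_inj; rewrite SubK /= parr_id; congr pair.
by apply/ffunP => i; rewrite !ffunE subnn.
Qed.
Fact lift_comp p q r (h1 : nle p q) (h2 : nle q r) (h3 : nle p r) :
  arw h3 = comp (arw h1) (arw h2).
Proof.
apply: val_inj; rewrite [RHS]val_comp; last first.
  by rewrite /src' /rng' /= src_parr rng_parr.
rewrite !SubK /= -(parr_comp x (f_mono f h1) (f_mono f h2) (f_mono f h3)).
congr pair; apply: (@naddIr _ p).
by rewrite nsubK // -addrA addrCA nsubK // nsubK.
Qed.
Fact lift_deg p q (h : nle p q) : deg (arw h) = nsub q p.
Proof. by []. Qed.

Definition path_lift : inf_path pullback :=
  InfPath lift_rng lift_src lift_id lift_comp lift_deg.

End Lift.

Lemma path_lift_shift (fsurj : forall n, exists m, f m = n) x (m n : nvec k) :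
  shift m (path_lift x) = shift n (path_lift x) -> shift (f m) x = shift (f n) x.
Proof.
move=> e; apply: inf_pathP => p' q' h'.
have [p ep] := fsurj p'; have [r er] := fsurj (nsub q' p').
have h : nle p (p + r) by exact: nle_addr.
have eq' : f (p + r) = q' by rewrite raddfD ep er nsubKC.
have /(congr1 (fun a : arr pullback => (val (a : pb_arr)).1)) :=
  congr1 (fun u => parr u h) e.
rewrite /= /shift_arr /= => e1.
have aux j : parr x (nle_add2r (f j) h') = parr x (f_mono f (nle_add2r j h)).
  by apply: parr_irr; rewrite raddfD ?ep ?eq'.
by rewrite !aux.
Qed.

Lemma shift_path_lift x (m n : nvec k) :
  f m = f n -> shift m (path_lift x) = shift n (path_lift x).
Proof.
move=> e; apply: inf_pathP => p q h; rewrite /= /shift_arr /=.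
apply: val_inj; rewrite !SubK; congr pair; last first.
  by apply/ffunP => i; rewrite !ffunE !subnDr.
by apply: parr_irr; rewrite !raddfD e.
Qed.

End Pullback.

Section Modules.
Variables (R : pzRingType) (M : lmodType R).

Definition submodule (N : set M) : Prop :=
  [/\ N 0, forall u v, N u -> N v -> N (u + v) & forall a u, N u -> N (a *: u)].

Definition simple_module : Prop :=
  (exists v : M, v <> 0) /\
  forall N : set M, submodule N -> N = [set 0] \/ N = setT.

Definition ann : set R := [set a | forall v : M, a *: v = 0].

Definition lspan (S : set M) : set M :=
  [set v | forall N, submodule N -> S `<=` N -> N v].

Lemma lspan_submodule S : submodule (lspan S).
Proof.
split=> [N [h0 _ _] _ //|u v hu hv N hN SN|a u hu N hN SN].
  by case: (hN) => _ hD _; apply: hD; [exact: hu|exact: hv].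
by case: (hN) => _ _ hZ; apply: hZ; exact: hu.
Qed.

Lemma sub_lspan S : S `<=` lspan S.
Proof. by move=> v Sv N _; exact. Qed.

Definition lspanb (S : set M) : {pred M} := fun v => `[< lspan S v >].

Fact lspanb_closed S : zmod_closed (lspanb S).
Proof.
have [h0 hD hZ] := lspan_submodule S.
split=> [|u v]; first exact/asboolP.
move=> /asboolP hu /asboolP hv; apply/asboolP; apply: hD => //.
by rewrite -scaleN1r; exact: hZ.
Qed.

HB.instance Definition _ S := GRing.isZmodClosed.Build M (lspanb S) (lspanb_closed S).

Definition lquot (S : set M) : Type := Quotient.quot (lspanb S).

HB.instance Definition _ S := GRing.Zmodule.on (lquot S).

Section LQuot.
Variable S : set M.

Definition lpi (v : M) : lquot S := \pi_(Quotient.quot (lspanb S)) v.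
Definition lrepr (q : lquot S) : M := repr (q : Quotient.quot (lspanb S)).

Lemma lreprK q : lpi (lrepr q) = q.
Proof. exact: reprK. Qed.

Lemma lpiP u v : lpi u = lpi v <-> lspan S (u - v).
Proof.
rewrite /lpi; split.
  by move/eqP; rewrite -Quotient.idealrBE => /asboolP.
by move=> h; apply/eqP; rewrite -Quotient.idealrBE; apply/asboolP.
Qed.

Lemma lpiD u v : lpi (u + v) = lpi u + lpi v.
Proof. by rewrite /lpi !piE. Qed.

Definition lquot_scale (a : R) (q : lquot S) : lquot S := lpi (a *: lrepr q).

Lemma lquot_scaleE a v : lquot_scale a (lpi v) = lpi (a *: v).
Proof.
apply/lpiP; rewrite -scalerBr; have [_ _ hZ] := lspan_submodule S.
by apply: hZ; apply/lpiP; rewrite lreprK.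
Qed.

Fact lquot_scaleA a b q : lquot_scale a (lquot_scale b q) = lquot_scale (a * b) q.
Proof. by rewrite -[q]lreprK !lquot_scaleE scalerA. Qed.
Fact lquot_scale1 q : lquot_scale 1 q = q.
Proof. by rewrite -[q]lreprK lquot_scaleE scale1r. Qed.
Fact lquot_scaleDr a q r : lquot_scale a (q + r) = lquot_scale a q + lquot_scale a r.
Proof. by rewrite -[q]lreprK -[r]lreprK -lpiD !lquot_scaleE scalerDr lpiD. Qed.
Fact lquot_scaleDl q a b : lquot_scale (a + b) q = lquot_scale a q + lquot_scale b q.
Proof. by rewrite -[q]lreprK !lquot_scaleE scalerDl lpiD. Qed.

HB.instance Definition _ := GRing.Zmodule_isLmodule.Build R (lquot S)
  lquot_scaleA lquot_scale1 lquot_scaleDr lquot_scaleDl.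

End LQuot.
End Modules.

Arguments simple_module {R} M.
Arguments ann {R} M.

Section Ideals.
Variable R : pzRingType.

Definition two_sided_ideal (J : set R) : Prop :=
  [/\ J 0, forall a b, J a -> J b -> J (a + b)
    & forall a b, J b -> J (a * b) /\ J (b * a)].

Definition ideal_gen (S : set R) : set R :=
  [set a | forall J, two_sided_ideal J -> S `<=` J -> J a].

(** R S, the set of the finite sums of products r s with s in S *)
Definition left_mul_set (S : set R) : set R :=
  [set a | exists n (r s : 'I_n -> R), (forall i, S (s i)) /\ a = \sum_i r i * s i].

Definition set_add (I J : set R) : set R := [set a + b | a in I & b in J].

Definition maximal_ideal (J : set R) : Prop :=
  [/\ two_sided_ideal J, J <> setT &
      forall J', two_sided_ideal J' -> J `<=` J' -> J' = J \/ J' = setT].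

Definition primitive_ideal (P : set R) : Prop :=
  exists M : lmodType R, simple_module M /\ P = ann M.

End Ideals.

Section Free.
Variables (R : nzRingType) (X : choiceType).

Lemma freeg_ind (P : {freeg X / R} -> Prop) :
  P 0 -> (forall u v, P u -> P v -> P (u + v)) -> (forall c x, P << c *g x >>) ->
  forall u, P u.
Proof. by move=> h0 hD hU u; rewrite -[u]freeg_sumE; apply: big_ind. Qed.

Lemma freegZU (c d : R) (x : X) : c *: << d *g x >> = << (c * d) *g x >>.
Proof. by apply/eqP/freeg_eqP => y; rewrite coeffZ !coeffU mulrA. Qed.

Variables (M : lmodType R) (f : X -> M).

HB.instance Definition _ := GRing.isZmodMorphism.Build {freeg X / R} M (fglift f)
  (lift_is_additive f).

Lemma fgliftZ c u : fglift f (c *: u) = c *: fglift f u.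
Proof.
elim/freeg_ind: u => [|u v eu ev|d x]; first by rewrite !(raddf0, scaler0).
  by rewrite scalerDr !raddfD /= eu ev.
by rewrite freegZU !liftU scalerA.
Qed.

Lemma fglift1 x : fglift f << x >> = f x.
Proof. by rewrite liftU scale1r. Qed.

Lemma freegU1 (c : R) (x : X) : << c *g x >> = c *: << x >>.
Proof. by rewrite freegZU mulr1. Qed.

End Free.

Section GroupAlgebra.
Variables (K : comNzRingType) (H : zmodType).

(** K[H]; the basis vector u_h is [<< h >>]. *)
Definition gralg : Type := {freeg H / K}.
HB.instance Definition _ := GRing.Lmodule.on gralg.

Implicit Types (a b c : gralg) (g h : H).

Definition gralg_mul a b : gralg :=
  fglift (fun g => fglift (fun h => (<< g + h >> : gralg)) b : gralg) a.

Definition gralg_one : gralg := << 0 >>.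

Lemma gralg_mulDl : left_distributive gralg_mul +%R.
Proof. by move=> a b c; rewrite /gralg_mul raddfD. Qed.

Lemma gralg_mul0l b : gralg_mul 0 b = 0.
Proof. by rewrite /gralg_mul raddf0. Qed.

Lemma gralg_mulZl x a b : gralg_mul (x *: a) b = x *: gralg_mul a b.
Proof. by rewrite /gralg_mul fgliftZ. Qed.

Lemma gralg_mulU g b : gralg_mul << g >> b = fglift (fun h => (<< g + h >> : gralg)) b.
Proof. by rewrite /gralg_mul fglift1. Qed.

Lemma gralg_ind (P : gralg -> Prop) :
  P 0 -> (forall a b, P a -> P b -> P (a + b)) ->
  (forall x a, P a -> P (x *: a)) -> (forall g, P << g >>) -> forall a, P a.
Proof.
move=> h0 hD hZ hU; apply: freeg_ind => // x g.
by rewrite freegU1; apply: hZ.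
Qed.

Lemma gralg_mulDr : right_distributive gralg_mul +%R.
Proof.
move=> a b c; elim/gralg_ind: a => [|a a' e e'|x a e|g].
- by rewrite !gralg_mul0l addr0.
- by rewrite !gralg_mulDl e e' addrACA.
- by rewrite !gralg_mulZl e scalerDr.
- by rewrite !gralg_mulU raddfD.
Qed.

Lemma gralg_mulZr x a b : gralg_mul a (x *: b) = x *: gralg_mul a b.
Proof.
elim/gralg_ind: a => [|a a' e e'|y a e|g].
- by rewrite !gralg_mul0l scaler0.
- by rewrite !gralg_mulDl e e' scalerDr.
- by rewrite !gralg_mulZl e !scalerA mulrC.
- by rewrite !gralg_mulU fgliftZ.
Qed.

Lemma gralg_mul0r a : gralg_mul a 0 = 0.
Proof. by rewrite -(scale0r (0 : gralg)) gralg_mulZr !scale0r. Qed.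

Lemma gralg_mulUU g h : gralg_mul << g >> << h >> = << g + h >>.
Proof. by rewrite gralg_mulU fglift1. Qed.

Fact gralg_mulC : commutative gralg_mul.
Proof.
move=> a b; elim/gralg_ind: a => [|a a' e e'|x a e|g].
- by rewrite gralg_mul0l gralg_mul0r.
- by rewrite gralg_mulDl gralg_mulDr e e'.
- by rewrite gralg_mulZl gralg_mulZr e.
elim/gralg_ind: b => [|b b' e e'|x b e|h].
- by rewrite gralg_mul0l gralg_mul0r.
- by rewrite gralg_mulDl gralg_mulDr e e'.
- by rewrite gralg_mulZl gralg_mulZr e.
- by rewrite !gralg_mulUU addrC.
Qed.

Fact gralg_mulA : associative gralg_mul.
Proof.
move=> a b c; elim/gralg_ind: a => [|a a' e e'|x a e|g].
- by rewrite !gralg_mul0l.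
- by rewrite !gralg_mulDl e e'.
- by rewrite !gralg_mulZl e.
elim/gralg_ind: b => [|b b' e e'|x b e|h].
- by rewrite !(gralg_mul0l, gralg_mul0r).
- by rewrite !(gralg_mulDl, gralg_mulDr) e e'.
- by rewrite !(gralg_mulZl, gralg_mulZr) e.
elim/gralg_ind: c => [|c c' e e'|x c e|i].
- by rewrite !gralg_mul0r.
- by rewrite !gralg_mulDr e e'.
- by rewrite !gralg_mulZr e.
- by rewrite !gralg_mulUU addrA.
Qed.

Fact gralg_mul1 : left_id gralg_one gralg_mul.
Proof.
move=> a; elim/gralg_ind: a => [|a a' e e'|x a e|g].
- by rewrite gralg_mul0r.
- by rewrite gralg_mulDr e e'.
- by rewrite gralg_mulZr e.
- by rewrite gralg_mulUU add0r.
Qed.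

Fact gralg_oner_neq0 : gralg_one != 0.
Proof. by rewrite /gralg_one freegU_eq0 oner_neq0. Qed.

HB.instance Definition _ := GRing.Zmodule_isComNzRing.Build gralg
  gralg_mulA gralg_mulC gralg_mul1 gralg_mulDl gralg_oner_neq0.

Fact gralg_scaleAl x a b : x *: (a * b) = (x *: a) * b.
Proof. by rewrite -gralg_mulZl. Qed.

HB.instance Definition _ := GRing.Lmodule_isLalgebra.Build K gralg gralg_scaleAl.
HB.instance Definition _ := GRing.Lalgebra_isComAlgebra.Build K gralg.

End GroupAlgebra.

Definition gralg_map (K : comNzRingType) (H H' : zmodType) (phi : H -> H')
  (a : gralg K H) : gralg K H' := fglift (fun h => (<< phi h >> : gralg K H')) a.

Section GroupAlgebraMap.
Variables (K : comNzRingType) (H H' : zmodType) (phi : {additive H -> H'}).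

Fact gralg_map_additive : zmod_morphism (gralg_map (K := K) phi).
Proof. by move=> a b; rewrite /gralg_map raddfB. Qed.

Fact gralg_map_multiplicative : monoid_morphism (gralg_map (K := K) phi).
Proof.
have mapZ x a : gralg_map phi (x *: a) = x *: (gralg_map phi a : gralg K H').
  exact: fgliftZ.
have mapU g : gralg_map phi (<< g >> : gralg K H) = << phi g >> by exact: fglift1.
have mapD a b : gralg_map phi (a + b) = (gralg_map phi a : gralg K H') + gralg_map phi b.
  by rewrite /gralg_map raddfD.
have map0 : gralg_map phi (0 : gralg K H) = 0 by rewrite /gralg_map raddf0.
split; first by rewrite [LHS]mapU raddf0.
move=> a b; elim/gralg_ind: a => [|a a' e e'|x a e|g].
- by rewrite mul0r map0 mul0r.
- by rewrite mulrDl !mapD e e' mulrDl.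
- by rewrite -scalerAl !mapZ e -scalerAl.
elim/gralg_ind: b => [|b b' e e'|x b e|h].
- by rewrite mulr0 map0 mulr0.
- by rewrite mulrDr !mapD e e' mulrDr.
- by rewrite -scalerAr !mapZ e -scalerAr.
- by rewrite [X in gralg_map phi X]gralg_mulUU !mapU [RHS]gralg_mulUU raddfD.
Qed.

HB.instance Definition _ := GRing.isZmodMorphism.Build _ _ (gralg_map (K := K) phi)
  gralg_map_additive.
HB.instance Definition _ := GRing.isMonoidMorphism.Build _ _ (gralg_map (K := K) phi)
  gralg_map_multiplicative.

End GroupAlgebraMap.

Definition restr (B C : pzRingType) (phi : {rmorphism B -> C}) (M : lmodType C) : Type := M.

Section Restriction.
Variables (B C : pzRingType) (phi : {rmorphism B -> C}) (M : lmodType C).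

Local Notation restr_scal := (restr phi M).

HB.instance Definition _ := GRing.Zmodule.on restr_scal.

Definition restr_scale (b : B) (v : restr_scal) : restr_scal := phi b *: (v : M).

Fact restr_scaleA a b v : restr_scale a (restr_scale b v) = restr_scale (a * b) v.
Proof. by rewrite /restr_scale scalerA rmorphM. Qed.
Fact restr_scale1 v : restr_scale 1 v = v.
Proof. by rewrite /restr_scale rmorph1 scale1r. Qed.
Fact restr_scaleDr a u v : restr_scale a (u + v) = restr_scale a u + restr_scale a v.
Proof. exact: scalerDr. Qed.
Fact restr_scaleDl v a b : restr_scale (a + b) v = restr_scale a v + restr_scale b v.
Proof. by rewrite /restr_scale rmorphD scalerDl. Qed.

HB.instance Definition _ := GRing.Zmodule_isLmodule.Build B restr_scal
  restr_scaleA restr_scale1 restr_scaleDr restr_scaleDl.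

End Restriction.

(** Expressions in the generators s_a, s_(a^* ) (a in \Lambda) and the operations of a
    K-algebra; the algebra is their quotient by the congruence generated by the
    axioms of (associative, not necessarily unital) K-algebras and (KP1)-(KP4). *)
Inductive kp_term (K : Type) (A : Type) : Type :=
| KPs of A
| KPss of A
| KPzero
| KPadd of kp_term K A & kp_term K A
| KPopp of kp_term K A
| KPscale of K & kp_term K A
| KPmul of kp_term K A & kp_term K A.

Arguments KPs {K A}.
Arguments KPss {K A}.
Arguments KPzero {K A}.

HB.instance Definition _ K A := gen_eqMixin (kp_term K A).
HB.instance Definition _ K A := gen_choiceMixin (kp_term K A).

Section KPCongruence.
Variables (K : fieldType) (k : nat) (V : finType) (L : kgraph k V).

Local Notation term := (kp_term K (arr L)).
Local Notation s_ a := (KPs a : term).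
Local Notation ss_ a := (KPss a : term).
Local Notation p_ v := (KPs (idv v : arr L) : term).
Local Infix "+t" := (@KPadd K (arr L)) (at level 50).
Local Infix "*t" := (@KPmul K (arr L)) (at level 40).
Local Infix "*:t" := (@KPscale K (arr L)) (at level 40).

Inductive kp_eqv : term -> term -> Prop :=
| kp_refl t : kp_eqv t t
| kp_sym t u : kp_eqv t u -> kp_eqv u t
| kp_trans t u w : kp_eqv t u -> kp_eqv u w -> kp_eqv t w
| kp_congD t t' u u' : kp_eqv t t' -> kp_eqv u u' -> kp_eqv (t +t u) (t' +t u')
| kp_congN t t' : kp_eqv t t' -> kp_eqv (KPopp t) (KPopp t')
| kp_congZ c t t' : kp_eqv t t' -> kp_eqv (c *:t t) (c *:t t')
| kp_congM t t' u u' : kp_eqv t t' -> kp_eqv u u' -> kp_eqv (t *t u) (t' *t u')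
| kp_addA t u w : kp_eqv (t +t (u +t w)) (t +t u +t w)
| kp_addC t u : kp_eqv (t +t u) (u +t t)
| kp_add0 t : kp_eqv (KPzero +t t) t
| kp_addN t : kp_eqv (KPopp t +t t) KPzero
| kp_scaleA c d t : kp_eqv (c *:t (d *:t t)) ((c * d) *:t t)
| kp_scale1 t : kp_eqv (1 *:t t) t
| kp_scaleDr c t u : kp_eqv (c *:t (t +t u)) (c *:t t +t c *:t u)
| kp_scaleDl c d t : kp_eqv ((c + d) *:t t) (c *:t t +t d *:t t)
| kp_mulA t u w : kp_eqv (t *t (u *t w)) (t *t u *t w)
| kp_mulDl t u w : kp_eqv ((t +t u) *t w) (t *t w +t u *t w)
| kp_mulDr t u w : kp_eqv (t *t (u +t w)) (t *t u +t t *t w)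
| kp_scaleAl c t u : kp_eqv (c *:t (t *t u)) (c *:t t *t u)
| kp_scaleAr c t u : kp_eqv (c *:t (t *t u)) (t *t (c *:t u))
| kp_vertex v : kp_eqv (ss_ (idv v)) (p_ v)
| kp1_idem v : kp_eqv (p_ v *t p_ v) (p_ v)
| kp1_orth v w : v <> w -> kp_eqv (p_ v *t p_ w) KPzero
| kp2_s a b : src a = rng b -> kp_eqv (s_ a *t s_ b) (s_ (comp a b))
| kp2_ss a b : src a = rng b -> kp_eqv (ss_ b *t ss_ a) (ss_ (comp a b))
| kp2_ps a : kp_eqv (p_ (rng a) *t s_ a) (s_ a)
| kp2_sp a : kp_eqv (s_ a *t p_ (src a)) (s_ a)
| kp2_pss a : kp_eqv (p_ (src a) *t ss_ a) (ss_ a)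
| kp2_ssp a : kp_eqv (ss_ a *t p_ (rng a)) (ss_ a)
| kp3_diag a : kp_eqv (ss_ a *t s_ a) (p_ (src a))
| kp3_off a b : deg a = deg b -> a <> b -> kp_eqv (ss_ a *t s_ b) KPzero
| kp4 v n (r : seq (arr L)) : n <> 0 -> uniq r ->
    (forall a, a \in r <-> paths_from L v n a) ->
    kp_eqv (p_ v) (foldr (fun a t => s_ a *t ss_ a +t t) KPzero r).

Definition kp_eqvb (t u : term) : bool := `[< kp_eqv t u >].

Fact kp_eqvb_equiv : equiv_class_of kp_eqvb.
Proof.
split=> [t|t u|u t w]; first exact/asboolP/kp_refl.
  by apply/asboolP/asboolP => /kp_sym.
by move=> /asboolP h1 /asboolP h2; apply/asboolP/(kp_trans h1 h2).
Qed.

Canonical kp_equiv := EquivRelPack kp_eqvb_equiv.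
Canonical kp_encModRel := defaultEncModRel kp_eqvb.

Definition KP : Type := {eq_quot kp_eqvb}.

HB.instance Definition _ := Choice.on KP.
HB.instance Definition _ := EqQuotient.on KP.

Definition kp_pi (t : term) : KP := \pi_({eq_quot kp_eqvb}) t.
Definition kp_repr (x : KP) : term := repr (x : {eq_quot kp_eqvb}).

Lemma kp_reprK x : kp_pi (kp_repr x) = x.
Proof. exact: reprK. Qed.

Lemma kp_piP t u : kp_pi t = kp_pi u <-> kp_eqv t u.
Proof.
have -> : kp_eqv t u <-> kp_eqvb t u by split=> /asboolP.
by split=> [e|e]; apply/eqmodP.
Qed.

Lemma kp_repr_pi t : kp_eqv (kp_repr (kp_pi t)) t.
Proof. by apply/kp_piP; rewrite kp_reprK. Qed.

Definition kp_zero : KP := kp_pi KPzero.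
Definition kp_add (x y : KP) := kp_pi (kp_repr x +t kp_repr y).
Definition kp_opp (x : KP) := kp_pi (KPopp (kp_repr x)).
Definition kp_scale (c : K) (x : KP) := kp_pi (c *:t kp_repr x).
Definition kp_mul (x y : KP) := kp_pi (kp_repr x *t kp_repr y).

Lemma kp_addE t u : kp_add (kp_pi t) (kp_pi u) = kp_pi (t +t u).
Proof. by apply/kp_piP/kp_congD; exact: kp_repr_pi. Qed.
Lemma kp_oppE t : kp_opp (kp_pi t) = kp_pi (KPopp t).
Proof. by apply/kp_piP/kp_congN; exact: kp_repr_pi. Qed.
Lemma kp_scaleE c t : kp_scale c (kp_pi t) = kp_pi (c *:t t).
Proof. by apply/kp_piP/kp_congZ; exact: kp_repr_pi. Qed.
Lemma kp_mulE t u : kp_mul (kp_pi t) (kp_pi u) = kp_pi (t *t u).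
Proof. by apply/kp_piP/kp_congM; exact: kp_repr_pi. Qed.

Let kpE := (kp_addE, kp_oppE, kp_scaleE, kp_mulE).

Ltac kp_lift := move=> *; repeat match goal with x : KP |- _ =>
  rewrite -(kp_reprK x); move: (kp_repr x) => {x} ? end; rewrite /kp_zero ?kpE.

Fact kp_add_A : associative kp_add.
Proof. by kp_lift; apply/kp_piP; exact: kp_addA. Qed.
Fact kp_add_C : commutative kp_add.
Proof. by kp_lift; apply/kp_piP; exact: kp_addC. Qed.
Fact kp_add_0 : left_id kp_zero kp_add.
Proof. by kp_lift; apply/kp_piP; exact: kp_add0. Qed.
Fact kp_add_N : left_inverse kp_zero kp_opp kp_add.
Proof. by kp_lift; apply/kp_piP; exact: kp_addN. Qed.

HB.instance Definition _ := GRing.isZmodule.Build KP kp_add_A kp_add_C kp_add_0 kp_add_N.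

Fact kp_scale_A c d x : kp_scale c (kp_scale d x) = kp_scale (c * d) x.
Proof. by kp_lift; apply/kp_piP; exact: kp_scaleA. Qed.
Fact kp_scale_1 : left_id 1 kp_scale.
Proof. by kp_lift; apply/kp_piP; exact: kp_scale1. Qed.
Fact kp_scale_Dr : right_distributive kp_scale +%R.
Proof.
move=> c x y; change (kp_scale c (kp_add x y) = kp_add (kp_scale c x) (kp_scale c y)).
by move: c x y; kp_lift; apply/kp_piP; exact: kp_scaleDr.
Qed.
Fact kp_scale_Dl x : {morph kp_scale^~ x : c d / c + d}.
Proof.
move=> c d; change (kp_scale (c + d) x = kp_add (kp_scale c x) (kp_scale d x)).
by move: c d x; kp_lift; apply/kp_piP; exact: kp_scaleDl.
Qed.

HB.instance Definition _ := GRing.Zmodule_isLmodule.Build K KP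
  kp_scale_A kp_scale_1 kp_scale_Dr kp_scale_Dl.

(** The generators s_a and s_(a^* ); p_v is [kp_s (idv v)]. *)
Definition kp_s (a : arr L) : KP := kp_pi (KPs a).
Definition kp_ss (a : arr L) : KP := kp_pi (KPss a).
Definition kp_p (v : V) : KP := kp_s (idv v).

Definition kp_one : KP := \sum_(v : V) kp_p v.

Fact kp_mul_A : associative kp_mul.
Proof. by kp_lift; apply/kp_piP; exact: kp_mulA. Qed.
Fact kp_mul_Dl : left_distributive kp_mul +%R.
Proof.
move=> x y z; change (kp_mul (kp_add x y) z = kp_add (kp_mul x z) (kp_mul y z)).
by move: x y z; kp_lift; apply/kp_piP; exact: kp_mulDl.
Qed.
Fact kp_mul_Dr : right_distributive kp_mul +%R.
Proof.
move=> x y z; change (kp_mul x (kp_add y z) = kp_add (kp_mul x y) (kp_mul x z)).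
by move: x y z; kp_lift; apply/kp_piP; exact: kp_mulDr.
Qed.

Fact kp_scale_Al c x y : c *: (kp_mul x y) = kp_mul (c *: x) y.
Proof.
change (kp_scale c (kp_mul x y) = kp_mul (kp_scale c x) y).
by move: c x y; kp_lift; apply/kp_piP; exact: kp_scaleAl.
Qed.
Fact kp_scale_Ar c x y : c *: (kp_mul x y) = kp_mul x (c *: y).
Proof.
change (kp_scale c (kp_mul x y) = kp_mul x (kp_scale c y)).
by move: c x y; kp_lift; apply/kp_piP; exact: kp_scaleAr.
Qed.

Let mul0k x : kp_mul 0 x = 0.
Proof. by rewrite -(scale0r (0 : KP)) -kp_scale_Al !scale0r. Qed.
Let mulk0 x : kp_mul x 0 = 0.
Proof. by rewrite -(scale0r (0 : KP)) -kp_scale_Ar !scale0r. Qed.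

Let mul_suml (r : seq V) x : kp_mul (\sum_(v <- r) kp_p v) x = \sum_(v <- r) kp_mul (kp_p v) x.
Proof. by elim: r => [|v r IH]; rewrite ?big_nil ?mul0k // !big_cons kp_mul_Dl IH. Qed.
Let mul_sumr (r : seq V) x : kp_mul x (\sum_(v <- r) kp_p v) = \sum_(v <- r) kp_mul x (kp_p v).
Proof. by elim: r => [|v r IH]; rewrite ?big_nil ?mulk0 // !big_cons kp_mul_Dr IH. Qed.

Lemma kp_ind (P : KP -> Prop) :
  P 0 -> (forall x y, P x -> P y -> P (x + y)) -> (forall c x, P x -> P (c *: x)) ->
  (forall x y, P x -> P y -> P (kp_mul x y)) ->
  (forall a, P (kp_s a)) -> (forall a, P (kp_ss a)) -> forall x, P x.
Proof.
move=> h0 hD hZ hM hs hss x; rewrite -(kp_reprK x).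
elim: (kp_repr x) => [a|a||t ht u hu|t ht|c t ht|t ht u hu].
- exact: hs.
- exact: hss.
- exact: h0.
- by rewrite -kp_addE; exact: hD.
- by rewrite -kp_oppE; have := hZ (-1) _ ht; rewrite scaleN1r.
- by rewrite -kp_scaleE; exact: hZ.
- by rewrite -kp_mulE; exact: hM.
Qed.

Let p_orth v w : kp_mul (kp_p v) (kp_p w) = if v == w then kp_p v else 0.
Proof.
rewrite /kp_p /kp_s kp_mulE; case: eqP => [<-|h]; first exact/kp_piP/kp1_idem.
exact/kp_piP/kp1_orth.
Qed.

Let one_p v : kp_mul kp_one (kp_p v) = kp_p v.
Proof.
rewrite /kp_one mul_suml (bigD1_seq v) ?mem_index_enum ?index_enum_uniq //= p_orth eqxx.
by rewrite big1 ?addr0 // => w /negbTE h; rewrite p_orth h.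
Qed.
Let p_one v : kp_mul (kp_p v) kp_one = kp_p v.
Proof.
rewrite /kp_one mul_sumr (bigD1_seq v) ?mem_index_enum ?index_enum_uniq //= p_orth eqxx.
by rewrite big1 ?addr0 // => w /negbTE h; rewrite p_orth eq_sym h.
Qed.

Fact kp_mul_1l : left_id kp_one kp_mul.
Proof.
move=> x; elim/kp_ind: x => [|x y ex ey|c x ex|x y ex ey|a|a].
- by rewrite mulk0.
- by rewrite kp_mul_Dr ex ey.
- by rewrite -kp_scale_Ar ex.
- by rewrite kp_mul_A ex.
- have e : kp_mul (kp_p (rng a)) (kp_s a) = kp_s a.
    by rewrite /kp_p /kp_s kp_mulE; apply/kp_piP/kp2_ps.
  by rewrite -e kp_mul_A one_p.
- have e : kp_mul (kp_p (src a)) (kp_ss a) = kp_ss a.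
    by rewrite /kp_p /kp_s /kp_ss kp_mulE; apply/kp_piP/kp2_pss.
  by rewrite -e kp_mul_A one_p.
Qed.

Fact kp_mul_1r : right_id kp_one kp_mul.
Proof.
move=> x; elim/kp_ind: x => [|x y ex ey|c x ex|x y ex ey|a|a].
- by rewrite mul0k.
- by rewrite kp_mul_Dl ex ey.
- by rewrite -kp_scale_Al ex.
- by rewrite -kp_mul_A ey.
- have e : kp_mul (kp_s a) (kp_p (src a)) = kp_s a.
    by rewrite /kp_p /kp_s kp_mulE; apply/kp_piP/kp2_sp.
  by rewrite -e -kp_mul_A p_one.
- have e : kp_mul (kp_ss a) (kp_p (rng a)) = kp_ss a.
    by rewrite /kp_p /kp_s /kp_ss kp_mulE; apply/kp_piP/kp2_ssp.
  by rewrite -e -kp_mul_A p_one.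
Qed.

HB.instance Definition _ := GRing.Zmodule_isPzRing.Build KP
  kp_mul_A kp_mul_1l kp_mul_1r kp_mul_Dl kp_mul_Dr.

Lemma kp_scalerAl c (x y : KP) : c *: (x * y) = (c *: x) * y.
Proof. exact: kp_scale_Al. Qed.
Lemma kp_scalerAr c (x y : KP) : c *: (x * y) = x * (c *: y).
Proof. exact: kp_scale_Ar. Qed.

End KPCongruence.

Arguments kp_s {K k V L}.
Arguments kp_ss {K k V L}.
Arguments kp_p {K k V L}.

Section Groupoid.
Variables (k : nat) (V : countType) (L : kgraph k V).

(** Triples (x, h, y), with range x and source y; [gmul g h] is the product
    when [gsrc g = grng h]. *)
Definition gtriple : Type := (inf_path L * zvec k * inf_path L)%type.
HB.instance Definition _ := Choice.on gtriple.

Definition grng (g : gtriple) := g.1.1.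
Definition gdeg (g : gtriple) := g.1.2.
Definition gsrc (g : gtriple) := g.2.
Definition gmul (g h : gtriple) : gtriple := (grng g, gdeg g + gdeg h, gsrc h).

Definition in_grpd (g : gtriple) : Prop := exists p q : nvec k,
  gdeg g = n2z p - n2z q /\ shift p (grng g) = shift q (gsrc g).

(** Z(a, b), for s(a) = s(b) *)
Definition cyl (a b : arr L) : set gtriple :=
  [set g | exists z : inf_path L,
     [/\ is_cat a z (grng g), gdeg g = n2z (deg a) - n2z (deg b) & is_cat b z (gsrc g)]].

Lemma grpd_id x : in_grpd (x, 0, x).
Proof. by exists 0, 0; rewrite /= subrr. Qed.

Lemma grpd_mul g h : in_grpd g -> in_grpd h -> gsrc g = grng h -> in_grpd (gmul g h).
Proof.
move=> [p [q [e1 e2]]] [p' [q' [e3 e4]]] e.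
exists (p' + p), (q + q'); split.
  change (gdeg g + gdeg h = n2z (p' + p) - n2z (q + q')).
  by rewrite e1 e3 !n2zD addrACA -opprD [n2z p + _]addrC.
change (shift (p' + p) (grng g) = shift (q + q') (gsrc h)).
by rewrite -(shiftD p' p) e2 shiftD e [p' + q]addrC -(shiftD q p') e4 shiftD.
Qed.

Lemma cyl_grpd a b g : cyl a b g -> in_grpd g.
Proof. by move=> [z [[_ e1] e2 [_ e3]]]; exists (deg a), (deg b); rewrite e1 e3. Qed.

(** L_x = s^(-1)(x) *)
Definition srcfib (x : inf_path L) : Type :=
  {g : gtriple | `[< in_grpd g /\ gsrc g = x >]}.
HB.instance Definition _ x := Choice.on (srcfib x).

Lemma srcfibP x (g : srcfib x) : in_grpd (val g) /\ gsrc (val g) = x.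
Proof. exact/asboolP/(valP g). Qed.

(** The isotropy group at x, where (x, h, x) is represented by h. *)
Definition iso_pred (x : inf_path L) : {pred zvec k} :=
  fun h => `[< in_grpd (x, h, x) >].

Fact iso_zmod_closed x : zmod_closed (iso_pred x).
Proof.
split=> [|g h]; first exact/asboolP/grpd_id.
move=> /asboolP hg /asboolP [p [q [e1 e2]]]; apply/asboolP.
apply: (@grpd_mul (x, g, x) (x, - h, x)) => //.
by exists q, p; rewrite /gdeg /= in e1 e2 *; rewrite e1 opprB.
Qed.

HB.instance Definition _ x := GRing.isZmodClosed.Build _ (iso_pred x) (iso_zmod_closed x).

Definition isotropy (x : inf_path L) : Type := {h : zvec k | h \in iso_pred x}.
HB.instance Definition _ x := SubChoice.on (isotropy x).
HB.instance Definition _ x := [SubChoice_isSubZmodule of isotropy x by <:].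

Lemma isotropyP x (h : isotropy x) : in_grpd (x, val h, x).
Proof. exact/asboolP/(valP h). Qed.

Fact fib_iso_subproof x (g : srcfib x) (h : isotropy x) :
  `[< in_grpd (gmul (val g) (x, val h, x)) /\ gsrc (gmul (val g) (x, val h, x)) = x >].
Proof.
have [g1 g2] := srcfibP g; apply/asboolP; split=> //.
by apply: grpd_mul => //; exact: isotropyP.
Qed.

Definition fib_iso x (g : srcfib x) (h : isotropy x) : srcfib x :=
  Sub (gmul (val g) (x, val h, x)) (fib_iso_subproof g h).

(** The partial map g |-> b g on L_x, where b is the element of the bisection D
    with s(b) = r(g), if there is one. *)
Definition bis_map (D : set gtriple) x (g : srcfib x) : option (srcfib x) :=
  match pselect (exists b, D b /\ gsrc b = grng (val g)) with
  | left e => insub (gmul (projT1 (cid e)) (val g))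
  | right _ => None
  end.

Variable K : fieldType.

(** The indicator function of D acting on the free module on L_x *)
Definition bis_act (D : set gtriple) x : {freeg (srcfib x) / K} -> {freeg (srcfib x) / K} :=
  fglift (fun g => if bis_map D g is Some g' then << g' >> else 0).

(** The right action of K[isotropy x] on the free module on L_x *)
Definition iso_act x (m : {freeg (srcfib x) / K}) (b : gralg K (isotropy x)) :
    {freeg (srcfib x) / K} :=
  fglift (fun g => fglift (fun h => (<< fib_iso g h >> : {freeg (srcfib x) / K})) b) m.

End Groupoid.

Arguments bis_map {k V L} D {x} g.
Arguments bis_act {k V L K} D {x}.

Section KPAction.
Variables (K : fieldType) (k : nat) (V : finType) (L : kgraph k V) (x : inf_path L).

Local Notation fib := (srcfib x).
Local Notation KL := {freeg fib / K}.

Implicit Types (a b : arr L) (v w : V) (g : fib) (m : KL).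

Let Sm a : fib -> option fib := bis_map (cyl a (idv (src a))).
Let SSm a : fib -> option fib := bis_map (cyl (idv (src a)) a).

(** The identification of KP_K(\Lambda) with the Steinberg algebra sends s_a s_(b^* )
    to the indicator function of Z(a, b); this prescribes the action of the
    generators, and [kp_act_cyl] recovers the rule for all s_a s_(b^* ). *)
Definition act_s a : KL -> KL := bis_act (cyl a (idv (src a))).
Definition act_ss a : KL -> KL := bis_act (cyl (idv (src a)) a).

Fixpoint term_act (t : kp_term K (arr L)) : KL -> KL :=
  match t with
  | KPs a => act_s a
  | KPss a => act_ss a
  | KPzero => fun _ => 0
  | KPadd t u => fun m => term_act t m + term_act u m
  | KPopp t => fun m => - term_act t m
  | KPscale c t => fun m => c *: term_act t m
  | KPmul t u => fun m => term_act t (term_act u m)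
  end.

Lemma opt_ext (T : Type) (o1 o2 : option T) :
  (forall y, o1 = Some y <-> o2 = Some y) -> o1 = o2.
Proof.
case: o1 => [y|] h; first by apply/esym/h.
by case: o2 h => [y|//] h; apply/h.
Qed.

Lemma fib_inj g g' : grng (val g) = grng (val g') -> gdeg (val g) = gdeg (val g') -> g = g'.
Proof.
move=> e1 e2; apply: val_inj; have [_ e3] := srcfibP g; have [_ e4] := srcfibP g'.
move: e1 e2 e3 e4; case: (val g) => [[r d] s]; case: (val g') => [[r' d'] s'].
by rewrite /grng /gdeg /gsrc /= => -> -> -> ->.
Qed.

Lemma cyl_uniq a b (g h : gtriple L) : cyl a b g -> cyl a b h -> gsrc g = gsrc h -> g = h.
Proof.
move=> [z [c1 d1 [e1 f1]]] [z' [c2 d2 [e2 f2]]] e.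
have ez : z = z' by rewrite -f1 -f2 e.
move: c1 c2 d1 d2 e; rewrite -ez => c1 c2 d1 d2 e.
have er := is_cat_inj c1 c2.
move: er d1 d2 e; case: g {c1 f1 e1} => [[r d] s]; case: h {c2 f2 e2} => [[r' d'] s'].
by rewrite /grng /gdeg /gsrc /= => -> -> -> ->.
Qed.

Lemma bis_mapP a b g g' : bis_map (cyl a b) g = Some g' <->
  exists be, [/\ cyl a b be, gsrc be = grng (val g) & val g' = gmul be (val g)].
Proof.
rewrite /bis_map; case: pselect => [e|ne]; last first.
  by split=> // -[be [h1 h2 _]]; case: ne; exists be.
case: (cid e) => be0 [h1 h2] /=.
have hm : `[< in_grpd (gmul be0 (val g)) /\ gsrc (gmul be0 (val g)) = x >].
  have [g1 g2] := srcfibP g; apply/asboolP; split=> //.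
  by apply: grpd_mul => //; exact: cyl_grpd h1.
rewrite insubT; split=> [[<-]|[be [h3 h4 h5]]]; first by exists be0; rewrite SubK.
have eb : be = be0 by apply: (cyl_uniq h3 h1); rewrite h2 h4.
by congr Some; apply: val_inj; rewrite SubK [RHS]h5 eb.
Qed.

Lemma SmP a g g' : Sm a g = Some g' <->
  is_cat a (grng (val g)) (grng (val g')) /\ gdeg (val g') = n2z (deg a) + gdeg (val g).
Proof.
rewrite /Sm bis_mapP; split=> [[be [[z [c1 d1 c2]] e ->]]|[c d]].
  have ez : gsrc be = z by apply/(is_cat_idv (v := src a)) => //; exact/esym/(is_cat_src c1).
  rewrite deg_idv n2z0 subr0 in d1.
  by split; [rewrite -e ez|rewrite -d1].
exists (grng (val g'), n2z (deg a), grng (val g)); split=> //.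
  exists (grng (val g)); split=> //.
    by rewrite /gdeg /= deg_idv n2z0 subr0.
  by apply/is_cat_idv => //; exact/esym/(is_cat_src c).
have [_ e1] := srcfibP g; have [_ e2] := srcfibP g'.
rewrite /gmul e1; move: d e2; case: (val g') => [[r dd] s].
by rewrite /grng /gdeg /gsrc /= => -> ->.
Qed.

Lemma SSmP a g g' : SSm a g = Some g' <->
  is_cat a (grng (val g')) (grng (val g)) /\ gdeg (val g') = gdeg (val g) - n2z (deg a).
Proof.
rewrite /SSm bis_mapP; split=> [[be [[z [c1 d1 c2]] e ->]]|[c d]].
  have ez : grng be = z by apply/(is_cat_idv (v := src a)) => //; exact/esym/(is_cat_src c2).
  rewrite deg_idv n2z0 sub0r in d1.
  split; first by rewrite -e [grng _]ez.
  by rewrite addrC -d1.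
exists (grng (val g'), - n2z (deg a), grng (val g)); split=> //.
  exists (grng (val g')); split=> //.
    by apply/is_cat_idv => //; exact/esym/(is_cat_src c).
  by rewrite /gdeg /= deg_idv n2z0 sub0r.
have [_ e1] := srcfibP g; have [_ e2] := srcfibP g'.
rewrite /gmul e1; move: d e2; case: (val g') => [[r dd] s].
by rewrite /grng /gdeg /gsrc /= => -> ->; rewrite addrC.
Qed.

Lemma PmP v g g' : Sm (idv v) g = Some g' <-> pobj (grng (val g)) 0 = v /\ g' = g.
Proof.
rewrite SmP; split=> [[c d]|[e ->]].
  have e : pobj (grng (val g)) 0 = v by rewrite -(is_cat_src c) src_idv.
  split=> //; apply: fib_inj; first exact/(is_cat_idv _ e).
  by rewrite d deg_idv n2z0 add0r.
by split; [apply/is_cat_idv|rewrite deg_idv n2z0 add0r].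
Qed.

Lemma PPmE v g : SSm (idv v) g = Sm (idv v) g.
Proof.
apply: opt_ext => g'; rewrite PmP SSmP; split=> [[c d]|[e ->]].
  have e : pobj (grng (val g')) 0 = v by rewrite -(is_cat_src c) src_idv.
  have eg : g' = g.
    apply: fib_inj; first exact/esym/(is_cat_idv _ e).
    by rewrite d deg_idv n2z0 subr0.
  by rewrite -eg.
by split; [apply/is_cat_idv|rewrite deg_idv n2z0 subr0].
Qed.

Lemma Sm_total a g : src a = pobj (grng (val g)) 0 -> exists g', Sm a g = Some g'.
Proof.
move=> e; have c := cat_pathP e; set y := cat_path e in c.
set be : gtriple L := (y, n2z (deg a), grng (val g)).
have hb : cyl a (idv (src a)) be.
  exists (grng (val g)); split=> //; first by rewrite /gdeg /= deg_idv n2z0 subr0.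
  exact/is_cat_idv.
have hm : `[< in_grpd (gmul be (val g)) /\ gsrc (gmul be (val g)) = x >].
  have [g1 g2] := srcfibP g; apply/asboolP; split=> //.
  by apply: grpd_mul => //; exact: cyl_grpd hb.
by exists (Sub (gmul be (val g)) hm); apply/bis_mapP; exists be; split=> //.
Qed.

Lemma SSm_total a z g : is_cat a z (grng (val g)) ->
  exists g', SSm a g = Some g' /\ grng (val g') = z.
Proof.
move=> c; set be : gtriple L := (z, - n2z (deg a), grng (val g)).
have hb : cyl (idv (src a)) a be.
  exists z; split=> //; last by rewrite /gdeg /= deg_idv n2z0 sub0r.
  by apply/is_cat_idv => //; exact/esym/(is_cat_src c).
have hm : `[< in_grpd (gmul be (val g)) /\ gsrc (gmul be (val g)) = x >].
  have [g1 g2] := srcfibP g; apply/asboolP; split=> //.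
  by apply: grpd_mul => //; exact: cyl_grpd hb.
exists (Sub (gmul be (val g)) hm); split; last by rewrite SubK.
by apply/bis_mapP; exists be.
Qed.

Let obindE (o : option fib) (F : fib -> option fib) g' :
  obind F o = Some g' <-> exists g, o = Some g /\ F g = Some g'.
Proof.
case: o => [g|] /=; last by split=> // -[g []].
by split=> [e|[h [[<-]]]]; first by exists g.
Qed.

Let PP v w g : v <> w -> obind (Sm (idv v)) (Sm (idv w) g) = None.
Proof.
move=> vw; apply: opt_ext => g'; split=> //.
by rewrite obindE => -[h [/PmP[e1 ->] /PmP[e2 _]]]; case: vw; rewrite -e1 -e2.
Qed.

Let PPv v g : obind (Sm (idv v)) (Sm (idv v) g) = Sm (idv v) g.
Proof.
apply: opt_ext => g'; rewrite obindE; split=> [[h [h1 /PmP[_ ->]]] //|h].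
by exists g'; split=> //; apply/PmP; case/PmP: h => e ->.
Qed.

Let SSc a b g : src a = rng b -> obind (Sm a) (Sm b g) = Sm (comp a b) g.
Proof.
move=> sab; apply: opt_ext => g'; rewrite obindE; split.
  move=> [h [/SmP[c1 d1] /SmP[c2 d2]]]; apply/SmP; split.
    exact: is_cat_comp c1 c2 sab.
  by rewrite d2 d1 deg_comp // n2zD addrA.
move=> /SmP[c d].
have sb : src b = pobj (grng (val g)) 0 by rewrite -(is_cat_src c) src_comp.
have [h hh] := Sm_total sb; exists h; split=> //.
have [c1 d1] := (SmP _ _ _).1 hh.
have sa : src a = pobj (grng (val h)) 0 by rewrite (is_cat_rng c1).
have [h' hh'] := Sm_total sa; have [c2 d2] := (SmP _ _ _).1 hh'.
suff -> : g' = h' by [].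
apply: fib_inj; first exact: is_cat_inj c (is_cat_comp c1 c2 sab).
by rewrite d d2 d1 deg_comp // n2zD addrA.
Qed.

Let SSSc a b g : src a = rng b -> obind (SSm b) (SSm a g) = SSm (comp a b) g.
Proof.
move=> sab; apply: opt_ext => g'; rewrite obindE; split.
  move=> [h [/SSmP[c1 d1] /SSmP[c2 d2]]]; apply/SSmP; split.
    exact: is_cat_comp c2 c1 sab.
  by rewrite d2 d1 deg_comp // n2zD opprD addrA.
move=> /SSmP[c d].
have sb : src b = pobj (grng (val g')) 0 by rewrite -(is_cat_src c) src_comp.
have cb := cat_pathP sb; set y := cat_path sb in cb.
have sa : src a = pobj y 0 by rewrite (is_cat_rng cb).
have ca := cat_pathP sa; set y' := cat_path sa in ca.
have ey : y' = grng (val g) by exact: is_cat_inj (is_cat_comp cb ca sab) c.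
rewrite ey in ca; have [h [hh eh]] := SSm_total ca; exists h; split=> //.
have [_ d1] := (SSmP _ _ _).1 hh.
apply/SSmP; rewrite eh; split=> //.
by rewrite d d1 deg_comp // n2zD opprD addrA.
Qed.

Let PS a g : obind (Sm (idv (rng a))) (Sm a g) = Sm a g.
Proof.
apply: opt_ext => g'; rewrite obindE; split=> [[h [h1 /PmP[_ ->]]] //|h].
exists g'; split=> //; apply/PmP; split=> //.
by have [c _] := (SmP _ _ _).1 h; rewrite (is_cat_rng c).
Qed.

Let SP a g : obind (Sm a) (Sm (idv (src a)) g) = Sm a g.
Proof.
apply: opt_ext => g'; rewrite obindE; split=> [[h [/PmP[_ ->]]] //|h].
exists g; split=> //; apply/PmP; split=> //.
by have [c _] := (SmP _ _ _).1 h; rewrite (is_cat_src c).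
Qed.

Let PSS a g : obind (Sm (idv (src a))) (SSm a g) = SSm a g.
Proof.
apply: opt_ext => g'; rewrite obindE; split=> [[h [h1 /PmP[_ ->]]] //|h].
exists g'; split=> //; apply/PmP; split=> //.
by have [c _] := (SSmP _ _ _).1 h; rewrite (is_cat_src c).
Qed.

Let SSP a g : obind (SSm a) (Sm (idv (rng a)) g) = SSm a g.
Proof.
apply: opt_ext => g'; rewrite obindE; split=> [[h [/PmP[_ ->]]] //|h].
exists g; split=> //; apply/PmP; split=> //.
by have [c _] := (SSmP _ _ _).1 h; rewrite (is_cat_rng c).
Qed.

Let SSS_diag a g : obind (SSm a) (Sm a g) = Sm (idv (src a)) g.
Proof.
apply: opt_ext => g'; rewrite obindE; split.
  move=> [h [/SmP[c1 d1] /SSmP[c2 d2]]]; apply/PmP; split; first by rewrite (is_cat_src c1).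
  apply: fib_inj; first by case: c1 c2 => _ <- [_ <-].
  by rewrite d2 d1 addrAC subrr add0r.
move=> /PmP[e ->]; have [h hh] := Sm_total (esym e).
exists h; split=> //; have [c d] := (SmP _ _ _).1 hh.
by apply/SSmP; split=> //; rewrite d addrAC subrr add0r.
Qed.

Let SSS_off a b g : deg a = deg b -> a <> b -> obind (SSm a) (Sm b g) = None.
Proof.
move=> dab ab; apply: opt_ext => g'; split=> //; rewrite obindE.
move=> [h [/SmP[[e1 _] _] /SSmP[[e2 _] _]]]; case: ab.
by rewrite -e1 -e2; apply: parr_irr.
Qed.

Let og (o : option fib) : KL := if o is Some g then << g >> else 0.

Lemma bis_actU D g : bis_act (K := K) D (<< g >> : KL) = og (bis_map D g).
Proof. exact: fglift1. Qed.

Lemma bis_act_og D o : bis_act (K := K) D (og o) = og (obind (bis_map D) o).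
Proof. by case: o => [g|] /=; [exact: bis_actU|rewrite /bis_act raddf0]. Qed.

Lemma term_actD t m m' : term_act t (m + m') = term_act t m + term_act t m'.
Proof.
elim: t m m' => [a|a||t ht u hu|t ht|c t ht|t ht u hu] m m' /=.
- by rewrite /act_s /bis_act raddfD.
- by rewrite /act_ss /bis_act raddfD.
- by rewrite addr0.
- by rewrite ht hu addrACA.
- by rewrite ht opprD.
- by rewrite ht scalerDr.
- by rewrite hu ht.
Qed.

Lemma term_actZ t c m : term_act t (c *: m) = c *: term_act t m.
Proof.
elim: t m => [a|a||t ht u hu|t ht|d t ht|t ht u hu] m /=.
- by rewrite /act_s /bis_act fgliftZ.
- by rewrite /act_ss /bis_act fgliftZ.
- by rewrite scaler0.
- by rewrite ht hu scalerDr.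
- by rewrite ht scalerN.
- by rewrite ht !scalerA mulrC.
- by rewrite hu ht.
Qed.

Lemma term_act0 t : term_act t 0 = 0.
Proof. by rewrite -(scale0r (0 : KL)) term_actZ !scale0r. Qed.

Lemma term_act_ext t u :
  (forall g, term_act t << g >> = term_act u << g >>) -> term_act t =1 term_act u.
Proof.
move=> h m; elim/freeg_ind: m => [|m m' e e'|c g].
- by rewrite !term_act0.
- by rewrite !term_actD e e'.
- by rewrite freegU1 !term_actZ h.
Qed.

Let actSU a g : act_s a << g >> = og (Sm a g). Proof. exact: bis_actU. Qed.
Let actSSU a g : act_ss a << g >> = og (SSm a g). Proof. exact: bis_actU. Qed.
Let actSo a o : act_s a (og o) = og (obind (Sm a) o). Proof. exact: bis_act_og. Qed.
Let actSSo a o : act_ss a (og o) = og (obind (SSm a) o). Proof. exact: bis_act_og. Qed.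

Let actE := (actSU, actSSU, actSo, actSSo).

Lemma act_kp4 v n (r : seq (arr L)) g : uniq r ->
  (forall a, a \in r <-> paths_from L v n a) ->
  act_s (idv v) << g >> = \sum_(a <- r) act_s a (act_ss a << g >>).
Proof.
move=> ur hr; rewrite actE.
under eq_bigr do rewrite !actE.
have [e|ne] := EM (pobj (grng (val g)) 0 = v); last first.
  rewrite big_seq big1 => [|a /hr[ra da]].
    by case E: (Sm _ _) => [g'|] //; case/PmP: E => /ne.
  case E: (SSm a g) => [g'|] //=.
  by have [c _] := (SSmP _ _ _).1 E; case: ne; rewrite (is_cat_rng c).
have -> : Sm (idv v) g = Some g by apply/PmP.
set a0 := parr (grng (val g)) (nle0 n).
have a0r : a0 \in r by apply/hr; split; rewrite ?rng_parr ?deg_parr0.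
rewrite (bigD1_seq a0) //= big_seq_cond big1 ?addr0 => [|a /andP[/hr[ra da] /eqP na]].
  have c : is_cat a0 (shift n (grng (val g))) (grng (val g)) by exact: is_cat_head.
  have [h [hh eh]] := SSm_total c; rewrite hh /=.
  have [_ d] := (SSmP _ _ _).1 hh.
  suff -> : Sm a0 h = Some g by [].
  by apply/SmP; rewrite eh d; split=> //; rewrite addrCA subrr addr0.
case E: (SSm a g) => [g'|] //=; have [[e1 _] _] := (SSmP _ _ _).1 E.
by case: na; rewrite -e1 /a0; apply: parr_irr.
Qed.

Lemma term_act_foldr (r : seq (arr L)) m :
  term_act (foldr (fun a t => KPadd (KPmul (KPs a) (KPss a)) t) KPzero r) m =
  \sum_(a <- r) act_s a (act_ss a m).
Proof. by elim: r => [|a r IH] /=; rewrite ?big_nil // big_cons IH. Qed.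

Lemma term_act_eqv t u : kp_eqv t u -> term_act t =1 term_act u.
Proof.
elim=> {t u}.
- by [].
- by move=> t u _ h m.
- by move=> t u w _ h1 _ h2 m; rewrite h1.
- by move=> t t' u u' _ h1 _ h2 m /=; rewrite h1 h2.
- by move=> t t' _ h m /=; rewrite h.
- by move=> c t t' _ h m /=; rewrite h.
- by move=> t t' u u' _ h1 _ h2 m /=; rewrite h2 h1.
- by move=> t u w m /=; rewrite addrA.
- by move=> t u m /=; rewrite addrC.
- by move=> t m /=; rewrite add0r.
- by move=> t m /=; rewrite addNr.
- by move=> c d t m /=; rewrite scalerA.
- by move=> t m /=; rewrite scale1r.
- by move=> c t u m /=; rewrite scalerDr.
- by move=> c d t m /=; rewrite scalerDl.
- by [].
- by [].
- by move=> t u w m /=; rewrite term_actD.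
- by [].
- by move=> c t u m /=; rewrite term_actZ.
- by move=> v; apply: term_act_ext => g /=; rewrite !actE PPmE.
- by move=> v; apply: term_act_ext => g /=; rewrite !actE PPv.
- by move=> v w h; apply: term_act_ext => g /=; rewrite !actE PP.
- by move=> a b h; apply: term_act_ext => g /=; rewrite !actE SSc.
- by move=> a b h; apply: term_act_ext => g /=; rewrite !actE SSSc.
- by move=> a; apply: term_act_ext => g /=; rewrite !actE PS.
- by move=> a; apply: term_act_ext => g /=; rewrite !actE SP.
- by move=> a; apply: term_act_ext => g /=; rewrite !actE PSS.
- by move=> a; apply: term_act_ext => g /=; rewrite !actE SSP.
- by move=> a; apply: term_act_ext => g /=; rewrite !actE SSS_diag.
- by move=> a b h1 h2; apply: term_act_ext => g /=; rewrite !actE SSS_off.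
- move=> v n r _ ur hr; apply: term_act_ext => g.
  by rewrite term_act_foldr; exact: act_kp4 ur hr.
Qed.

Definition kp_act (y : KP K L) : KL -> KL := term_act (kp_repr y).

Lemma kp_act_pi t m : kp_act (kp_pi t) m = term_act t m.
Proof. exact/term_act_eqv/kp_repr_pi. Qed.

Lemma kp_act_s a m : kp_act (kp_s a) m = act_s a m.
Proof. exact: kp_act_pi. Qed.

Lemma kp_act_ss a m : kp_act (kp_ss a) m = act_ss a m.
Proof. exact: kp_act_pi. Qed.

Lemma kp_actDr y m m' : kp_act y (m + m') = kp_act y m + kp_act y m'.
Proof. exact: term_actD. Qed.

Lemma kp_actZr y c m : kp_act y (c *: m) = c *: kp_act y m.
Proof. exact: term_actZ. Qed.

Lemma kp_actDl y z m : kp_act (y + z) m = kp_act y m + kp_act z m.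
Proof. by rewrite -[y]kp_reprK -[z]kp_reprK [_ + _]kp_addE !kp_act_pi. Qed.

Lemma kp_actZl c y m : kp_act (c *: y) m = c *: kp_act y m.
Proof. by rewrite -[y]kp_reprK [_ *: _]kp_scaleE !kp_act_pi. Qed.

Lemma kp_actM y z m : kp_act (y * z) m = kp_act y (kp_act z m).
Proof. by rewrite -[y]kp_reprK -[z]kp_reprK [_ * _]kp_mulE !kp_act_pi. Qed.

Lemma kp_act0l m : kp_act 0 m = 0.
Proof. exact: (kp_act_pi KPzero). Qed.

Lemma kp_act1 m : kp_act 1 m = m.
Proof.
have acts n : kp_act 1 n = \sum_(v : V) act_s (idv v) n.
  have -> : 1 = \sum_(v : V) kp_p v :> KP K L by [].
  elim: (index_enum V) => [|v r IH]; first by rewrite !big_nil kp_act0l.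
  by rewrite !big_cons kp_actDl IH kp_act_s.
elim/freeg_ind: m => [|m m' e e'|c g]; first by exact: term_act0.
  by rewrite kp_actDr e e'.
rewrite freegU1 kp_actZr acts; congr (_ *: _).
rewrite (bigD1 (pobj (grng (val g)) 0)) //= big1 ?addr0 => [|v /eqP ne]; rewrite actE.
  by have -> : Sm (idv (pobj (grng (val g)) 0)) g = Some g by apply/PmP.
by case E: (Sm _ _) => [g'|] //; case/PmP: E => e; case: ne.
Qed.

Lemma kp_act_cyl a b m : src a = src b ->
  kp_act (kp_s a * kp_ss b) m = bis_act (cyl a b) m.
Proof.
move=> sab; elim/freeg_ind: m => [|m m' e e'|c g].
- by rewrite [LHS]term_act0 /bis_act raddf0.
- by rewrite kp_actDr e e' /bis_act raddfD.
rewrite freegU1 kp_actZr /bis_act fgliftZ; congr (_ *: _).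
rewrite kp_actM kp_act_s kp_act_ss !actE [RHS]bis_actU; congr og.
apply: opt_ext => g'; rewrite obindE bis_mapP; split.
  move=> [h [/SSmP[c1 d1] /SmP[c2 d2]]].
  exists (grng (val g'), n2z (deg a) - n2z (deg b), grng (val g)); split=> //.
    by exists (grng (val h)).
  have [_ e1] := srcfibP g; have [_ e2] := srcfibP g'.
  rewrite /gmul e1; move: d1 d2 e2; case: (val g') => [[r dd] s].
  by rewrite /grng /gdeg /gsrc /= => -> -> ->; rewrite addrA addrAC.
move=> [be [[z [c1 d1 c2]] e eg']]; rewrite e in c2.
have [h [hh eh]] := SSm_total c2; exists h; split=> //.
have [_ d] := (SSmP _ _ _).1 hh; apply/SmP; rewrite eh eg'; split=> //.
change (gdeg be + gdeg (val g) = n2z (deg a) + gdeg (val h)).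
by rewrite d1 d -addrA [- _ + _]addrC.
Qed.

Local Notation B := (gralg K (isotropy x)).

Lemma iso_actDl m m' (b : B) : iso_act (m + m') b = iso_act m b + iso_act m' b.
Proof. by rewrite /iso_act raddfD. Qed.

Lemma iso_actZl c m (b : B) : iso_act (c *: m) b = c *: iso_act m b.
Proof. by rewrite /iso_act fgliftZ. Qed.

Lemma iso_act0l (b : B) : iso_act (0 : KL) b = 0.
Proof. by rewrite /iso_act raddf0. Qed.

Lemma iso_actUU g (h : isotropy x) :
  iso_act (<< g >> : KL) (<< h >> : B) = << fib_iso g h >>.
Proof. by rewrite /iso_act !fglift1. Qed.

Lemma iso_actDr m (b b' : B) : iso_act m (b + b') = iso_act m b + iso_act m b'.
Proof.
elim/freeg_ind: m => [|m m' e e'|c g].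
- by rewrite !iso_act0l addr0.
- by rewrite !iso_actDl e e' addrACA.
- by rewrite freegU1 !iso_actZl -scalerDr /iso_act !fglift1 raddfD.
Qed.

Lemma iso_actZr m c (b : B) : iso_act m (c *: b) = c *: iso_act m b.
Proof.
elim/freeg_ind: m => [|m m' e e'|d g].
- by rewrite !iso_act0l scaler0.
- by rewrite !iso_actDl e e' scalerDr.
- rewrite freegU1 !iso_actZl !scalerA mulrC -scalerA; congr (_ *: _).
  by rewrite /iso_act !fglift1 fgliftZ.
Qed.

Lemma iso_act0r m : iso_act m (0 : B) = 0.
Proof. by rewrite -(scale0r (0 : B)) iso_actZr scale0r. Qed.

Lemma bis_act_iso a b m (c : B) :
  bis_act (cyl a b) (iso_act m c) = iso_act (bis_act (cyl a b) m) c.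
Proof.
have biD n n' : bis_act (K := K) (cyl a b) (n + n' : KL) =
    bis_act (cyl a b) n + bis_act (cyl a b) n' by rewrite /bis_act raddfD.
have biZ d n : bis_act (K := K) (cyl a b) (d *: n : KL) = d *: bis_act (cyl a b) n.
  exact: fgliftZ.
have bi0 : bis_act (K := K) (cyl a b) (0 : KL) = 0 by rewrite /bis_act raddf0.
elim/freeg_ind: m => [|m m' e e'|d g].
- by rewrite bi0 !iso_act0l bi0.
- by rewrite biD !iso_actDl biD e e'.
rewrite freegU1 biZ !iso_actZl biZ; congr (_ *: _).
elim/gralg_ind: c => [|c c' e e'|y c e|h].
- by rewrite !iso_act0r bi0.
- by rewrite !iso_actDr biD e e'.
- by rewrite !iso_actZr biZ e.
rewrite iso_actUU !bis_actU.
have -> : bis_map (cyl a b) (fib_iso g h) = omap (fun g0 => fib_iso g0 h) (bis_map (cyl a b) g).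
  apply: opt_ext => g'; rewrite bis_mapP; split.
    move=> [be [h1 h2 h3]].
    case E: (bis_map _ g) => [g0|] /=; last first.
      have [g0 E'] : exists g0, bis_map (cyl a b) g = Some g0.
        have hm : `[< in_grpd (gmul be (val g)) /\ gsrc (gmul be (val g)) = x >].
          have [g1 g2] := srcfibP g; apply/asboolP; split=> //.
          by apply: grpd_mul => //; exact: cyl_grpd h1.
        by exists (Sub (gmul be (val g)) hm); apply/bis_mapP; exists be; rewrite SubK.
      by rewrite E' in E.
    have [be' [h4 h5 h6]] := (bis_mapP _ _ _ _).1 E.
    have eb : be' = be by apply: (cyl_uniq h4 h1); rewrite h2 h5.
    congr Some; apply: fib_inj.
      by rewrite h3 /= /grng /= h6 eb.
    by rewrite h3 /= /gdeg /= h6 eb /gdeg /= addrA.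
  case E: (bis_map _ g) => [g0|] //= -[<-].
  have [be [h1 h2 h3]] := (bis_mapP _ _ _ _).1 E; exists be; split=> //.
  by rewrite /= h3 /gmul /gdeg /grng /= addrA.
by case: (bis_map _ g) => [g0|] /=; rewrite ?iso_actUU ?iso_act0l.
Qed.

Lemma kp_act_iso y m (c : B) : kp_act y (iso_act m c) = iso_act (kp_act y m) c.
Proof.
elim/kp_ind: y m => [|y z ey ez|d y ey|y z ey ez|a|a] m.
- by rewrite !kp_act0l iso_act0l.
- by rewrite !kp_actDl ey ez iso_actDl.
- by rewrite !kp_actZl ey iso_actZl.
- by rewrite -[kp_mul y z]/(y * z) !kp_actM ez ey.
- by rewrite !kp_act_s /act_s bis_act_iso.
- by rewrite !kp_act_ss /act_ss bis_act_iso.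
Qed.

End KPAction.

Section Tensor.
Variables (B : pzRingType) (M : zmodType) (ract : M -> B -> M) (W : lmodType B).

Local Notation F := {freeg (M * W)%type / int}.
Local Notation pure u w := (<< ((u, w) : (M * W)%type) >> : F).

Inductive tensor_rel : F -> Prop :=
| tensor_relDl u u' w : tensor_rel (pure (u + u') w - (pure u w + pure u' w))
| tensor_relDr u w w' : tensor_rel (pure u (w + w') - (pure u w + pure u w'))
| tensor_relM u b w : tensor_rel (pure (ract u b) w - pure u (b *: w)).

(** M (x)_B W, for the right action [ract] of B on M: the quotient of the free
    abelian group on M * W by the subgroup generated by the relations *)
Definition tensor : Type := lquot (M := F) [set t | tensor_rel t].

End Tensor.

Section Ind.
Variables (K : fieldType) (k : nat) (V : finType) (L : kgraph k V) (x : inf_path L).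
Variable W : lmodType (gralg K (isotropy x)).

Local Notation A := (KP K L).
Local Notation KL := {freeg (srcfib x) / K}.
Local Notation F := {freeg (KL * W)%type / int}.
Local Notation rel := [set t : F | tensor_rel (@iso_act _ _ _ K x) t].

(** Ind_x(W), with A acting by a (u (x) w) = (a u) (x) w *)
Definition Ind : Type := tensor (@iso_act _ _ _ K x) W.
HB.instance Definition _ := GRing.Zmodule.on Ind.

Definition ind_pi (t : F) : Ind := lpi rel t.
Definition ind_repr (q : Ind) : F := lrepr q.

Definition ind_tens (u : KL) (w : W) : Ind := ind_pi << (u, w) >>.

Definition free_act (a : A) : F -> F :=
  fglift (fun uw : KL * W => (<< ((kp_act a uw.1, uw.2) : (KL * W)%type) >> : F)).

Definition ind_scale (a : A) (q : Ind) : Ind := ind_pi (free_act a (ind_repr q)).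

Lemma ind_reprK q : ind_pi (ind_repr q) = q.
Proof. exact: lreprK. Qed.

Lemma ind_piD s t : ind_pi (s + t) = ind_pi s + ind_pi t.
Proof. exact: lpiD. Qed.

Lemma free_actU a u w : free_act a << (u, w) >> = << (kp_act a u, w) >>.
Proof. exact: fglift1. Qed.

Lemma free_actD a s t : free_act a (s + t) = free_act a s + free_act a t.
Proof. by rewrite /free_act raddfD. Qed.

Lemma free_actB a s t : free_act a (s - t) = free_act a s - free_act a t.
Proof. by rewrite /free_act raddfB. Qed.

Lemma free_actZ a c t : free_act a (c *: t) = c *: free_act a t.
Proof. exact: fgliftZ. Qed.

Lemma free_act_rel a t : lspan rel t -> lspan rel (free_act a t).
Proof.
have [l0 lD lZ] := lspan_submodule rel.
move=> h; apply: (h [set s | lspan rel (free_act a s)]).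
  split=> [|s t' hs ht|c s hs].
  - by rewrite /= /free_act raddf0.
  - by rewrite /= free_actD; exact: lD.
  - by rewrite /= free_actZ; exact: lZ.
move=> _ [u u' w|u w w'|u b w]; apply: sub_lspan => /=.
- by rewrite free_actB free_actD !free_actU kp_actDr; exact: tensor_relDl.
- by rewrite free_actB free_actD !free_actU; exact: tensor_relDr.
- by rewrite free_actB !free_actU kp_act_iso; exact: tensor_relM.
Qed.

Lemma ind_scaleE a t : ind_scale a (ind_pi t) = ind_pi (free_act a t).
Proof.
apply/lpiP; rewrite -free_actB; apply: free_act_rel.
by apply/lpiP; exact: ind_reprK.
Qed.

Lemma ind_scale_tens a u w : ind_scale a (ind_tens u w) = ind_tens (kp_act a u) w.
Proof. by rewrite /ind_tens ind_scaleE free_actU. Qed.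

Lemma ind_ind (P : Ind -> Prop) :
  P 0 -> (forall q r, P q -> P r -> P (q + r)) -> (forall q, P q -> P (- q)) ->
  (forall u w, P (ind_tens u w)) -> forall q, P q.
Proof.
have pi0 : ind_pi 0 = 0 by apply: (@addIr _ (ind_pi 0)); rewrite -ind_piD !add0r.
have piN t : ind_pi (- t) = - ind_pi t.
  by apply: (@addIr _ (ind_pi t)); rewrite -ind_piD !addNr pi0.
move=> h0 hD hN hT q; rewrite -[q]ind_reprK.
elim/freeg_ind: (ind_repr q) => [|s t hs ht|c [u w]].
- by rewrite pi0.
- by rewrite ind_piD; exact: hD.
have hn n : P (ind_pi << n%:Z *g (u, w) >>).
  elim: n => [|n IH]; first by rewrite freegU0 pi0.
  by rewrite -addn1 PoszD -freegUD ind_piD; apply: hD => //; exact: hT.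
case: c => n; first exact: hn.
by rewrite NegzE -freegUN piN; apply: hN; exact: hn.
Qed.

Fact ind_scaleDr a q r : ind_scale a (q + r) = ind_scale a q + ind_scale a r.
Proof.
by rewrite -[q]ind_reprK -[r]ind_reprK -ind_piD !ind_scaleE free_actD ind_piD.
Qed.

Let scale0 a : ind_scale a 0 = 0.
Proof. by apply: (@addIr _ (ind_scale a 0)); rewrite -ind_scaleDr !add0r. Qed.
Let scaleN a q : ind_scale a (- q) = - ind_scale a q.
Proof. by apply: (@addIr _ (ind_scale a q)); rewrite -ind_scaleDr !addNr scale0. Qed.

Lemma ind_tensDl u u' w : ind_tens (u + u') w = ind_tens u w + ind_tens u' w.
Proof.
rewrite /ind_tens -ind_piD; apply/lpiP; apply: sub_lspan; exact: tensor_relDl.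
Qed.

Fact ind_scaleA a b q : ind_scale a (ind_scale b q) = ind_scale (a * b) q.
Proof.
elim/ind_ind: q => [|q r eq er|q eq|u w]; first by rewrite !scale0.
- by rewrite !ind_scaleDr eq er.
- by rewrite !scaleN eq.
- by rewrite !ind_scale_tens kp_actM.
Qed.

Fact ind_scale1 q : ind_scale 1 q = q.
Proof.
elim/ind_ind: q => [|q r eq er|q eq|u w]; first by rewrite scale0.
- by rewrite !ind_scaleDr eq er.
- by rewrite scaleN eq.
- by rewrite ind_scale_tens kp_act1.
Qed.

Fact ind_scaleDl q a b : ind_scale (a + b) q = ind_scale a q + ind_scale b q.
Proof.
elim/ind_ind: q => [|q r eq er|q eq|u w]; first by rewrite !scale0 addr0.
- by rewrite !ind_scaleDr eq er addrACA.
- by rewrite !scaleN eq opprD.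
- by rewrite !ind_scale_tens kp_actDl ind_tensDl.
Qed.

HB.instance Definition _ := GRing.Zmodule_isLmodule.Build A Ind
  ind_scaleA ind_scale1 ind_scaleDr ind_scaleDl.

End Ind.

Section KerFbar.
Variables (k l : nat) (f : {additive nvec k -> nvec l}).

Definition ker_pred : {pred zvec k} := fun h => fbar f h == 0.

Fact ker_zmod_closed : zmod_closed ker_pred.
Proof.
split=> [|g h]; rewrite !unfold_in; first by rewrite raddf0.
by move=> /eqP hg /eqP hh; rewrite fbar_is_additive hg hh subrr.
Qed.

HB.instance Definition _ := GRing.isZmodClosed.Build _ ker_pred ker_zmod_closed.

(** H = ker fbar *)
Definition ker_fbar : Type := {h : zvec k | h \in ker_pred}.
HB.instance Definition _ := SubChoice.on ker_fbar.
HB.instance Definition _ := [SubChoice_isSubZmodule of ker_fbar by <:].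

End KerFbar.

Section Primitive.
Variables (K : fieldType) (k l : nat) (f : {additive nvec k -> nvec l}).
Variables (V : finType) (G : kgraph l V).

Local Notation H := (ker_fbar f).
Local Notation C := (gralg K H).
Local Notation A := (KP K (pullback f G)).

(** s_(a,n) and s_((a,n)^* ), for a \in \Gamma and n \in N^k with d(a) = f(n) *)
Definition s_at (a : arr G) (n : nvec k) : A :=
  if insub (a, n) is Some b then kp_s (b : arr (pullback f G)) else 0.
Definition ss_at (a : arr G) (n : nvec k) : A :=
  if insub (a, n) is Some b then kp_ss (b : arr (pullback f G)) else 0.

Definition U_elt (h : H) : A :=
  \sum_(v : V) \sum_(a \in paths_from G v (f (zpos (val h))))
    s_at a (zpos (val h)) * ss_at a (zneg (val h)).

Definition iota : C -> A := fglift U_elt.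

(** I_X, for X a set of vertices *)
Definition vertex_ideal (X : {set V}) : set A :=
  ideal_gen [set a | exists2 v, v \in X & a = kp_p v].

Definition P_ideal (T : {set V}) (m : set C) : set A :=
  set_add (vertex_ideal (~: T)%SET) (left_mul_set (iota @` m)).

(** \kappa(m) = C / m *)
Definition kappa (m : set C) : lmodType C := lquot (M := C^o) m.

Section AtPath.
Variable x : inf_path G.
Hypotheses (fsurj : forall n, exists m, f m = n) (hx : aperiodic_path x).

Lemma isotropy_ker (h : isotropy (path_lift f x)) : val h \in ker_pred f.
Proof.
have [p [q [e1 e2]]] := isotropyP h.
have {}e1 : val h = n2z p - n2z q by exact: e1.
rewrite e1 unfold_in fbarB subr_eq0; apply/eqP; congr n2z.
by apply: hx; apply: (path_lift_shift fsurj).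
Qed.

(** The isomorphism from the isotropy group at the lift of x to H *)
Definition isotropy_to_ker (h : isotropy (path_lift f x)) : H :=
  Sub (val h) (isotropy_ker h).

Fact isotropy_to_ker_additive : zmod_morphism isotropy_to_ker.
Proof. by move=> g h; exact: val_inj. Qed.

HB.instance Definition _ := GRing.isZmodMorphism.Build _ _ isotropy_to_ker
  isotropy_to_ker_additive.

Lemma isotropy_to_ker_bij : bijective isotropy_to_ker.
Proof.
have hi (h : H) : val h \in iso_pred (path_lift f x).
  apply/asboolP; exists (zpos (val h)), (zneg (val h)).
  split; first by rewrite zpos_negB.
  apply: shift_path_lift; apply: n2z_inj; apply/eqP.
  by rewrite -subr_eq0; exact: (valP h).
exists (fun h => Sub (val h) (hi h)) => h; apply: val_inj; by rewrite !SubK.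
Qed.

Definition M_module (m : set C) : lmodType A :=
  Ind (x := path_lift f x) (restr (gralg_map (K := K) isotropy_to_ker) (kappa m)).

End AtPath.
End Primitive.

Arguments P_ideal {K k l f V} G T m.

(** The data chosen for a maximal tail T: a vertex w of T and an aperiodic path x
    in w \Gamma_T^\infty such that v \Gamma_T w is nonempty for all v in T *)
Definition tail_choice (l : nat) (V : finType) (G : kgraph l V) (T : {set V})
    (hT : maximal_tail G T) (w : V) (x : inf_path (tail_graph hT)) : Prop :=
  [/\ w \in T, val (pobj x 0) = w, aperiodic_path x
    & forall v, v \in T -> exists a : arr (tail_graph hT),
        val (rng a) = v /\ val (src a) = w].

Lemma tail_choice_aperiodic (l : nat) (V : finType) (G : kgraph l V) (T : {set V})
    (hT : maximal_tail G T) (w : V) (x : inf_path (tail_graph hT)) :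
  tail_choice w x -> aperiodic_path (path_incl x).
Proof. by case=> _ _ hx _; exact: path_incl_aperiodic. Qed.

(** M(T, m) = Ind_(lift of x)(\kappa(m)), a module over A = KP_K(f^*\Gamma) *)
Definition M_tail (K : fieldType) (k l : nat) (f : {additive nvec k -> nvec l})
    (fsurj : forall n, exists m, f m = n) (V : finType) (G : kgraph l V)
    (T : {set V}) (hT : maximal_tail G T) (w : V) (x : inf_path (tail_graph hT))
    (hc : tail_choice w x) (m : set (gralg K (ker_fbar f))) :
    lmodType (KP K (pullback f G)) :=
  M_module fsurj (tail_choice_aperiodic hc) m.

(* Main.v *)
Require Import Defs.
From HB Require Import structures.
From mathcomp Require Import all_boot all_order all_algebra.
From mathcomp Require Import boolp classical_sets functions cardinality fsbigop.
From mathcomp Require Import freeg.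
From mathcomp Require Import zify.
Import Defs.

Set Implicit Arguments.
Unset Strict Implicit.
Unset Printing Implicit Defensive.

Import Order.TTheory GRing.Theory Num.Theory.

Local Open Scope classical_set_scope.
Local Open Scope ring_scope.

(** Write L for the pullback of G along f and P for P_(T, m). Everything rests on one
    uniqueness result, [ideal_eq_P]: a two-sided ideal J of A that contains iota(m)
    and, among the vertices, exactly those outside T, is equal to P. Granted this, the
    annihilator of M(T, m) is computed by looking at vertices only, and so is every
    primitive ideal.

    The uniqueness result is an aperiodicity argument. Multiplying an element of J by
    s_b for a long path b removes all starred generators ([long_span_absorb]), and the
    identity is the sum of the s_b s_b^* over the paths b of one degree, so only
    combinations of paths s_a of L have to be considered. Lifts to L of the same path
    of G differ by some h in H, and U_h exchanges them ([U_s]); this determines U_h,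
    makes iota a homomorphism with central image, and turns the combination into a sum
    of iota(c_a) s_(nu a) with one lift nu a for each path a of G ([iota_group]).
    Prefixing the paths a to an aperiodic path y gives distinct infinite paths, so a
    long prefix of one of them isolates its term and leaves iota(c_a) p_v in J, where
    v lies in T ([compress]). As p_v is not in J, c_a is not invertible modulo m, hence
    lies in m, and the element is in P.

    For M(T, m), simplicity holds for the induction of any simple module from any
    isotropy group ([Ind_simple]): a long prefix isolates one range again, and the
    arrows of the groupoid and the group algebra do the rest. Every path of L is
    periodic along H, so U_h acts on L_x by translation and iota(c) acts on
    Ind(kappa(m)) through kappa(m); therefore iota(m) annihilates it. A vertex
    annihilates it exactly when no path shift equivalent to x starts there, that is,
    off T.

    If K is uncountable and algebraically closed and P is the annihilator of a simple
    module, the central elements iota(c) act by scalars, because A has countable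
    dimension ([central_scalar], Amitsur's trick). The c that act as 0 form a maximal
    ideal, the vertices that act nontrivially form a maximal tail, and uniqueness
    identifies P. *)

(** * Submodules, degrees and finite sums *)

Lemma lspan_sub (R : pzRingType) (M : lmodType R) (S N : set M) :
  submodule N -> S `<=` N -> lspan S `<=` N.
Proof. by move=> hN SN x; apply. Qed.

Lemma lpi0 (R : pzRingType) (M : lmodType R) (S : set M) : lpi S 0 = 0.
Proof. by rewrite -[LHS](addrK (lpi S 0)) -lpiD addr0 subrr. Qed.

Lemma fglift_lspan (R : nzRingType) (X : choiceType) (M : lmodType R) (f : X -> M) x :
  lspan (range f) x -> exists u : {freeg X / R}, x = fglift f u.
Proof.
apply: (@lspan_sub _ _ _ [set x | exists u : {freeg X / R}, x = fglift f u]).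
  split=> [|_ _ [u ->] [u' ->]|c _ [u ->]].
  - by exists 0; rewrite raddf0.
  - by exists (u + u'); rewrite raddfD.
  - by exists (c *: u); rewrite fgliftZ.
by move=> _ [y _ <-]; exists << y >>; rewrite fglift1.
Qed.

Lemma simple_gen (R : pzRingType) (M : lmodType R) (u v : M) :
  simple_module M -> u <> 0 -> exists a, v = a *: u.
Proof.
move=> [_ hM] u0; have hN : submodule [set a *: u | a in setT].
  split=> [|_ _ [a _ <-] [b _ <-]|c _ [a _ <-]].
  - by exists 0; rewrite ?scale0r.
  - by exists (a + b); rewrite ?scalerDl.
  - by exists (c * a); rewrite ?scalerA.
have [e|e] := hM _ hN.
  have : [set a *: u | a in setT] u by exists 1; rewrite ?scale1r.
  by rewrite e.
have [a _ <-] : [set a *: u | a in setT] v by rewrite e.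
by exists a.
Qed.

Lemma simple_restr (B C : pzRingType) (phi : {rmorphism B -> C}) (M : lmodType C) :
  (forall c, exists b, phi b = c) -> simple_module M ->
  simple_module (restr phi M : lmodType B).
Proof.
move=> phi_surj [M0 hM]; split=> // N [N0 ND NZ]; apply: (hM N); split=> // c u Nu.
by have [b <-] := phi_surj c; exact: NZ.
Qed.

Lemma lspan_ideal (C : comPzRingType) (m : set C) : two_sided_ideal m ->
  lspan (m : set C^o) = m.
Proof.
move=> [m0 mD mM]; apply/seteqP; split=> [c|c]; last exact: sub_lspan.
by apply=> //; split=> // a u /(mM a)[].
Qed.

Lemma ann_ideal (R : pzRingType) (M : lmodType R) : two_sided_ideal (ann M).
Proof.
split=> [u|a b ha hb u|a b hb]; first by rewrite scale0r.
  by rewrite scalerDl ha hb addr0.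
by split=> u; rewrite -scalerA ?hb // scaler0.
Qed.

Lemma nle_addE (k : nat) (n m : nvec k) : nle n m -> exists r, m = n + r.
Proof. by move=> h; exists (nsub m n); rewrite nsubKC. Qed.

Lemma zposE k (h : zvec k) : n2z (zpos h) = n2z (zneg h) + h.
Proof. by rewrite -{3}(zpos_negB h) addrC subrK. Qed.

Lemma big_undup_map (I J : eqType) (Z : zmodType) (p : I -> J) (D : seq I) (F : I -> Z) :
  \sum_(i <- D) F i = \sum_(j <- undup (map p D)) \sum_(i <- D | p i == j) F i.
Proof.
rewrite (exchange_big_dep xpredT) //= big_seq [RHS]big_seq; apply: eq_bigr => i iD.
rewrite big_mkcond (bigD1_seq (p i)) ?undup_uniq ?mem_undup ?map_f //= eqxx.
by rewrite big1 ?addr0 // => j ne; rewrite eq_sym (negbTE ne).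
Qed.

Lemma uncountable_fiber (T : choiceType) (S : nat -> set T) :
  ~ countable [set: T] -> (forall y, exists n, S n y) ->
  exists n, infinite_set (S n).
Proof.
move=> uT hS; apply: contra_notP uT => hn.
have -> : [set: T] = \bigcup_(n in [set: nat]) S n.
  by apply/seteqP; split=> // c _; have [n Sn] := hS c; exists n.
apply: bigcup_countable => [|n _]; first exact: countableP.
apply: finite_set_countable; apply: contrapT => h; by apply: hn; exists n.
Qed.

(** * Calculus in a Kumjian-Pask algebra *)

Lemma paths_seq (k : nat) (V : countType) (L : kgraph k V) (rf : row_finite L)
    (v : V) (n : nvec k) : exists r : seq (arr L),
  uniq r /\ forall a, a \in r <-> paths_from L v n a.
Proof.
have /finite_seqP [r hr] := rf v n.
exists (undup r); split; first exact: undup_uniq.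
by move=> a; rewrite mem_undup hr.
Qed.

Section KPCalculus.
Variables (K : fieldType) (k : nat) (V : finType) (L : kgraph k V).
Implicit Types (a b c : arr L) (v w : V) (n : nvec k).

Local Notation A := (KP K L).
Local Notation s_ a := (kp_s a : A).
Local Notation ss_ a := (kp_ss a : A).
Local Notation p_ v := (kp_p v : A).

Lemma kp_mul_pi t u : kp_pi t * kp_pi u = kp_pi (KPmul t u) :> A.
Proof. exact: kp_mulE. Qed.

Lemma kp_ss_idv v : ss_ (idv v) = p_ v.
Proof. exact/kp_piP/kp_vertex. Qed.

Lemma kp_pp v w : p_ v * p_ w = if v == w then p_ v else 0.
Proof.
rewrite kp_mul_pi; case: eqP => [<-|h]; first exact/kp_piP/kp1_idem.
exact/kp_piP/kp1_orth.
Qed.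

Lemma kp_ps a : p_ (rng a) * s_ a = s_ a.
Proof. by rewrite kp_mul_pi; apply/kp_piP/kp2_ps. Qed.

Lemma kp_sp a : s_ a * p_ (src a) = s_ a.
Proof. by rewrite kp_mul_pi; apply/kp_piP/kp2_sp. Qed.

Lemma kp_pss a : p_ (src a) * ss_ a = ss_ a.
Proof. by rewrite kp_mul_pi; apply/kp_piP/kp2_pss. Qed.

Lemma kp_ssp a : ss_ a * p_ (rng a) = ss_ a.
Proof. by rewrite kp_mul_pi; apply/kp_piP/kp2_ssp. Qed.

Lemma kp_sM a b : src a = rng b -> s_ a * s_ b = s_ (comp a b).
Proof. by move=> h; rewrite kp_mul_pi; apply/kp_piP/kp2_s. Qed.

Lemma kp_sM0 a b : src a <> rng b -> s_ a * s_ b = 0.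
Proof.
move=> /eqP/negbTE h.
by rewrite -(kp_sp a) -(kp_ps b) mulrA -[s_ a * _ * _]mulrA kp_pp h mulr0 mul0r.
Qed.

Lemma kp_p_s v a : p_ v * s_ a = if v == rng a then s_ a else 0.
Proof.
rewrite -{1}(kp_ps a) mulrA kp_pp; case: eqP => [->|]; first exact: kp_ps.
by rewrite mul0r.
Qed.

Lemma kp_s_p v a : s_ a * p_ v = if src a == v then s_ a else 0.
Proof.
rewrite -{1}(kp_sp a) -mulrA kp_pp; case: eqP => _; first exact: kp_sp.
by rewrite mulr0.
Qed.

Lemma kp_p_ss v b : src b <> v -> p_ v * ss_ b = 0.
Proof.
move=> ne; rewrite -(kp_pss b) mulrA kp_pp; case: eqP => [e|_]; last by rewrite mul0r.
by case: ne.
Qed.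

Lemma kp_ss_p v b : rng b <> v -> ss_ b * p_ v = 0.
Proof.
move=> ne; rewrite -(kp_ssp b) -mulrA kp_pp; case: eqP => [//|_]; by rewrite mulr0.
Qed.

Lemma kp_sss a b : deg a = deg b ->
  ss_ a * s_ b = if a == b then p_ (src a) else 0.
Proof.
rewrite kp_mul_pi; case: eqP => [<- _|h e]; first exact/kp_piP/kp3_diag.
exact/kp_piP/kp3_off.
Qed.

Lemma kp_ss_comp a b c : deg a = deg b -> src b = rng c ->
  ss_ a * s_ (comp b c) = if a == b then s_ c else 0.
Proof.
move=> dab sbc; rewrite -kp_sM // mulrA kp_sss //; case: eqP => [->|_].
  by rewrite sbc kp_ps.
by rewrite mul0r.
Qed.

Lemma kp_pi_foldr (r : seq (arr L)) :
  kp_pi (foldr (fun a t => KPadd (KPmul (KPs a) (KPss a)) t) KPzero r) =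
  \sum_(a <- r) s_ a * ss_ a.
Proof.
elim: r => [|a r IH] /=; first by rewrite big_nil.
by rewrite big_cons -IH [s_ a * _]kp_mul_pi [RHS]kp_addE.
Qed.

Hypothesis rf : row_finite L.

Lemma kp_p_sum v n : exists r : seq (arr L), [/\ uniq r,
  forall a, a \in r <-> paths_from L v n a & p_ v = \sum_(a <- r) s_ a * ss_ a].
Proof.
have [r [ur hr]] := paths_seq rf v n; exists r; split=> //.
have [n0|n0] := eqVneq n 0; last first.
  by rewrite -kp_pi_foldr; apply/kp_piP/(kp4 _ (n := n)) => //; exact/eqP.
have ir : idv v \in r by apply/hr; split; rewrite ?rng_idv ?deg_idv.
rewrite (bigD1_seq (idv v)) //= big_seq_cond big1 ?addr0.
  by rewrite kp_ss_idv kp_pp eqxx.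
move=> a /andP[/hr[<- da] /eqP []]; apply: deg0_idv; by rewrite da.
Qed.

(** The degree n part of the path space resolves the identity, so an element is
    known once its products with the s_b of a single degree are. *)
Lemma kp_split n (P : set A) : P 0 -> (forall x y, P x -> P y -> P (x + y)) ->
  forall z : A, (forall b, deg b = n -> P (z * s_ b * ss_ b)) -> P z.
Proof.
move=> P0 PD z h; have -> : z = \sum_(v : V) z * p_ v by rewrite -mulr_sumr -[LHS]mulr1.
apply: (big_ind P) => // v _.
have [r [ur hr ->]] := kp_p_sum v n.
rewrite mulr_sumr big_seq; apply: (big_ind P) => // b /hr[_ db].
by rewrite mulrA; exact: h.
Qed.

Lemma kp_ext n (z z' : A) : (forall b, deg b = n -> z * s_ b = z' * s_ b) -> z = z'.
Proof.
move=> h; apply/eqP; rewrite -subr_eq0; apply/eqP.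
apply: (@kp_split n [set 0]) => [//|x y -> ->|b db] /=; first by rewrite addr0.
by rewrite mulrBl h // subrr mul0r.
Qed.

End KPCalculus.

(** * Spanning sets *)

Section KPSpan.
Variables (K : fieldType) (k : nat) (V : finType) (L : kgraph k V).
Implicit Types (a b c : arr L) (v w : V) (n m : nvec k).

Local Notation A := (KP K L).
Local Notation s_ a := (kp_s a : A).
Local Notation ss_ a := (kp_ss a : A).

Definition long_span n : set A := lspan [set x | exists2 a, nle n (deg a) & x = s_ a].

Lemma long_span_s n a : nle n (deg a) -> long_span n (s_ a).
Proof. by move=> h; apply: sub_lspan; exists a. Qed.

Lemma long_span_mul n m (x y : A) : (forall a, nle n (deg a) -> long_span m (x * s_ a)) ->
  long_span n y -> long_span m (x * y).
Proof.
move=> h; apply: (@lspan_sub _ _ _ [set y | long_span m (x * y)]) => [|_ [a na ->]]; last exact: h.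
have [h0 hD hZ] := lspan_submodule [set x | exists2 a, nle m (deg a) & x = s_ a].
split=> [|u v hu hv|c u hu] /=; first by rewrite mulr0.
  by rewrite mulrDr; exact: hD.
by rewrite -kp_scalerAr; exact: hZ.
Qed.

(** The starred factors of an element are absorbed one by one, since s_a^* s_b is a
    path or 0 as soon as deg a <= deg b. *)
Lemma long_span_absorb (z : A) m : exists n, forall b, nle n (deg b) -> long_span m (z * s_ b).
Proof.
have h0 j : long_span j 0 by case: (lspan_submodule [set x | exists2 a, nle j (deg a) & x = s_ a]).
elim/kp_ind: z m => [|x y hx hy|c x hx|x y hx hy|a|a] m.
- by exists 0 => b _; rewrite mul0r.
- have [n1 h1] := hx m; have [n2 h2] := hy m; exists (n1 + n2) => b nb.
  rewrite mulrDl; case: (lspan_submodule [set x | exists2 a, nle m (deg a) & x = s_ a]).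
  move=> _ hD _; apply: hD; [apply: h1|apply: h2]; apply: nle_trans nb.
    exact: nle_addr.
  exact: nle_addl.
- have [n1 h1] := hx m; exists n1 => b nb.
  rewrite -kp_scalerAl; case: (lspan_submodule [set x | exists2 a, nle m (deg a) & x = s_ a]).
  by move=> _ _; apply; exact: h1.
- have [n1 h1] := hx m; have [n2 h2] := hy n1; exists n2 => b nb.
  rewrite -[kp_mul x y]/(x * y) -mulrA; apply: (long_span_mul (n := n1)) => //; exact: h2.
- exists m => b mb; have [e|e] := eqVneq (src a) (rng b); last first.
    by rewrite kp_sM0 //; exact/eqP.
  rewrite kp_sM //; apply: long_span_s; rewrite deg_comp //.
  exact: nle_trans mb (nle_addl _ _).
- exists (deg a + m) => b mb.
  have hb := nle_trans (nle_addr (deg a) m) mb.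
  have [h1 h3 h2] := headtailP hb; rewrite -[in kp_s b]h3 kp_ss_comp ?h2 //.
  case: eqP => // _; apply: long_span_s; have := deg_comp h1; rewrite h2 h3 => e.
  apply/nleP => i; move/nleP/(_ i): mb; rewrite e !ffunE.
  by rewrite leq_add2l.
Qed.

(** Once the degree n of b is large, z s_b is a combination of paths s_a; now
    resolve the identity in degree n. *)
Lemma kp_lspan (z : A) : row_finite L ->
  lspan [set x | exists a b, x = s_ a * ss_ b] z.
Proof.
move=> rf; have [h0 hD hZ] := lspan_submodule [set x | exists a b, x = s_ a * ss_ b].
have [n hn] := long_span_absorb z 0.
apply: (kp_split rf (n := n)) => [//|//|b db].
have : long_span 0 (z * s_ b) by apply: hn; rewrite db nle_refl.
pose N := [set y | lspan [set x | exists a b, x = s_ a * ss_ b] (y * ss_ b)].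
apply: (@lspan_sub _ _ _ N); last first.
  by move=> _ [a _ ->]; apply: sub_lspan; exists a, b.
split=> [|u v hu hv|c u hu]; rewrite /N /=; first by rewrite mul0r.
  by rewrite mulrDl; exact: hD.
by rewrite -kp_scalerAl; exact: hZ.
Qed.

Lemma long_span_sum n (z : A) : long_span n z -> exists u : {freeg (arr L) / K},
  z = \sum_(a <- dom u) coeff a u *: s_ a.
Proof.
move=> hz; have [u ->] : exists u : {freeg (arr L) / K}, z = fglift (fun a => s_ a) u.
  apply: fglift_lspan; move: z hz; apply: lspan_sub; first exact: lspan_submodule.
  by move=> _ [a _ ->]; apply: sub_lspan; exists a.
by exists u; rewrite -{1}[u]freeg_sumE raddf_sum; apply: eq_bigr => a _; rewrite /= liftU.
Qed.

End KPSpan.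

(** * The central copy of the group algebra of H *)

Section Pullback.
Variables (k l : nat) (f : {additive nvec k -> nvec l}).
Variables (V : countType) (G : kgraph l V).
Implicit Types (b c : arr (pullback f G)) (a : arr G) (n : nvec k).

Definition und b : arr G := (val (b : pb_arr f G)).1.

Lemma deg_und b : deg (und b) = f (deg b).
Proof. exact/eqP/(valP (b : pb_arr f G)). Qed.

Lemma val_pb b : val (b : pb_arr f G) = (und b, deg b).
Proof. exact: surjective_pairing. Qed.

Lemma pb_inj b c : und b = und c -> deg b = deg c -> b = c.
Proof. by move=> h1 h2; apply: val_inj; rewrite !val_pb h1 h2. Qed.

Lemma pb_lift a n : deg a = f n -> exists b, und b = a /\ deg b = n.
Proof. by move=> /eqP h; exists (Sub (a, n) h : pb_arr f G). Qed.

Lemma und_comp b c : src b = rng c -> und (comp b c) = comp (und b) (und c).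
Proof.
move=> h; rewrite /und insubdK // unfold_in /= deg_comp // raddfD.
by rewrite !deg_und.
Qed.

Lemma row_finite_pullback : row_finite G -> row_finite (pullback f G).
Proof.
move=> rf v n; have [r [_ hr]] := paths_seq rf v (f n).
pose s : seq (pb_arr f G) := pmap (fun a => insub (a, n)) r.
apply: (@sub_finite_set _ _ [set` s]) => [b [hb1 hb2]|]; last exact: finite_seq.
rewrite /= mem_pmap; apply/mapP; exists (und b).
  by apply/hr; split=> //; rewrite deg_und hb2.
by rewrite -hb2 -val_pb valK.
Qed.

End Pullback.

Arguments row_finite_pullback {k l} f {V G}.

Section Iota.
Variables (K : fieldType) (k l : nat) (f : {additive nvec k -> nvec l}).
Variables (V : finType) (G : kgraph l V).
Hypothesis rf : row_finite G.

Local Notation L := (pullback f G).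
Local Notation A := (KP K L).
Local Notation H := (ker_fbar f).
Local Notation C := (gralg K H).
Local Notation U := (@U_elt K k l f V G).
Implicit Types (b c : arr L) (h g : H) (z : A).

Let rfL : row_finite L := row_finite_pullback f rf.

Lemma s_at_und b : s_at K f (und b) (deg b) = kp_s b.
Proof. by rewrite /s_at -val_pb valK. Qed.

Lemma ss_at_und b : ss_at K f (und b) (deg b) = kp_ss b.
Proof. by rewrite /ss_at -val_pb valK. Qed.

Lemma ker_posneg h : f (zpos (val h)) = f (zneg (val h)).
Proof. by apply/n2z_inj/eqP; rewrite -subr_eq0; exact: (valP h). Qed.

Lemma U_s_neg h b b' : und b = und b' -> deg b = zneg (val h) -> deg b' = zpos (val h) ->
  U h * kp_s b = kp_s b'.
Proof.
move=> eu db db'; rewrite /U_elt mulr_suml.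
have key (v : V) : (\sum_(a \in paths_from G v (f (zpos (val h))))
    s_at K f a (zpos (val h)) * ss_at K f a (zneg (val h))) * kp_s b =
    if v == rng b then kp_s b' else 0 :> A.
  have [r [ur hr]] := paths_seq rf v (f (zpos (val h))).
  have -> : paths_from G v (f (zpos (val h))) = [set` r].
    by apply/seteqP; split=> a /=; rewrite hr.
  rewrite -fsbig_seq // mulr_suml.
  have term a : a \in r -> s_at K f a (zpos (val h)) * ss_at K f a (zneg (val h)) * kp_s b =
      if a == und b then kp_s b' else 0 :> A.
    move=> /hr[_ da]; have [c [<- dc]] := pb_lift da.
    have := deg_und c; rewrite dc ker_posneg => /pb_lift[c' [ec' dc']].
    rewrite -dc s_at_und -{1}ec' -dc' ss_at_und -mulrA kp_sss; last by rewrite dc' db.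
    have -> : (c' == b) = (und c == und b).
      by apply/eqP/eqP => [<-|e] //; apply: pb_inj; [rewrite ec'|rewrite dc' db].
    case: eqP => e; last by rewrite mulr0.
    have -> : src c' = src c by rewrite -[src c']/(src (und c')) ec'.
    by rewrite kp_sp; congr kp_s; apply: pb_inj; rewrite ?e // dc db'.
  rewrite big_seq (eq_bigr _ term) -big_seq.
  have [vb|vb] := eqVneq v (rng b); last first.
    rewrite big_seq big1 // => a /hr[ra _]; case: eqP => // e.
    by case/eqP: vb; rewrite -ra e.
  have br : und b \in r.
    by apply/hr; split=> //; rewrite deg_und db ker_posneg.
  rewrite (bigD1_seq (und b)) //= eqxx big1 ?addr0 // => a /negbTE -> //.
under eq_bigr do rewrite key.
by rewrite (bigD1 (rng b)) //= eqxx big1 ?addr0 // => v /negbTE ->.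
Qed.

(** As deg b + h is a degree, b has an initial segment of degree h_-, on which (KP3)
    leaves a single term of the sum that defines U_h. *)
Lemma U_s h b b' : und b = und b' -> n2z (deg b') = n2z (deg b) + val h ->
  U h * kp_s b = kp_s b'.
Proof.
move=> eu ed.
have hb : nle (zneg (val h)) (deg b).
  apply/nleP => i; move/ffunP/(_ i): ed; rewrite !ffunE.
  move: (fun_of_fin (val h) i) => x.
  by case: (lerP 0 (- x)) => hx; lia.
have [s1 c1 d1] := headtailP hb.
have := deg_und (head b (zneg (val h))); rewrite d1 -ker_posneg => /pb_lift[b1 [u1 e1]].
have s2 : src b1 = rng (tail b (zneg (val h))) by rewrite -s1 -[src b1]/(src (und b1)) u1.
rewrite -{1}c1 -kp_sM // mulrA (U_s_neg (b' := b1)) // kp_sM //; congr kp_s.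
apply: pb_inj; first by rewrite -eu -{2}c1 !und_comp // u1.
apply: n2z_inj; rewrite ed deg_comp // -{2}c1 deg_comp // e1 d1.
by rewrite !n2zD addrAC zposE.
Qed.

(** h may have negative entries, so paths can be moved by h only in large degrees. *)
Lemma U_degree h (n0 : nvec k) : exists n, nle n0 n /\
  exists m, n2z m = n2z n + val h.
Proof.
exists (n0 + zneg (val h)); split; first exact: nle_addr.
exists (n0 + zpos (val h)).
by rewrite !n2zD -addrA zposE.
Qed.

Lemma U_move h b (m : nvec k) : n2z m = n2z (deg b) + val h ->
  exists b', und b' = und b /\ deg b' = m.
Proof.
move=> e; apply: pb_lift; rewrite deg_und; apply: n2z_inj; apply/eqP.
rewrite eq_sym -subr_eq0 -fbarB e addrAC subrr add0r.
exact: (valP h).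
Qed.

Lemma U0 : U 0 = 1.
Proof.
apply: (kp_ext rfL (n := 0)) => b _.
by rewrite mul1r (U_s (b' := b)) // addr0.
Qed.

Lemma U_D g h : U (g + h) = U g * U h.
Proof.
have [n1 [_ [m1 e1]]] := U_degree h 0.
have [n2 [h2 [m2 e2]]] := U_degree g m1.
have [r er] := nle_addE h2.
have en : n2z n2 = n2z (n1 + r) + val h.
  by rewrite n2zD addrAC -e1 -n2zD er.
apply: (kp_ext rfL (n := n1 + r)) => b db.
have [b1 [u1 d1]] : exists b', und b' = und b /\ deg b' = n2.
  by apply: (@U_move h); rewrite db.
have [b2 [u2 d2]] : exists b', und b' = und b1 /\ deg b' = m2.
  by apply: (@U_move g); rewrite d1.
rewrite -mulrA (U_s (b' := b1) (h := h)) ?d1 ?db //.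
rewrite (U_s (b' := b2) (h := g)) ?d1 ?d2 // (U_s (b' := b2)) ?u2 ?u1 //.
by rewrite d2 db e2 en -addrA [val h + _]addrC.
Qed.

Lemma U_comm_s h b : U h * kp_s b = kp_s b * U h.
Proof.
have [n [_ [m e]]] := U_degree h 0.
apply: (kp_ext rfL (n := n)) => c dc.
have [c' [u' d']] : exists c', und c' = und c /\ deg c' = m.
  by apply: (@U_move h); rewrite dc.
have rc : rng c' = rng c by rewrite -[rng c']/(rng (und c')) u'.
rewrite -[kp_s b * U h * _]mulrA (U_s (b := c) (b' := c')) ?d' ?dc // -[U h * _ * _]mulrA.
have [s|s] := pselect (src b = rng c); last by rewrite !kp_sM0 ?mulr0 // rc.
rewrite !kp_sM ?rc //; apply: U_s; first by rewrite !und_comp ?rc // u'.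
by rewrite !deg_comp ?rc // !n2zD d' e dc addrA.
Qed.

Lemma U_comm_ss h b : U h * kp_ss b = kp_ss b * U h.
Proof.
apply: (kp_ext rfL (n := deg b)) => c dc.
rewrite -!mulrA U_comm_s [RHS]mulrA kp_sss //; case: eqP => _.
  by rewrite U_comm_s.
by rewrite mulr0 mul0r.
Qed.

Lemma U_central h z : U h * z = z * U h.
Proof.
elim/kp_ind: z => [|x y ex ey|c x ex|x y ex ey|b|b].
- by rewrite mulr0 mul0r.
- by rewrite mulrDr ex ey mulrDl.
- by rewrite -kp_scalerAr ex kp_scalerAl.
- by rewrite -[kp_mul x y]/(x * y) mulrA ex -mulrA ey mulrA.
- exact: U_comm_s.
- exact: U_comm_ss.
Qed.

Local Notation iota := (@iota K k l f V G).

Lemma iotaD (x y : C) : iota (x + y) = iota x + iota y.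
Proof. by rewrite /iota raddfD. Qed.

Lemma iota0 : iota 0 = 0.
Proof. by rewrite /iota raddf0. Qed.

Lemma iotaZ (c : K) (x : C) : iota (c *: x) = c *: iota x.
Proof. exact: fgliftZ. Qed.

Lemma iotaU h : iota << h >> = U h.
Proof. exact: fglift1. Qed.

Lemma iota1 : iota 1 = 1.
Proof. by rewrite [LHS]iotaU U0. Qed.

Lemma iotaM (x y : C) : iota (x * y) = iota x * iota y.
Proof.
elim/gralg_ind: x => [|a a' e e'|c a e|g].
- by rewrite mul0r iota0 mul0r.
- by rewrite mulrDl !iotaD e e' mulrDl.
- by rewrite -scalerAl !iotaZ e kp_scalerAl.
elim/gralg_ind: y => [|b b' e e'|c b e|h].
- by rewrite mulr0 iota0 mulr0.
- by rewrite mulrDr !iotaD e e' mulrDr.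
- by rewrite -scalerAr !iotaZ e kp_scalerAr.
- by rewrite [X in iota X]gralg_mulUU !iotaU U_D.
Qed.

Lemma iota_central (x : C) z : iota x * z = z * iota x.
Proof.
elim/gralg_ind: x => [|a a' e e'|c a e|g].
- by rewrite iota0 mul0r mulr0.
- by rewrite iotaD mulrDl e e' mulrDr.
- by rewrite iotaZ -kp_scalerAl e kp_scalerAr.
- by rewrite iotaU U_central.
Qed.

End Iota.

(** * Ideals *)

Section IdealTheory.
Variable R : pzRingType.
Implicit Types (J S : set R) (a b : R).

Lemma ideal_mull J a b : two_sided_ideal J -> J b -> J (a * b).
Proof. by move=> [_ _ h] /(h a)[]. Qed.

Lemma ideal_mulr J a b : two_sided_ideal J -> J b -> J (b * a).
Proof. by move=> [_ _ h] /(h a)[]. Qed.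

Lemma ideal_opp J a : two_sided_ideal J -> J a -> J (- a).
Proof. by move=> hJ; rewrite -mulN1r; exact: ideal_mull. Qed.

Lemma ideal_sum (I : eqType) J (r : seq I) (F : I -> R) : two_sided_ideal J ->
  (forall i, i \in r -> J (F i)) -> J (\sum_(i <- r) F i).
Proof.
by move=> [h0 hD _] h; rewrite big_seq; apply: (big_ind J) => // i; exact: h.
Qed.

Lemma ideal_full J : two_sided_ideal J -> J 1 -> J = setT.
Proof.
move=> hJ J1; apply/seteqP; split=> // a _.
by rewrite -[a]mulr1; exact: ideal_mull.
Qed.

Lemma ideal_gen_ideal S : two_sided_ideal (ideal_gen S).
Proof.
split=> [J [] //|a b ha hb J hJ SJ|a b hb].
  by case: (hJ) => _ hD _; apply: hD; [exact: ha|exact: hb].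
by split=> J hJ SJ; [apply: ideal_mull|apply: ideal_mulr] => //; exact: hb.
Qed.

Lemma left_mul_setD S a b : left_mul_set S a -> left_mul_set S b -> left_mul_set S (a + b).
Proof.
move=> [n [r [s [hs ->]]]] [m [r' [s' [hs' ->]]]]; exists (n + m)%N.
exists (fun i => match fintype.split i with inl j => r j | inr j => r' j end).
exists (fun i => match fintype.split i with inl j => s j | inr j => s' j end).
split=> [i|]; first by case: fintype.split.
rewrite big_split_ord; congr (_ + _); apply: eq_bigr => i _ /=.
  by rewrite (unsplitK (inl i)).
by rewrite (unsplitK (inr i)).
Qed.

Lemma left_mul_set1 S s : S s -> left_mul_set S s.
Proof.
by move=> Ss; exists 1%N, (fun=> 1), (fun=> s); split=> //; rewrite big_ord1 mul1r.
Qed.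

(** Centrality of S makes R S stable on the right. *)
Lemma left_mul_set_ideal S : (forall a s, S s -> s * a = a * s) ->
  two_sided_ideal (left_mul_set S).
Proof.
move=> hS; split.
- by exists 0%N, (fun=> 0), (fun=> 0); split=> [[]//|]; rewrite big_ord0.
- exact: left_mul_setD.
- move=> a _ [n [r [s [hs ->]]]]; split.
    exists n, (fun i => a * r i), s; split=> //.
    by rewrite mulr_sumr; apply: eq_bigr => i _; rewrite mulrA.
  exists n, (fun i => r i * a), s; split=> //.
  by rewrite mulr_suml; apply: eq_bigr => i _; rewrite -!mulrA (hS a) //.
Qed.

Lemma left_mul_set_sub S J : two_sided_ideal J -> S `<=` J -> left_mul_set S `<=` J.
Proof.
move=> hJ SJ _ [n [r [s [hs ->]]]]; apply: ideal_sum => // i _.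
by apply: ideal_mull => //; exact: SJ.
Qed.

Lemma set_add_ideal I J : two_sided_ideal I -> two_sided_ideal J ->
  two_sided_ideal (set_add I J).
Proof.
move=> [i0 iD iM] [j0 jD jM]; split.
- by exists 0 => //; exists 0 => //; rewrite addr0.
- move=> _ _ [a ia [b jb <-]] [c ic [d jd <-]].
  by exists (a + c); [exact: iD|exists (b + d); [exact: jD|rewrite addrACA]].
- move=> a _ [b ib [c jc <-]]; have [i1 i2] := iM a b ib; have [j1 j2] := jM a c jc.
  by rewrite mulrDr mulrDl; split; [exists (a * b) => //; exists (a * c)|
     exists (b * a) => //; exists (c * a)].
Qed.

Lemma set_add_sub I J J' : two_sided_ideal J' -> I `<=` J' -> J `<=` J' ->
  set_add I J `<=` J'.
Proof. by move=> [_ hD _] iJ jJ _ [a ia [b jb <-]]; apply: hD; [exact: iJ|exact: jJ]. Qed.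

Lemma set_addl I J a : J 0 -> I a -> set_add I J a.
Proof. by move=> j0 ia; exists a => //; exists 0 => //; rewrite addr0. Qed.

Lemma set_addr I J a : I 0 -> J a -> set_add I J a.
Proof. by move=> i0 ja; exists 0 => //; exists a => //; rewrite add0r. Qed.

End IdealTheory.

Lemma maximal_ideal_inv (C : comPzRingType) (m : set C) (c : C) :
  maximal_ideal m -> ~ m c -> exists b, m (1 - b * c).
Proof.
move=> [hm _ hmax] nc.
pose J := set_add m [set b * c | b in setT].
have hJ : two_sided_ideal J.
  apply: set_add_ideal => //; split=> [|_ _ [x _ <-] [y _ <-]|x _ [y _ <-]].
  - by exists 0; rewrite ?mul0r.
  - by exists (x + y); rewrite ?mulrDl.
  - split; first by exists (x * y); rewrite ?mulrA.
    by exists (x * y) => //; rewrite [RHS]mulrC mulrA.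
have mJ : m `<=` J by move=> a ma; apply: set_addl => //; exists 0; rewrite ?mul0r.
have [e|e] := hmax J hJ mJ.
  case: nc; rewrite -e; apply: set_addr; first by case: hm.
  by exists 1; rewrite ?mul1r.
have [a ma [_ [b _ <-] e1]] : J 1 by rewrite e.
by exists b; rewrite -e1 addrK.
Qed.

(** The submodules of C / m correspond to the ideals between m and C. *)
Lemma simple_quotient (C : comPzRingType) (m : set C) : maximal_ideal m ->
  simple_module (lquot (m : set C^o) : lmodType C).
Proof.
move=> [hm m1 mmax]; have pi0 c : lpi (m : set C^o) c = 0 <-> m c.
  by rewrite -(lpi0 (m : set C^o)) lpiP subr0 lspan_ideal.
split.
  exists (lpi (m : set C^o) 1) => /pi0 h1; apply: m1; exact: ideal_full.
move=> N [N0 ND NZ]; pose J : set C := [set c | N (lpi (m : set C^o) c)].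
have lpiZ a c : lpi (m : set C^o) (a * c) = a *: lpi (m : set C^o) c.
  by rewrite [RHS]lquot_scaleE.
have hJ : two_sided_ideal J.
  split=> [|a b Ja Jb|a b Jb].
  - by rewrite /J /= (pi0 0).2 //; case: hm.
  - by rewrite /J /= lpiD; exact: ND.
  - by rewrite /J /= [b * a]mulrC lpiZ; split; exact: NZ.
have mJ : m `<=` J by move=> c /pi0; rewrite /J /= => ->.
have [/seteqP[Jm _]|/seteqP[_ JT]] := mmax J hJ mJ; [left|right].
  apply/seteqP; split=> [q Nq|_ -> //]; rewrite /= -[q]lreprK; apply/pi0; apply: Jm.
  by rewrite /J /= lreprK.
by apply/seteqP; split=> // q _; have := JT (lrepr q) I; rewrite /J /= lreprK.
Qed.

(** * The ideal P of a tail and a maximal ideal *)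

Section PIdeal.
Variables (K : fieldType) (k l : nat) (f : {additive nvec k -> nvec l}).
Variables (V : finType) (G : kgraph l V).
Hypothesis rf : row_finite G.
Variables (T : {set V}) (m : set (gralg K (ker_fbar f))).

Local Notation L := (pullback f G).
Local Notation A := (KP K L).
Local Notation P := (P_ideal G T m).

Let vert_ideal : two_sided_ideal (vertex_ideal (~: T)%SET : set A).
Proof. exact: ideal_gen_ideal. Qed.

Let iota_ideal : two_sided_ideal (left_mul_set (iota G @` m)).
Proof.
by apply: left_mul_set_ideal => a _ [c _ <-]; exact: iota_central.
Qed.

Lemma P_ideal_ideal : two_sided_ideal P.
Proof. exact: set_add_ideal. Qed.

Lemma P_ideal_vertex v : v \notin T -> P (kp_p v).
Proof.
move=> vT; apply: set_addl; first by case: iota_ideal.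
by move=> J hJ; apply; exists v => //; rewrite inE.
Qed.

Lemma P_ideal_iota c : m c -> P (iota G c).
Proof.
move=> mc; apply: set_addr; first by case: vert_ideal.
by apply: left_mul_set1; exists c.
Qed.

Lemma P_ideal_sub (J : set A) : two_sided_ideal J ->
  (forall v, v \notin T -> J (kp_p v)) -> (forall c, m c -> J (iota G c)) ->
  P `<=` J.
Proof.
move=> hJ hv hc; apply: set_add_sub => //.
  by move=> a; apply=> // _ [v vT ->]; apply: hv; rewrite inE in vT.
by apply: left_mul_set_sub => // _ [c mc <-]; exact: hc.
Qed.

End PIdeal.

(** * Aperiodic compression *)

Section Prefixes.
Variables (k : nat) (V : countType) (L : kgraph k V).
Implicit Types (x y z : inf_path L) (a : arr L) (n : nvec k).

Lemma is_cat_prefix a z y n : is_cat a z y ->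
  parr y (nle0 (deg a + n)) = comp a (parr z (nle0 n)).
Proof.
move=> [e1 <-]; rewrite (parr_comp y (nle0 (deg a)) (nle_addr _ _) (nle0 _)) e1.
by rewrite /= /shift_arr; congr comp; apply: parr_irr; rewrite ?add0r // addrC.
Qed.

Lemma prefix_mono x y n n' : nle n n' ->
  parr x (nle0 n') = parr y (nle0 n') -> parr x (nle0 n) = parr y (nle0 n).
Proof. by move=> h e; rewrite !(parr_seg _ (nle0 n) h) e. Qed.

Lemma inf_path_prefix x y : (forall n, parr x (nle0 n) = parr y (nle0 n)) -> x = y.
Proof.
move=> h; apply: inf_pathP => p q pq.
by rewrite !(parr_seg _ pq (nle_refl q)) h.
Qed.

(** Distinct paths differ on some prefix, hence on all longer ones, so that the
    degrees needed for finitely many paths can be added up. *)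
Lemma prefix_sep x (s : seq (inf_path L)) : exists n, forall y, y \in s ->
  parr y (nle0 n) = parr x (nle0 n) -> y = x.
Proof.
elim: s => [|z s [n hn]]; first by exists 0.
have [->|zx] := pselect (z = x).
  by exists n => y; rewrite inE => /predU1P[->//|]; exact: hn.
have [n' hn'] : exists n', parr z (nle0 n') <> parr x (nle0 n').
  by apply: contra_notP zx => h; apply: inf_path_prefix => n'; apply: contra_notP h; exists n'.
exists (n + n') => y; rewrite inE => /predU1P[->|ys] e.
  by case: hn'; apply: prefix_mono e; exact: nle_addl.
by apply: hn => //; apply: prefix_mono e; exact: nle_addr.
Qed.

End Prefixes.

Section Uniqueness.
Variables (K : fieldType) (k l : nat) (f : {additive nvec k -> nvec l}).
Hypothesis fsurj : forall n, exists m, f m = n.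
Variables (V : finType) (G : kgraph l V).
Hypothesis rf : row_finite G.

Local Notation L := (pullback f G).
Local Notation A := (KP K L).
Local Notation C := (gralg K (ker_fbar f)).
Implicit Types (a : arr G) (b : arr L) (v : V).

Let rfL : row_finite L := row_finite_pullback f rf.

Lemma lift_section : exists nu : arr G -> arr L, (forall a, und (nu a) = a) /\
  (forall a a', deg a = deg a' -> deg (nu a) = deg (nu a')).
Proof.
have [g hg] := choice fsurj.
have /choice [nu hnu] a : exists b : arr L, und b = a /\ deg b = g (deg a).
  by apply: pb_lift; rewrite hg.
exists nu; split=> [a|a a' e]; first by have [] := hnu a.
by have [_ ->] := hnu a; have [_ ->] := hnu a'; rewrite e.
Qed.

Section WithSection.
Variable nu : arr G -> arr L.
Hypothesis nuK : forall a, und (nu a) = a.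
Hypothesis nu_deg : forall a a', deg a = deg a' -> deg (nu a) = deg (nu a').

(** The lifts of one path of G differ by elements of H, so a combination of paths
    of the pullback is a C-combination of one lift per path of G. *)
Lemma iota_group (D : seq (arr L)) (q : arr L -> K) : exists c : arr G -> C,
  \sum_(b <- D) q b *: kp_s b =
  \sum_(a <- undup (map (@und _ _ f V G) D)) iota G (c a) * kp_s (nu a) :> A.
Proof.
have /choice [h hh] b : exists h : ker_fbar f,
    n2z (deg b) = n2z (deg (nu (und b))) + val h.
  pose z := n2z (deg b) - n2z (deg (nu (und b))).
  have hz : z \in ker_pred f.
    by rewrite unfold_in fbarB -!deg_und nuK subrr.
  by exists (Sub z hz); rewrite SubK addrC subrK.
exists (fun a => \sum_(b <- D | und b == a) q b *: << h b >>).
rewrite (big_undup_map (@und _ _ f V G)); apply: eq_bigr => a _.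
rewrite /iota raddf_sum mulr_suml; apply: eq_bigr => b /eqP <- /=.
by rewrite fgliftZ fglift1 -kp_scalerAl (U_s K rf (b' := b)) ?nuK.
Qed.

Lemma cat_lift_inj (y : inf_path G) a a' z : aperiodic_path y ->
  is_cat (nu a) (path_lift f y) z -> is_cat (nu a') (path_lift f y) z -> a = a'.
Proof.
move=> hy [e1 s1] [e2 s2].
have : shift (deg (nu a')) (path_lift f y) = shift (deg (nu a)) (path_lift f y).
  by rewrite -{1}s1 -s2 !shiftD addrC.
move=> /(path_lift_shift fsurj)/hy; rewrite -!deg_und !nuK => /nu_deg e.
by rewrite -[a]nuK -[a']nuK -e1 -e2; congr und; apply: parr_irr.
Qed.

(** Multiplying by s_lam^* on the left, for a long prefix lam of a lift of a0 y,
    and by a prefix of the lift of y on the right, kills every other term since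
    the paths a y are distinct for y aperiodic. *)
Lemma compress (J : set A) (S : seq (arr G)) (c : arr G -> C) (y : inf_path G) a0 :
  two_sided_ideal J -> aperiodic_path y -> uniq S -> a0 \in S ->
  (forall a, a \in S -> src a = pobj y 0) ->
  J (\sum_(a <- S) iota G (c a) * kp_s (nu a)) ->
  exists n, J (iota G (c a0) * kp_p (pobj y n)).
Proof.
move=> hJ hy uS a0S sS Jx; pose y' := path_lift f y.
have /choice [z hz] a : exists z, a \in S -> is_cat (nu a) y' z.
  have [aS|aS] := boolP (a \in S); last by exists y'.
  have s : src (nu a) = pobj y' 0.
    by rewrite -[src (nu a)]/(src (und (nu a))) nuK sS //= raddf0.
  by exists (cat_path s) => _; exact: cat_pathP.
have [n hn] := prefix_sep (z a0) (map z S).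
pose mu := parr y' (nle0 n); pose lam := parr (z a0) (nle0 n).
have term a : a \in S -> kp_ss lam * (iota G (c a) * kp_s (nu a)) * kp_s mu =
    if a == a0 then iota G (c a) *
      kp_s (parr (z a) (nle_addl n (deg (nu a)))) else 0 :> A.
  move=> aS; rewrite mulrA -iota_central // -!mulrA.
  have sm : src (nu a) = rng mu by rewrite rng_parr (is_cat_src (hz a aS)).
  rewrite kp_sM // -(is_cat_prefix _ (hz a aS)).
  rewrite (parr_comp (z a) (nle0 n) (nle_addl n (deg (nu a))) (nle0 _)).
  rewrite kp_ss_comp ?deg_parr0 ?src_parr ?rng_parr //.
  have -> : (lam == parr (z a) (nle0 n)) = (a == a0).
    apply/eqP/eqP => [e|-> //].
    have ez := hn _ (map_f z aS) (esym e).
    by apply: (cat_lift_inj hy (hz a aS)); rewrite ez; exact: hz.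
  by case: (a == a0); rewrite ?mulr0.
pose tau := parr (z a0) (nle_addl n (deg (nu a0))).
exists (f n).
have -> : pobj y (f n) = src tau.
  rewrite src_parr; have [_ s] := hz a0 a0S.
  by rewrite [deg _ + n]addrC; exact: (congr1 (fun x => pobj x n) (esym s)).
have -> : iota G (c a0) * kp_p (src tau) =
    kp_ss tau * (kp_ss lam * (\sum_(a <- S) iota G (c a) * kp_s (nu a)) * kp_s mu) :> A.
  rewrite mulr_sumr mulr_suml big_seq (eq_bigr _ term) -big_seq.
  rewrite (bigD1_seq a0) //= eqxx big1 ?addr0 => [|a /negbTE -> //].
  by rewrite mulrA -iota_central // -mulrA kp_sss // eqxx.
by apply: ideal_mull => //; apply: ideal_mulr => //; exact: ideal_mull.
Qed.

End WithSection.

(** Compressing an element of J to a corner gives iota(c) p_v with v in T, for each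
    of its coefficients c. If c were not in m, it would be invertible modulo m, and
    p_v would lie in J. *)
Theorem ideal_eq_P (T : {set V}) (m : set C) (J : set A) :
  (forall v, v \in T -> exists y : inf_path G,
     [/\ pobj y 0 = v, aperiodic_path y & forall n, pobj y n \in T]) ->
  maximal_ideal m -> two_sided_ideal J ->
  (forall v, J (kp_p v) <-> v \notin T) -> (forall c, m c -> J (iota G c)) ->
  J = P_ideal G T m.
Proof.
move=> hT hm hJ hv hc; apply/seteqP; split; last first.
  by apply: P_ideal_sub => // v; rewrite hv.
move=> x Jx; have hP := P_ideal_ideal rf T m.
have [n hn] := long_span_absorb x 0.
apply: (kp_split rfL (n := n)); [by case: hP|by case: hP|move=> b db].
have [vT|vT] := boolP (src b \in T); last first.
  rewrite -(kp_sp K b) mulrA; apply: (ideal_mulr _ hP); apply: (ideal_mull _ hP).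
  exact: P_ideal_vertex.
apply: (ideal_mulr _ hP).
have [u eu] : exists u : {freeg (arr L) / K},
    x * kp_s b = \sum_(a <- dom u) coeff a u *: kp_s a.
  by apply: (long_span_sum (n := 0)); apply: hn; rewrite db nle_refl.
pose D := [seq a <- dom u | src a == src b].
have {}eu : x * kp_s b = \sum_(a <- D) coeff a u *: kp_s a.
  rewrite -(kp_sp K b) mulrA eu mulr_suml big_filter [RHS]big_mkcond.
  apply: eq_bigr => a _; rewrite -kp_scalerAl kp_s_p.
  by case: eqP; rewrite ?scaler0.
have [nu [nuK nu_deg]] := lift_section.
have [c ec] := iota_group nuK D (fun b' : arr L => coeff b' u).
have Jb : J (x * kp_s b) by exact: ideal_mulr.
rewrite eu ec in Jb *; have [y [y0 hy yT]] := hT _ vT.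
apply: (ideal_sum hP) => a aS; apply: (ideal_mulr _ hP); apply: P_ideal_iota => //.
apply: contrapT => /(maximal_ideal_inv hm)[d md].
have sS a' : a' \in undup (map (@und _ _ f V G) D) -> src a' = pobj y 0.
  rewrite mem_undup => /mapP[b' + ->]; rewrite mem_filter => /andP[/eqP sb' _].
  by rewrite y0 -sb'.
have [n' Jn'] := compress nuK nu_deg hJ hy (undup_uniq _) aS sS Jb.
have : J (kp_p (pobj y n')); last by rewrite hv yT.
rewrite -[kp_p _]mul1r -(iota1 K f rf) -[1](subrK (d * c a)) iotaD mulrDl.
case: (hJ) => _ hD _; apply: hD; first by apply: ideal_mulr => //; exact: hc.
by rewrite iotaM // -mulrA; exact: ideal_mull.
Qed.

End Uniqueness.

(** * Modules induced from isotropy *)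

Lemma n2zB_eq k (p q p' q' : nvec k) :
  n2z p' - n2z q' = n2z (p' + q) - n2z (p + q') + (n2z p - n2z q).
Proof.
by rewrite !n2zD opprD [n2z p' + _ + _]addrACA [RHS]addrACA subrK [n2z q - _]addrC addrK.
Qed.

Section IndTheory.
Variables (K : fieldType) (k : nat) (V : finType) (L : kgraph k V) (x : inf_path L).
Variable W : lmodType (gralg K (isotropy x)).

Local Notation A := (KP K L).
Local Notation B := (gralg K (isotropy x)).
Local Notation fib := (srcfib x).
Local Notation KL := {freeg fib / K}.
Local Notation F := {freeg (KL * W)%type / int}.
Local Notation rel := [set t : F | tensor_rel (@iso_act _ _ _ K x) t].
Local Notation tens := (@ind_tens K k V L x W).
Implicit Types (g : fib) (u : KL) (w : W) (b : B).

Lemma ind_tensDr u w w' : tens u (w + w') = tens u w + tens u w'.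
Proof.
by rewrite /ind_tens -ind_piD; apply/lpiP; apply: sub_lspan; exact: tensor_relDr.
Qed.

Lemma ind_tens_iso u b w : tens (iso_act u b) w = tens u (b *: w).
Proof. by apply/lpiP; apply: sub_lspan; exact: tensor_relM. Qed.

Lemma ind_tens0l w : tens 0 w = 0.
Proof. by apply: (@addIr _ (tens 0 w)); rewrite -ind_tensDl !add0r. Qed.

Lemma ind_tens0r u : tens u 0 = 0.
Proof. by apply: (@addIr _ (tens u 0)); rewrite -ind_tensDr !add0r. Qed.

Lemma ind_tensNr u w : tens u (- w) = - tens u w.
Proof. by apply: (@addIr _ (tens u w)); rewrite -ind_tensDr !addNr ind_tens0r. Qed.

Lemma ind_scalerE (a : A) u w : a *: tens u w = tens (kp_act a u) w.
Proof. exact: ind_scale_tens. Qed.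

Lemma ind_tens_sumr (I : Type) (r : seq I) (P : pred I) u (Q : I -> W) :
  tens u (\sum_(i <- r | P i) Q i) = \sum_(i <- r | P i) tens u (Q i).
Proof. by apply: (big_morph (tens u)); [exact: ind_tensDr|exact: ind_tens0r]. Qed.

Lemma fib_iso0 g : fib_iso g (0 : isotropy x) = g.
Proof. by apply: fib_inj => //=; rewrite /gdeg /= addr0. Qed.

Lemma ind_tensU (c : K) g w : tens << c *g g >> w = tens << g >> ((c *: (1 : B)) *: w).
Proof. by rewrite -ind_tens_iso iso_actZr iso_actUU fib_iso0 [in LHS]freegU1. Qed.

Lemma ind_basis (q : Ind W) : exists s : seq (fib * W),
  q = \sum_(p <- s) tens << p.1 >> p.2.
Proof.
elim/ind_ind: q => [|_ _ [s ->] [s' ->]|_ [s ->]|u w].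
- by exists [::]; rewrite big_nil.
- by exists (s ++ s'); rewrite big_cat.
- exists [seq (p.1, - p.2) | p <- s]; rewrite big_map -sumrN.
  by apply: eq_bigr => p _; rewrite ind_tensNr.
elim/freeg_ind: u => [|u u' [s es] [s' es']|c g].
- by exists [::]; rewrite big_nil ind_tens0l.
- by exists (s ++ s'); rewrite big_cat ind_tensDl es es'.
- by exists [:: (g, (c *: (1 : B)) *: w)]; rewrite big_seq1 ind_tensU.
Qed.

Fact fib_unit_subproof : `[< in_grpd (x, 0, x) /\ gsrc (x, 0, x) = x >].
Proof. by apply/asboolP; split=> //; exact: grpd_id. Qed.

Definition fib_unit : fib := Sub (x, 0, x) fib_unit_subproof.

Lemma fib_iso_of g g' : grng (val g) = grng (val g') ->
  exists h : isotropy x, g' = fib_iso g h.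
Proof.
move=> e; have [[p [q [e1 e2]]] e3] := srcfibP g.
have [[p' [q' [e1' e2']]] e3'] := srcfibP g'.
have hh : gdeg (val g') - gdeg (val g) \in iso_pred x.
  apply/asboolP; exists (p' + q), (p + q'); split.
    rewrite [LHS]/(gdeg (val g') - gdeg (val g)) e1 e1' !n2zD opprB opprD [LHS]addrACA.
    by congr (_ + _); exact: addrC.
  rewrite e3 in e2; rewrite e3' -e in e2'.
  change (shift (p' + q) x = shift (p + q') x).
  by rewrite -(shiftD p') -e2 -(shiftD p) -e2' !shiftD addrC.
exists (Sub (gdeg (val g') - gdeg (val g)) hh); apply: fib_inj; first exact: esym e.
exact: etrans (esym (subrK (gdeg (val g)) _)) (addrC _ _).
Qed.

Lemma kp_act_s_fib (a : arr L) g g' : is_cat a (grng (val g)) (grng (val g')) ->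
  gdeg (val g') = n2z (deg a) + gdeg (val g) ->
  kp_act (kp_s a) (<< g >> : KL) = << g' >>.
Proof.
move=> h1 h2; rewrite kp_act_s /act_s bis_actU (_ : bis_map _ g = Some g') //.
exact: (SmP a g g').2 (conj h1 h2).
Qed.

(** The arrow g' g^-1 of the groupoid lies in some Z(a, b), so s_a s_b^* moves g
    to g'. *)
Lemma fib_move g g' : exists a : A, kp_act a (<< g >> : KL) = << g' >>.
Proof.
have [[p [q [e1 e2]]] e3] := srcfibP g.
have [[p' [q' [e1' e2']]] e3'] := srcfibP g'.
pose b : arr L := parr (grng (val g')) (nle0 (p' + q)).
pose c : arr L := parr (grng (val g)) (nle0 (p + q')).
have es : shift (p' + q) (grng (val g')) = shift (p + q') (grng (val g)).
  rewrite e3 in e2; rewrite e3' in e2'.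
  rewrite [p' + q]addrC -(shiftD q) e2' [p + q']addrC -(shiftD q') e2.
  by rewrite !shiftD addrC.
have hb := is_cat_head (p' + q) (grng (val g')); rewrite -/b in hb.
have hc := is_cat_head (p + q') (grng (val g)); rewrite -/c -es in hc.
exists (kp_s b * kp_ss c).
have sbc : src b = src c by rewrite (is_cat_src hb) (is_cat_src hc).
rewrite kp_act_cyl // bis_actU.
suff -> : bis_map (cyl b c) g = Some g' by [].
apply/bis_mapP; exists (grng (val g'), n2z (deg b) - n2z (deg c), grng (val g)); split=> //.
  by exists (shift (p' + q) (grng (val g'))).
rewrite /gmul e3 e1 !deg_parr0; move: e1' e3'.
case: (val g') => [[r d] s]; rewrite /gdeg /gsrc /= => -> ->.
by rewrite -n2zB_eq.
Qed.

(** The coordinate of L_x on the orbit of the unit under right multiplication by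
    the isotropy group, with values in its group algebra *)
Definition unit_coord : KL -> B :=
  fglift (fun g => if `[< grng (val g) = x >] then
    (if insub (gdeg (val g)) is Some h then << h >> else 0) else 0 : B).

Lemma unit_coordU g (h : isotropy x) : g = fib_iso fib_unit h -> unit_coord << g >> = << h >>.
Proof.
move=> ->; rewrite /unit_coord fglift1 /=; case: asboolP => // _.
by rewrite /gdeg /= add0r valK.
Qed.

Lemma unit_coord_iso u b : unit_coord (iso_act u b) = unit_coord u * b.
Proof.
have cD v v' : unit_coord (v + v') = unit_coord v + unit_coord v' by rewrite /unit_coord raddfD.
have c0 : unit_coord 0 = 0 by rewrite /unit_coord raddf0.
have cZ c v : unit_coord (c *: v) = c *: unit_coord v by exact: fgliftZ.
elim/freeg_ind: u => [|u u' e e'|c g].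
- by rewrite iso_act0l c0 mul0r.
- by rewrite iso_actDl !cD e e' mulrDl.
rewrite freegU1 iso_actZl !cZ -scalerAl; congr (_ *: _).
elim/gralg_ind: b => [|b b' e e'|d b e|h].
- by rewrite iso_act0r c0 mulr0.
- by rewrite iso_actDr cD e e' mulrDr.
- by rewrite iso_actZr cZ e -scalerAr.
rewrite iso_actUU; have [e|ne] := pselect (grng (val g) = x).
  have [h' eg] := fib_iso_of (esym e : grng (val fib_unit) = _).
  rewrite (unit_coordU eg) (unit_coordU (h := h' + h)).
    by rewrite [RHS]gralg_mulUU.
  by rewrite eg; apply: fib_inj => //; rewrite /gdeg /= addrA.
by rewrite /unit_coord !fglift1 /=; case: asboolP => // _; rewrite mul0r.
Qed.

(** Pairing [unit_coord] with W is balanced, so the generators over the unit of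
    L_x do not collapse in the tensor product. *)
Lemma ind_tens_unit w : tens << fib_unit >> w = 0 -> w = 0.
Proof.
pose Phi : F -> zmodule W := fglift (fun uw : KL * W => unit_coord uw.1 *: uw.2 : zmodule W).
have PU u w' : Phi << (u, w') >> = unit_coord u *: w' by exact: fglift1.
have PB t t' : Phi (t - t') = Phi t - Phi t' by rewrite /Phi raddfB.
have PD t t' : Phi (t + t') = Phi t + Phi t' by rewrite /Phi raddfD.
have kerP t : lspan rel t -> Phi t = 0.
  apply: (@lspan_sub _ _ _ [set t | Phi t = 0]).
    split=> [|t1 t2 h1 h2|c t1 h1] /=; first by rewrite /Phi raddf0.
      by rewrite PD h1 h2 addr0.
    by rewrite /Phi fgliftZ -/(Phi t1) h1 scaler0.
  move=> _ [u u' w'|u w1 w2|u b w'] /=; rewrite PB ?PD !PU.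
  - by rewrite /unit_coord raddfD scalerDl subrr.
  - by rewrite scalerDr subrr.
  - by rewrite unit_coord_iso scalerA subrr.
have P1 : unit_coord << fib_unit >> = 1.
  by apply: (unit_coordU (h := 0)); rewrite fib_iso0.
have pi0 : ind_pi (0 : F) = 0 :> Ind W by exact: lpi0.
move=> e; have : lspan rel (<< (<< fib_unit >>, w) >> - 0) by apply/lpiP; rewrite [LHS]e -[LHS]pi0.
by rewrite subr0 => /kerP; rewrite PU P1 scale1r.
Qed.

Lemma ind_tens_neq0 g w : w <> 0 -> tens << g >> w <> 0.
Proof.
move=> hw e; apply: hw; apply: ind_tens_unit.
by have [a <-] := fib_move g fib_unit; rewrite -ind_scalerE e scaler0.
Qed.

(** Elements of L_x with the same range differ by isotropy, so the terms of q can be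
    grouped by their ranges, one element of W for each range. A long prefix lam of
    one range tells it from the others, and s_lam^* cuts these off. *)
Lemma submodule_tens (N : set (Ind W)) q : submodule N -> N q -> q <> 0 ->
  exists g w, w <> 0 /\ N (tens << g >> w).
Proof.
move=> [_ _ NZ] Nq q0; have [s es] := ind_basis q.
have /choice [rep hrep] (y : inf_path L) : exists g : fib,
    (exists g', grng (val g') = y) -> grng (val g) = y.
  by have [[g eg]|ne] := pselect (exists g' : fib, grng (val g') = y);
     [exists g|exists fib_unit].
have /choice [h hh] (g : fib) : exists h : isotropy x, g = fib_iso (rep (grng (val g))) h.
  by apply: fib_iso_of; apply: hrep; exists g.
pose rg (p : fib * W) := grng (val p.1).
pose w_ y := \sum_(p <- s | rg p == y) (<< h p.1 >> : B) *: p.2.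
have eq : q = \sum_(y <- undup (map rg s)) tens << rep y >> (w_ y).
  rewrite es (big_undup_map rg); apply: eq_bigr => y _.
  rewrite /w_ ind_tens_sumr; apply: eq_bigr => p /eqP <-.
  by rewrite -ind_tens_iso iso_actUU -hh.
have [y0 y0s wy0] : exists2 y, y \in undup (map rg s) & w_ y <> 0.
  apply: contra_notP q0 => hw; rewrite eq big_seq big1 // => y ys.
  rewrite (_ : w_ y = 0) ?ind_tens0r //.
  by apply: contra_notP hw => ne; exists y.
have hrng y : y \in undup (map rg s) -> grng (val (rep y)) = y.
  by rewrite mem_undup => /mapP[p _ ->]; apply: hrep; exists p.1.
have [n hn] := prefix_sep y0 (undup (map rg s)).
pose lam := parr y0 (nle0 n).
have [g [hg _]] : exists g, bis_map (cyl (idv (src lam)) lam) (rep y0) = Some g /\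
    grng (val g) = shift n y0.
  by apply: SSm_total; rewrite hrng //; exact: is_cat_head.
exists g, (w_ y0); split=> //.
suff <- : kp_ss lam *: q = tens << g >> (w_ y0) by exact: NZ.
rewrite eq scaler_sumr (bigD1_seq y0) ?undup_uniq //= big_seq_cond big1 => [|y /andP[ys ne]].
  by rewrite addr0 ind_scalerE kp_act_ss /act_ss bis_actU hg.
rewrite ind_scalerE kp_act_ss /act_ss bis_actU.
case E: (bis_map _ _) => [g'|]; last by rewrite ind_tens0l.
have [[e _] _] := (SSmP _ _ _).1 E; case/eqP: ne; apply: hn => //.
by rewrite hrng // in e; rewrite -[RHS]e; apply: parr_irr; rewrite ?deg_parr0.
Qed.

Lemma tens_generates (N : set (Ind W)) g w : simple_module W -> submodule N ->
  w <> 0 -> N (tens << g >> w) -> N = setT.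
Proof.
move=> hW [N0 ND NZ] w0 Ngw.
apply/seteqP; split=> // q _; have [s ->] := ind_basis q.
apply: (big_ind N) => // -[g' w'] _ /=.
have [b ->] := simple_gen w' hW w0.
elim/gralg_ind: b g' => [|b b' hb hb'|c b hb|h] g'.
- by rewrite scale0r ind_tens0r.
- by rewrite scalerDl ind_tensDr; exact: ND.
- rewrite -ind_tens_iso iso_actZr.
  have -> u : tens (c *: u) w = (c *: (1 : A)) *: tens u w.
    by rewrite ind_scalerE kp_actZl kp_act1.
  by apply: NZ; rewrite ind_tens_iso; exact: hb.
rewrite -ind_tens_iso iso_actUU; have [a <-] := fib_move g (fib_iso g' h).
by rewrite -ind_scalerE; exact: NZ.
Qed.

(** A nonzero submodule contains some g (x) w with w nonzero; the arrows of the
    groupoid then move g everywhere, and the isotropy algebra moves w everywhere. *)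
Theorem Ind_simple : simple_module W -> simple_module (Ind W).
Proof.
move=> hW; have [[w w0] _] := hW; split.
  by exists (tens << fib_unit >> w); exact: ind_tens_neq0.
move=> N hN; have [|] := pselect (exists q, N q /\ q <> 0).
  move=> [q [Nq q0]]; right; have [g [w' [w'0 Nw]]] := submodule_tens hN Nq q0;
     exact: tens_generates hW hN w'0 Nw.
move=> h; left; apply/seteqP; split=> [q Nq|_ ->]; last by case: hN.
by apply: contrapT => q0; apply: h; exists q.
Qed.

Lemma ann_Ind_vertex v : (exists w : W, w <> 0) ->
  ann (Ind W) (kp_p v) <-> ~ exists g : fib, pobj (grng (val g)) 0 = v.
Proof.
move=> [w w0]; have pv g : kp_act (kp_p v) (<< g >> : KL) =
    if `[< pobj (grng (val g)) 0 = v >] then << g >> else 0.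
  rewrite kp_act_s /act_s bis_actU; case: asboolP => e.
    by rewrite (_ : bis_map _ g = Some g) //; exact: (PmP v g g).2 (conj e erefl).
  by case E: (bis_map _ _) => [g'|] //; case/PmP: E.
split=> [h [g eg]|h q].
  apply: (ind_tens_neq0 (g := g) w0); have := h (tens << g >> w).
  by rewrite ind_scalerE pv; case: asboolP.
have [s ->] := ind_basis q; rewrite scaler_sumr big1 // => -[g w'] _.
rewrite ind_scalerE pv; case: asboolP => e; last by rewrite ind_tens0l.
by case: h; exists g.
Qed.

End IndTheory.

(** * The action of the group algebra of H on induced modules *)

Section GralgMap.
Variables (K : comNzRingType) (H H' : zmodType) (phi : H -> H').
Implicit Types a b : gralg K H.

Lemma gralg_map0 : gralg_map phi (0 : gralg K H) = 0.
Proof. by rewrite /gralg_map raddf0. Qed.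

Lemma gralg_mapD a b : gralg_map phi (a + b) = gralg_map phi a + gralg_map phi b.
Proof. by rewrite /gralg_map raddfD. Qed.

Lemma gralg_mapZ c a : gralg_map phi (c *: a) = c *: gralg_map phi a.
Proof. exact: fgliftZ. Qed.

Lemma gralg_mapU h : gralg_map phi (<< h >> : gralg K H) = << phi h >>.
Proof. exact: fglift1. Qed.

End GralgMap.

Section ActionOfIota.
Variables (K : fieldType) (k l : nat) (f : {additive nvec k -> nvec l}).
Hypothesis fsurj : forall n, exists m, f m = n.
Variables (V : finType) (G : kgraph l V).
Hypothesis rf : row_finite G.

Local Notation L := (pullback f G).
Local Notation A := (KP K L).
Local Notation H := (ker_fbar f).
Local Notation C := (gralg K H).

(** Both prefixes extend to the one of degree n + n', and factorisation in G only
    sees their common degree f n = f n'. *)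
Lemma pb_prefix_und (y : inf_path L) (n n' : nvec k) : f n = f n' ->
  und (parr y (nle0 n)) = und (parr y (nle0 n')).
Proof.
move=> e; have e1 := parr_comp y (nle0 n) (nle_addr n n') (nle0 (n + n')).
have e2 := parr_comp y (nle0 n') (nle_addl n' n) (nle0 (n + n')).
have s1 : src (parr y (nle0 n)) = rng (parr y (nle_addr n n')) by rewrite src_parr rng_parr.
have s2 : src (parr y (nle0 n')) = rng (parr y (nle_addl n' n)) by rewrite src_parr rng_parr.
have : comp (und (parr y (nle0 n))) (und (parr y (nle_addr n n'))) =
    comp (und (parr y (nle0 n'))) (und (parr y (nle_addl n' n))).
  by rewrite -!und_comp // -e1 -e2.
by case/fact_uniq => //; rewrite !deg_und !deg_parr0.
Qed.

(** Thus every path of the pullback is periodic along H, which is why U_h can act on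
    L_x by translating the degree. *)
Lemma pb_shift (y : inf_path L) (n n' : nvec k) : f n = f n' -> shift n y = shift n' y.
Proof.
move=> e; apply: inf_path_prefix => r.
have h j := is_cat_prefix r (is_cat_head j y).
have s j : src (parr y (nle0 j)) = rng (parr (shift j y) (nle0 r)).
  by rewrite src_parr rng_parr /= /shift_obj add0r.
have : comp (und (parr y (nle0 n))) (und (parr (shift n y) (nle0 r))) =
    comp (und (parr y (nle0 n'))) (und (parr (shift n' y) (nle0 r))).
  rewrite -!und_comp // -!h; apply: pb_prefix_und.
  by rewrite !deg_parr0 !raddfD /= e.
case/fact_uniq; rewrite ?deg_und ?deg_parr0 //.
- by rewrite -[LHS]/(src (parr y (nle0 n))) s.
- by rewrite -[LHS]/(src (parr y (nle0 n'))) s.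
by move=> _ eu; apply: pb_inj => //; rewrite !deg_parr0.
Qed.

Lemma kp_act_U (x : inf_path L) (h : H) (g g' : srcfib x) :
  grng (val g') = grng (val g) -> gdeg (val g') = gdeg (val g) + val h ->
  kp_act (U_elt K G h) (<< g >> : {freeg (srcfib x) / K}) = << g' >>.
Proof.
move=> er ed; set y := grng (val g) in er.
pose n := zneg (val h); pose n' := zpos (val h).
have en : f n' = f n := ker_posneg h.
have [g1 [+ e1]] := SSm_total (is_cat_head n y : is_cat _ _ (grng (val g))).
move=> /(SSmP _ _ _).1 [_ d1]; rewrite deg_parr0 in d1.
have <- : kp_act (kp_s (parr y (nle0 n)) : A) << g1 >> = << g >>.
  by apply: kp_act_s_fib; rewrite ?e1 ?d1 ?deg_parr0; [exact: is_cat_head|rewrite addrC subrK].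
rewrite -kp_actM (U_s K rf (b' := parr y (nle0 n'))).
- apply: kp_act_s_fib; first by rewrite e1 er (pb_shift y (esym en)); exact: is_cat_head.
  by rewrite ed d1 deg_parr0 zposE -/n [n2z n + _]addrC -addrA [n2z n + _]addrC subrK addrC.
- exact: pb_prefix_und.
- by rewrite !deg_parr0 zposE.
Qed.

Variable x : inf_path G.
Hypothesis hx : aperiodic_path x.

Local Notation i2k := (isotropy_to_ker fsurj hx).
Local Notation KL := {freeg (srcfib (path_lift f x)) / K}.

Lemma kp_act_iota (c : gralg K (isotropy (path_lift f x))) (u : KL) :
  kp_act (iota G (gralg_map i2k c)) u = iso_act u c.
Proof.
elim/gralg_ind: c => [|c c' e e'|d c e|h].
- by rewrite gralg_map0 iota0 kp_act0l iso_act0r.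
- by rewrite gralg_mapD iotaD kp_actDl e e' iso_actDr.
- by rewrite gralg_mapZ iotaZ kp_actZl e iso_actZr.
rewrite gralg_mapU iotaU.
elim/freeg_ind: u => [|u u' e e'|d g].
- by rewrite [LHS]term_act0 iso_act0l.
- by rewrite kp_actDr e e' iso_actDl.
by rewrite freegU1 kp_actZr iso_actZl iso_actUU (kp_act_U (g' := fib_iso g h)).
Qed.

Lemma gralg_map_surj (c : C) : exists b, gralg_map i2k b = c.
Proof.
have [j _ ijK] := isotropy_to_ker_bij fsurj hx.
exists (gralg_map j c); elim/gralg_ind: c => [|c c' e e'|d c e|h].
- by rewrite !gralg_map0.
- by rewrite !gralg_mapD e e'.
- by rewrite !gralg_mapZ e.
- by rewrite !gralg_mapU ijK.
Qed.

Variable m : set C.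
Hypothesis hm : maximal_ideal m.

Theorem M_module_simple : simple_module (M_module fsurj hx m).
Proof.
apply: Ind_simple; apply: simple_restr; first exact: gralg_map_surj.
exact: simple_quotient.
Qed.

Lemma ann_M_iota c : m c -> ann (M_module fsurj hx m) (iota G c).
Proof.
have [b <-] := gralg_map_surj c => mc q.
have [s ->] := ind_basis q; rewrite scaler_sumr big1 // => -[g w] _ /=.
rewrite ind_scalerE kp_act_iota ind_tens_iso (_ : b *: w = 0) ?ind_tens0r //.
rewrite -[w]lreprK [LHS]lquot_scaleE.
rewrite -(lpi0 (m : set C^o)); apply/lpiP; rewrite subr0 lspan_ideal; last by case: hm.
by rewrite [X in m X]mulrC; case: hm => hi _ _; exact: ideal_mull.
Qed.

End ActionOfIota.

(** * Central elements act by scalars on simple modules *)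

Lemma closed_axiom_root (K : fieldType) (q : {poly K}) :
  GRing.closed_field_axiom K -> (1 < size q)%N -> exists r, root q r.
Proof.
move=> cK sq; have lq : lead_coef q != 0.
  by rewrite lead_coef_eq0 -size_poly_gt0 ltnW.
(* The axiom concerns monic equations solved for the leading power. *)
have [r er] := cK (size q).-1 (fun i => - (q`_i / lead_coef q)) (ltac:(by rewrite -ltnS prednK // ltnW)).
exists r; rewrite /root horner_coef -(prednK (ltnW sq)) big_ord_recr /= er mulr_sumr -big_split.
rewrite big1 // => i _ /=; rewrite -[q`_(size q).-1]/(lead_coef q).
by rewrite mulNr mulrN mulrA mulrCA divff // mulr1 subrr.
Qed.

Section Amitsur.
Variables (K : fieldType) (k : nat) (V : finType) (L : kgraph k V).
Hypothesis rf : row_finite L.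
Local Notation A := (KP K L).
Variable z : A.
Hypothesis z_central : forall a, z * a = a * z.
Implicit Types (p q : {poly K}) (c d : K).

(** The value q(z), as an explicit sum because A is the zero ring for an empty graph,
    while polynomials are evaluated in nonzero rings. *)
Definition poly_at q : A := \sum_(i < size q) q`_i *: z ^+ i.

Lemma poly_at_big n q : (size q <= n)%N -> poly_at q = \sum_(i < n) q`_i *: z ^+ i.
Proof.
move=> h; rewrite /poly_at (big_ord_widen n (fun i => q`_i *: z ^+ i) h) big_mkcond.
apply: eq_bigr => i _; case: ifP => // /negbT; rewrite -leqNgt => h'.
by rewrite nth_default // scale0r.
Qed.

Lemma poly_at0 : poly_at 0 = 0.
Proof. by rewrite /poly_at size_poly0 big_ord0. Qed.

Lemma poly_atD p q : poly_at (p + q) = poly_at p + poly_at q.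
Proof.
pose n := maxn (size p) (size q).
rewrite (poly_at_big (n := n)) ?size_polyD // (poly_at_big (n := n)) ?leq_maxl //.
rewrite (poly_at_big (n := n) (q := q)) ?leq_maxr // -big_split.
by apply: eq_bigr => i _; rewrite coefD scalerDl.
Qed.

Lemma poly_atC c : poly_at c%:P = c *: (1 : A).
Proof.
by rewrite (poly_at_big (n := 1)) ?size_polyC_leq1 // big_ord1 coefC expr0.
Qed.

Lemma poly_atZ c q : poly_at (c *: q) = c *: poly_at q.
Proof.
rewrite (poly_at_big (n := size q)) ?size_scale_leq // scaler_sumr.
by apply: eq_bigr => i _; rewrite coefZ scalerA.
Qed.

Lemma poly_atMX q : poly_at (q * 'X) = poly_at q * z.
Proof.
rewrite (poly_at_big (n := (size q).+1)); last first.
  by apply: leq_trans (size_polyMleq _ _) _; rewrite size_polyX addn2.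
rewrite big_ord_recl coefMX scale0r add0r mulr_suml; apply: eq_bigr => i _.
by rewrite coefMX /= -kp_scalerAl exprSr.
Qed.

Lemma poly_atM p q : poly_at (p * q) = poly_at p * poly_at q.
Proof.
elim/poly_ind: p => [|p c IH]; first by rewrite mul0r poly_at0 mul0r.
rewrite mulrDl mul_polyC poly_atD poly_atZ mulrAC poly_atMX IH.
rewrite poly_atD poly_atMX poly_atC mulrDl -kp_scalerAl mul1r; congr (_ + _).
by rewrite -!mulrA z_central.
Qed.

Lemma poly_atXsubC c : poly_at ('X - c%:P) = z - c *: (1 : A).
Proof.
by rewrite -polyCN poly_atD poly_atC -['X]mul1r poly_atMX poly_atC scale1r mul1r scaleNr.
Qed.

Variable M : lmodType A.
Hypothesis simM : simple_module M.
Implicit Types (u v : M).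

(** Schur's lemma for one central element: its kernel and image are submodules. *)
Lemma central_kills_or_inj (a : A) : (forall b, a * b = b * a) ->
  ann M a \/ ((forall u, a *: u = 0 -> u = 0) /\ forall u, exists v, a *: v = u).
Proof.
move=> ca; have [_ hM] := simM.
have hker : submodule [set u : M | a *: u = 0].
  split=> [|u v /= eu ev|b u /= eu]; first by rewrite /= scaler0.
    by rewrite scalerDr eu ev addr0.
  by rewrite scalerA ca -scalerA eu scaler0.
have him : submodule [set a *: u | u in [set: M]].
  split=> [|_ _ [u _ <-] [v _ <-]|b _ [u _ <-]].
  - by exists 0; rewrite ?scaler0.
  - by exists (u + v); rewrite ?scalerDr.
  - by exists (b *: u); rewrite ?scalerA ?ca.
have [ek|ek] := hM _ hker; last first.
  by left=> u; have : [set u : M | a *: u = 0] u by rewrite ek.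
have inj u : a *: u = 0 -> u = 0.
  by move=> e; have : [set u : M | a *: u = 0] u by []; rewrite ek.
right; split=> // u; have [ei|ei] := hM _ him.
  exists u; have e0 : a *: u = 0.
    by have : [set a *: v | v in [set: M]] (a *: u) by [exists u]; rewrite ei.
  by rewrite e0 (inj u e0).
by have [v _ e] : [set a *: v | v in [set: M]] u by [rewrite ei]; exists v.
Qed.

Lemma scalerZl c (a : A) u : (c *: a) *: u = (c *: (1 : A)) *: (a *: u).
Proof. by rewrite scalerA -kp_scalerAl mul1r. Qed.

Lemma scaler_unit c u : c != 0 -> (c *: (1 : A)) *: u = 0 -> u = 0.
Proof.
move=> c0 e; have : (c^-1 *: (1 : A)) *: ((c *: (1 : A)) *: u) = u.
  by rewrite -scalerZl scalerA mulVf // !scale1r.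
by rewrite e scaler0.
Qed.

Lemma poly_at_inj q u : GRing.closed_field_axiom K ->
  (forall c, ~ ann M (z - c *: (1 : A))) -> q != 0 -> poly_at q *: u = 0 -> u = 0.
Proof.
move=> cK nk; have [n] := ubnP (size q); elim: n q u => // n IH q u sq q0.
have [s1|s1] := leqP (size q) 1.
  have -> : q = (q`_0)%:P by exact: size1_polyC.
  rewrite poly_atC; apply: scaler_unit; apply: contra q0 => /eqP e.
  by rewrite [q]size1_polyC // e.
have [r /factor_theorem[p ep]] := closed_axiom_root cK s1.
have p0 : p != 0 by apply: contra q0; rewrite ep => /eqP ->; rewrite mul0r.
have sp : (size p < n)%N.
  by move: sq; rewrite ep size_Mmonic ?monicXsubC // size_XsubC addn2 ltnS.
rewrite ep poly_atM -scalerA => /(IH _ _ sp p0); rewrite poly_atXsubC.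
have ca b : (z - r *: (1 : A)) * b = b * (z - r *: (1 : A)).
  by rewrite mulrBl mulrBr z_central -kp_scalerAl -kp_scalerAr mul1r mulr1.
by have [/nk|[inj _]] := central_kills_or_inj ca; [|exact: inj].
Qed.

Lemma kp_countable_span : exists t : nat -> A, forall a : A,
  exists n (B : nat -> K), a = \sum_(j < n) B j *: t j.
Proof.
pose t j : A := if unpickle j is Some (a, b) then kp_s (a : arr L) * kp_ss b else 0.
exists t => a; have := kp_lspan a rf.
apply: (@lspan_sub _ _ _ [set a | exists n (B : nat -> K), a = \sum_(j < n) B j *: t j])
  => [|_ [b [c ->]]].
  have ext n m (B : nat -> K) : (n <= m)%N -> \sum_(j < n) B j *: t j =
      \sum_(j < m) (if (j < n)%N then B j else 0) *: t j.
    move=> h; rewrite (big_ord_widen m (fun j => B j *: t j) h) big_mkcond.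
    by apply: eq_bigr => i _; case: ifP => // _; rewrite scale0r.
  split=> [|u v [n [B eu]] [n' [B' ev]]|c u [n [B eu]]].
  - by exists 0%N, (fun=> 0); rewrite big_ord0.
  - pose m := maxn n n'; exists m.
    exists (fun j => (if (j < n)%N then B j else 0) + (if (j < n')%N then B' j else 0)).
    rewrite eu ev (ext n m) ?leq_maxl // (ext n' m) ?leq_maxr // -big_split.
    by apply: eq_bigr => j _; rewrite scalerDl.
  - exists n, (fun j => c * B j); rewrite eu scaler_sumr.
    by apply: eq_bigr => j _; rewrite scalerA.
exists (pickle (b, c)).+1, (fun j => if j == pickle (b, c) then 1 else 0).
rewrite big_ord_recr /= eqxx scale1r big1 ?add0r => [|j _].
  by rewrite /t pickleK.
by rewrite (ltn_eqF (ltn_ord j)) scale0r.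
Qed.

(** Amitsur's trick. Were all z - c bijective on M, the uncountably many vectors
    (z - c)^-1 u would be dependent in the countably spanned space M, and clearing
    denominators in a linear relation gives a nonzero polynomial q with q(z) u = 0. *)
Theorem central_scalar : ~ countable [set: K] -> GRing.closed_field_axiom K ->
  exists c, ann M (z - c *: (1 : A)).
Proof.
move=> uK cK; apply: contrapT => nk'.
have nk c : ~ ann M (z - c *: (1 : A)) by move=> h; apply: nk'; exists c.
have [[u u0] _] := simM; have [t ht] := kp_countable_span.
have ca c b : (z - c *: (1 : A)) * b = b * (z - c *: (1 : A)).
  by rewrite mulrBl mulrBr z_central -kp_scalerAl -kp_scalerAr mul1r mulr1.
pose comb n (B : nat -> K) : M := (\sum_(j < n) B j *: t j) *: u.
pose S n : set K := [set c | exists B, (z - c *: (1 : A)) *: comb n B = u].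
(* Infinitely many of the vectors (z - c)^-1 u lie in the span of the first n
   vectors t_j u, as K is not a countable union of finite sets. *)
have [n Sn] : exists n, infinite_set (S n).
  apply: uncountable_fiber => // c.
  have [/nk//|[_ /(_ u)[v ev]]] := central_kills_or_inj (ca c).
  have [a ea] := simple_gen v simM u0; have [n [B eB]] := ht a.
  by exists n, B; rewrite /comb -eB -ea.
have [X XS sX] := infinite_set_fset n.+1 Sn.
pose kap (i : 'I_n.+1) : K := nth 0 (finmap.enum_fset X) i.
have kap_inj : injective kap.
  move=> i j /eqP; rewrite nth_uniq ?finmap.fset_uniq //; first by move/eqP/val_inj.
    exact: leq_trans (ltn_ord i) sX.
  exact: leq_trans (ltn_ord j) sX.
have /choice [B hB] (i : 'I_n.+1) : exists B, (z - kap i *: (1 : A)) *: comb n B = u.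
  by apply: XS; apply: mem_nth; exact: leq_trans (ltn_ord i) sX.
pose Bm : 'M[K]_(n.+1, n) := \matrix_(i, j) B i j.
(* A linear relation between n + 1 of them, which exists as they have only n
   coordinates *)
have /rowV0Pn [r /sub_kermxP rB r0] : kermx Bm != 0.
  rewrite kermx_eq0 /row_free; apply/negP => /eqP e.
  by have := rank_leq_col Bm; rewrite e ltnn.
have [i0 ri0] : exists i, r 0 i != 0.
  apply: contrapT => h; case/eqP: r0; apply/rowP => i; rewrite mxE.
  by apply: contrapT => /eqP ne; apply: h; exists i.
have rel : \sum_i (r 0 i *: (1 : A)) *: comb n (B i) = 0.
  have -> : \sum_i (r 0 i *: (1 : A)) *: comb n (B i) =
      (\sum_i \sum_(j < n) (r 0 i * B i j) *: t j) *: u.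
    rewrite scaler_suml; apply: eq_bigr => i _; rewrite -scalerZl; congr (_ *: _).
    by rewrite scaler_sumr; apply: eq_bigr => j _; rewrite scalerA.
  rewrite exchange_big big1 ?scale0r // => j _; rewrite -scaler_suml.
  move/rowP/(_ j): rB; rewrite !mxE => e.
  rewrite (_ : \sum_i _ = 0) ?scale0r // -[RHS]e.
  by apply: eq_bigr => i _; rewrite mxE.
(* The relation sum_i r_i (z - kap_i)^-1 u = 0 becomes q(z) u = 0 once it is
   multiplied by the product of all z - kap_j. *)
pose Q (i : 'I_n.+1) : {poly K} := \prod_(j | j != i) ('X - (kap j)%:P).
pose Qall : {poly K} := \prod_j ('X - (kap j)%:P).
have QallE i : Qall = Q i * ('X - (kap i)%:P) by rewrite /Qall (bigD1 i) //= mulrC.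
pose q := \sum_i r 0 i *: Q i.
have q0 : q != 0.
  apply/eqP => /(congr1 (horner^~ (kap i0))).
  rewrite horner0 horner_sum (bigD1 i0) //= big1 => [|i ne].
    rewrite addr0 hornerZ horner_prod => /eqP; rewrite mulf_eq0 (negbTE ri0) /=.
    move/prodf_eq0 => [j ne]; rewrite hornerXsubC subr_eq0 => /eqP/kap_inj e.
    by rewrite e eqxx in ne.
  rewrite hornerZ horner_prod (bigD1 i0) 1?eq_sym //= hornerXsubC subrr.
  by rewrite mul0r mulr0.
apply: u0; apply: (poly_at_inj cK nk q0).
have -> : poly_at q = \sum_i r 0 i *: poly_at (Q i).
  rewrite /q; apply: (big_ind2 (fun x y => poly_at x = y)) => [|p1 y1 p2 y2 <- <-|i _].
  - exact: poly_at0.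
  - exact: poly_atD.
  - exact: poly_atZ.
transitivity (poly_at Qall *: (0 : M)); last by rewrite scaler0.
rewrite -[X in _ = _ *: X]rel scaler_suml scaler_sumr.
apply: eq_bigr => i _; rewrite scalerZl -{1}(hB i).
rewrite (QallE i) poly_atM poly_atXsubC !scalerA.
congr (_ *: _); rewrite -!kp_scalerAl mul1r -kp_scalerAr mulr1.
exact: kp_scalerAl.
Qed.

End Amitsur.

(** * Maximal tails and their infinite paths *)

Section TailPaths.
Variables (l : nat) (V : finType) (G : kgraph l V).
Variables (T : {set V}) (hT : maximal_tail G T).

Lemma conn_trans u v w : conn G u v -> conn G v w -> conn G u w.
Proof.
move=> [a [ra sa]] [b [rb sb]]; have e : src a = rng b by rewrite sa rb.
by exists (comp a b); rewrite rng_comp // src_comp.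
Qed.

Lemma tail_vertex (v : V) : v \in T -> v \notin (~: T)%SET.
Proof. by rewrite inE negbK. Qed.

Lemma tail_arrow (a : arr G) : src a \in T -> exists b : arr (tail_graph hT),
  val (rng b) = rng a /\ val (src b) = src a.
Proof.
move=> /tail_vertex h.
by exists (Sub a h : {a : arr G | src a \notin (~: T)%SET}).
Qed.

(** (MT3) says that T is directed, and T is finite. *)
Lemma tail_root : exists2 w, w \in T & forall v, v \in T -> conn G v w.
Proof.
have [T0 _ _ mt3] := hT; have [v0 v0T] := set0Pn _ T0.
suff [w wT hw] : exists2 w, w \in T & forall v, v \in enum T -> conn G v w.
  by exists w => // v vT; apply: hw; rewrite mem_enum.
have : {subset enum T <= T} by move=> v; rewrite mem_enum.
elim: (enum T) => [|v s IH] sT; first by exists v0.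
have [|w wT hw] := IH; first by move=> u us; apply: sT; rewrite inE us orbT.
have vT : v \in T by apply: sT; rewrite mem_head.
have [z [zT vz wz]] := mt3 v w vT wT.
exists z => // u; rewrite inE => /predU1P[-> //|/hw uw]; exact: conn_trans uw wz.
Qed.

Lemma tail_saturated : saturated G (~: T)%SET.
Proof.
have [_ _ mt2 _] := hT; move=> v n _ h; rewrite inE; apply/negP => vT.
by have [a [/h + aT]] := mt2 v n vT; rewrite inE aT.
Qed.

Hypothesis hsa : strongly_aperiodic G.

Lemma tail_aperiodic v : v \in T -> exists x : inf_path (tail_graph hT),
  val (pobj x 0) = v /\ aperiodic_path x.
Proof.
have [T0 _ _ _] := hT.
have ne : (~: T)%SET != [set: V]%SET.
  by apply: contra T0 => /eqP e; rewrite -[T]finset.setCK e finset.setCT.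
move=> /tail_vertex h.
have [x [e hx]] := hsa (maximal_tail_hereditary hT) tail_saturated ne (Sub v h).
by exists x; rewrite e SubK.
Qed.

Lemma path_incl_in_T (x : inf_path (tail_graph hT)) n : pobj (path_incl x) n \in T.
Proof. by have := valP (pobj x n); rewrite inE negbK. Qed.

Lemma tail_aperiodic_path v : v \in T -> exists y : inf_path G,
  [/\ pobj y 0 = v, aperiodic_path y & forall n, pobj y n \in T].
Proof.
move=> /tail_aperiodic[x [e hx]]; exists (path_incl x); split=> //.
  exact: path_incl_aperiodic.
exact: path_incl_in_T.
Qed.

Lemma tail_choice_exists : exists w (x : inf_path (tail_graph hT)), tail_choice w x.
Proof.
have [w wT hw] := tail_root; have [x [e hx]] := tail_aperiodic wT.
exists w, x; split=> // v /hw[a [<- sa]].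
by have [b [rb sb]] : exists b : arr (tail_graph hT),
  val (rng b) = rng a /\ val (src b) = src a; [apply: tail_arrow; rewrite sa|
  exists b; rewrite rb sb].
Qed.

End TailPaths.

(** * The annihilator of an induced module *)

Section Annihilator.
Variables (K : fieldType) (k l : nat) (f : {additive nvec k -> nvec l}).
Hypothesis fsurj : forall n, exists m, f m = n.
Variables (V : finType) (G : kgraph l V).
Hypotheses (rf : row_finite G) (hsa : strongly_aperiodic G).
Local Notation L := (pullback f G).

Section Choice.
Variables (T : {set V}) (hT : maximal_tail G T) (w : V) (x : inf_path (tail_graph hT)).
Hypothesis hc : tail_choice w x.

(** A path that is shift equivalent to x reaches T, so it starts in T by (MT1);
    conversely a vertex of T reaches x(0), and one can prefix x with a path from it. *)
Lemma tail_fiber v :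
  (exists g : srcfib (path_lift f (path_incl x)), pobj (grng (val g)) 0 = v) <-> v \in T.
Proof.
have [wT x0 _ hw] := hc; split=> [[g <-]|vT].
  have [[p [q [_ e2]]] e3] := srcfibP g; rewrite e3 in e2.
  have [_ mt1 _ _] := hT; apply: (mt1 _ (pobj (grng (val g)) p)).
    have := congr1 (fun y => pobj y 0) e2; rewrite /= /shift_obj !add0r => ->.
    exact: path_incl_in_T.
  exists (und (parr (grng (val g)) (nle0 p))); split.
    exact: (rng_parr (grng (val g)) (nle0 p)).
  exact: (src_parr (grng (val g)) (nle0 p)).
have [a [ra sa]] := hw v vT; pose a' : arr G := val a.
have [n en] := fsurj (deg a'); have [b [ub db]] := pb_lift (esym en).
pose X := path_lift f (path_incl x).
have sb : src b = pobj X 0.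
  by rewrite -[LHS]/(src (und b)) ub -[LHS]/(val (src a)) sa /= raddf0.
have cb := cat_pathP sb.
have hg : `[< in_grpd (cat_path sb, n2z (deg b), X) /\ gsrc (cat_path sb, n2z (deg b), X) = X >].
  apply/asboolP; split=> //; exists (deg b), 0; split; first by rewrite n2z0 subr0.
  by rewrite shift0; case: cb.
exists (Sub (cat_path sb, n2z (deg b), X) hg : srcfib X).
by rewrite [LHS](is_cat_rng cb) -[LHS]/(rng (und b)) ub.
Qed.

Theorem ann_M_tail (m : set (gralg K (ker_fbar f))) : maximal_ideal m ->
  simple_module (M_tail fsurj hc m) /\ ann (M_tail fsurj hc m) = P_ideal G T m.
Proof.
move=> hm; split; first exact: M_module_simple.
apply: (ideal_eq_P fsurj rf) => //.
- exact: tail_aperiodic_path.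
- exact: ann_ideal.
- move=> v; rewrite ann_Ind_vertex.
    by rewrite tail_fiber; split=> [/negP|/negP].
  have [] : simple_module (restr (gralg_map (K := K)
     (isotropy_to_ker fsurj (tail_choice_aperiodic hc))) (kappa m) : lmodType _).
    apply: simple_restr; first exact: gralg_map_surj.
    exact: simple_quotient.
  by [].
- exact: ann_M_iota.
Qed.

End Choice.

(** * Primitive ideals *)

Section PrimitiveIdeal.
Variable M : lmodType (KP K L).
Hypothesis simM : simple_module M.
Local Notation A := (KP K L).
Local Notation P := (ann M).

Let hP : two_sided_ideal P := ann_ideal M.
Let rfL : row_finite L := row_finite_pullback f rf.

Definition live : {set V} := [set v : V | `[< ~ P (kp_p v) >]]%SET.

Lemma liveP v : reflect (~ P (kp_p v)) (v \in live).
Proof. by rewrite inE; exact: asboolP. Qed.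

(** As M is simple, p_v A p_w acts nontrivially on M. So does then some
    p_v s_a s_b^* p_w, which factors through the vertex s(a) = s(b). *)
Lemma live_directed v w : v \in live -> w \in live ->
  exists z, [/\ z \in live, conn G v z & conn G w z].
Proof.
move=> /liveP vP /liveP wP.
have [u1 h1] : exists u, kp_p w *: u <> 0 :> M.
  by apply: contrapT => h; apply: wP => u; apply: contrapT => ne; apply: h; exists u.
have [u2 h2] : exists u, kp_p v *: u <> 0 :> M.
  by apply: contrapT => h; apply: vP => u; apply: contrapT => ne; apply: h; exists u.
have [a ea] := simple_gen u2 simM h1.
have [b [c hbc]] : exists b c : arr L,
    (kp_p v * (kp_s b * kp_ss c) * kp_p w : A) *: u1 <> 0.
  apply: contrapT => hn; apply: h2; rewrite ea !scalerA; move: {ea} a.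
  move=> a; have := kp_lspan a rfL.
  apply: (@lspan_sub _ _ _ [set a : A | (kp_p v * a * kp_p w) *: u1 = 0]).
    split=> [|a1 a2 /= e1 e2|d a1 /= e1] /=; first by rewrite mulr0 mul0r scale0r.
      by rewrite mulrDr mulrDl scalerDl e1 e2 addr0.
    by rewrite -kp_scalerAr -kp_scalerAl scalerZl e1 scaler0.
  by move=> _ [b [c ->]] /=; apply: contrapT => ne; apply: hn; exists b, c.
have rb : rng b = v.
  apply: contrapT => ne; apply: hbc; rewrite mulrA kp_p_s; case: eqP => [e|_].
    by case: ne.
  by rewrite !mul0r scale0r.
have rc : rng c = w.
  by apply: contrapT => ne; apply: hbc; rewrite -!mulrA kp_ss_p // !mulr0 scale0r.
have sbc : src c = src b.
  apply: contrapT => ne; apply: hbc; rewrite -(kp_sp K b) -[kp_s b * _ * _]mulrA.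
  by rewrite kp_p_ss // !mulr0 mul0r scale0r.
exists (src b); split.
- apply/liveP => sP; apply: hbc; rewrite -(kp_sp K b).
  by rewrite !mulrA -!scalerA sP !scaler0.
- by exists (und b).
- by exists (und c).
Qed.

Lemma live_maximal_tail : maximal_tail G live.
Proof.
split.
- apply/eqP => l0; have [[u u0] _] := simM; apply: u0.
  rewrite -[u]scale1r (_ : 1 = \sum_(v : V) kp_p v) // scaler_suml big1 // => v _.
  have : v \notin live by rewrite l0 inE.
  by move/liveP/contrapT; apply.
- move=> v w /liveP wP [a [ra sa]]; apply/liveP => vP; apply: wP.
  have [n en] := fsurj (deg a); have [b [ub db]] := pb_lift (esym en).
  have sb : src b = w by rewrite -sa -ub.
  have rb : rng b = v by rewrite -ra -ub.
  have -> : kp_p w = kp_ss b * kp_s b :> A by rewrite kp_sss // eqxx sb.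
  apply: (ideal_mull _ hP); rewrite -(kp_ps K b) rb; exact: (ideal_mulr _ hP).
- move=> v n /liveP vP; have [n' en] := fsurj n.
  apply: contrapT => hn; apply: vP.
  have [r [_ hr ->]] := kp_p_sum K rfL v n'.
  apply: (ideal_sum hP) => b /hr[rb db].
  rewrite -(kp_sp K b); apply: (ideal_mulr _ hP); apply: (ideal_mull _ hP).
  apply: contrapT => /liveP sP; apply: hn; exists (und b).
  by split=> //; split=> //; rewrite deg_und db.
- exact: live_directed.
Qed.

Hypotheses (uK : ~ countable [set: K]) (cK : GRing.closed_field_axiom K).

(** C acts on M by scalars, so that modulo this ideal every element of C is one. *)
Lemma central_character :
  maximal_ideal [set c : gralg K (ker_fbar f) | P (iota G c)].
Proof.
have [u [u0 _]] : exists u : M, u <> 0 /\ True by have [[u u0] _] := simM; exists u.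
set m := [set c | _].
have hm : two_sided_ideal m.
  split=> [|a b ha hb|a b hb]; rewrite /m /=.
  - by rewrite iota0; case: hP.
  - by rewrite iotaD; case: hP => _ hD _; exact: hD.
  - by rewrite !iotaM //; split; [apply: (ideal_mull _ hP)|apply: (ideal_mulr _ hP)].
split=> // [e|J hJ mJ].
  have : m 1 by rewrite e.
  by rewrite /m /= iota1 // => /(_ u); rewrite scale1r.
have [h|h] := pselect (J `<=` m); [left|right]; first by apply/seteqP.
have [c Jc mc] : exists2 c, J c & ~ m c.
  by apply: contrapT => h'; apply: h => c Jc; apply: contrapT => mc; apply: h'; exists c.
have [d hd] := central_scalar rfL (iota_central rf c) simM uK cK.
have md : m (c - d *: 1).
  by rewrite /m /= -scaleN1r iotaD !iotaZ iota1 // scaleN1r.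
have d0 : d != 0.
  by apply: contra_notN mc => /eqP d0; move: md; rewrite d0 scale0r subr0.
apply: ideal_full => //.
have -> : 1 = (d^-1 *: 1) * c - (d^-1 *: 1) * (c - d *: 1) :> gralg K (ker_fbar f).
  by rewrite -mulrBr opprB addrC subrK -scalerAl mul1r scalerA mulVf // scale1r.
case: (hJ) => _ hD _; apply: hD; first exact: ideal_mull.
by apply: ideal_opp => //; apply: ideal_mull => //; exact: mJ.
Qed.

Theorem primitive_eq_P : exists (T : {set V}) (hT : maximal_tail G T)
    (m : set (gralg K (ker_fbar f))), maximal_ideal m /\ P = P_ideal G T m.
Proof.
exists live, live_maximal_tail, [set c | P (iota G c)]; split.
  exact: central_character.
apply: (ideal_eq_P fsurj rf) => //.
- exact: (tail_aperiodic_path live_maximal_tail hsa).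
- exact: central_character.
- move=> v; split=> [h|/liveP/contrapT //]; apply/liveP; exact.
Qed.

End PrimitiveIdeal.
End Annihilator.

(** * Annihilators of the induced modules and primitive ideals *)

Theorem theorem6p5 (K : fieldType) (k l : nat)
    (f : {additive nvec k -> nvec l}) (fsurj : forall n, exists m, f m = n)
    (V : finType) (G : kgraph l V) (hrf : row_finite G) (hns : no_sources G)
    (hsa : strongly_aperiodic G) :
  [/\
    forall (T : {set V}) (hT : maximal_tail G T) (w : V)
        (x : inf_path (tail_graph hT)) (hc : tail_choice w x)
        (m : set (gralg K (ker_fbar f))),
      maximal_ideal m ->
      simple_module (M_tail fsurj hc m) /\
      ann (M_tail fsurj hc m) = P_ideal G T m,
    forall (T : {set V}) (hT : maximal_tail G T)
        (m : set (gralg K (ker_fbar f))),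
      maximal_ideal m ->
      exists (w : V) (x : inf_path (tail_graph hT)) (hc : tail_choice w x),
        ann (M_tail fsurj hc m) = P_ideal G T m
  & ~ countable [set: K] -> GRing.closed_field_axiom K ->
    forall P : set (KP K (pullback f G)), primitive_ideal P ->
    exists (T : {set V}) (hT : maximal_tail G T)
        (m : set (gralg K (ker_fbar f))),
      [/\ maximal_ideal m, P = P_ideal G T m &
          exists (w : V) (x : inf_path (tail_graph hT)) (hc : tail_choice w x),
            P = ann (M_tail fsurj hc m)]].
Proof.
have realised (T : {set V}) (hT : maximal_tail G T) (m : set (gralg K (ker_fbar f))) :
    maximal_ideal m ->
    exists (w : V) (x : inf_path (tail_graph hT)) (hc : tail_choice w x),
      ann (M_tail fsurj hc m) = P_ideal G T m.
  move=> hm; have [w [x hc]] := tail_choice_exists hT hsa.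
  by exists w, x, hc; have [] := ann_M_tail fsurj hrf hsa hc hm.
split=> //.
- by move=> T hT w x hc m hm; exact: ann_M_tail.
move=> uK cK P [M [simM ->]].
have [T [hT [m [hm eP]]]] := primitive_eq_P fsurj hrf hsa simM uK cK.
exists T, hT, m; split=> //; have [w [x [hc e]]] := realised T hT m hm.
by exists w, x, hc; rewrite e.
Qed.
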